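(* Let $\xi>0$ be a constant, $\delta=\xi m$, and let $c_0=c_0(\xi)$ be a sufficiently large constant and $c_1,c_2$ constants satisfying $$(c_0-c_1-1)\Big(1-\frac1{\xi+2}\Big)<c_1<2(c_0-c_1-1)\Big(1-\frac2{2+\xi}\Big),\qquad c_2=c_1\frac{\ln(\xi(1+\xi/2)+1)}{\ln\big((7+400/\xi)^2(\xi(1+\xi/2)+1)\big)}.$$ Let $r_0=n^{-1/2}(\ln n)^{c_0}$ and $t_r=\frac{12(\ln n)^2n^{c_1/c_0}}{r^{2(1-c_1/c_0)}}$. In the base model with parameters $m,r,\delta$, if $r\ge r_0$, then for every $u\in S$ and all $t\ge t_r$, $$\Pr\Big[\big|T_t(u)-(2+\xi)mA_rt\big|\ge \frac{1}{(nr^2)^{c_2/(2c_0)}}\,mA_rt\Big]=O(n^{-2}).$$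
   Context: Asymptotics are as $n\to\infty$; $m=m(n)$ and $r=r(n)$ may depend on $n$, and $t\le n$. Let $S$ be a sphere of unit area (radius $\frac1{2\sqrt\pi}$), $\|\cdot\|$ the angular distance on $S$, $B_R(v)=\{u\in S:\|u-v\|\le R\}$, and $A_R=\mathrm{area}(B_R(v))$ (independent of $v$). A self-loop counts as degree $1$. All graphs are multigraphs; $V_t=\{x_1,\dots,x_t\}$ is the vertex set at time $t$. $n$ is the number of vertices generated; $m$ is a positive integer. Base model. $G_1$ consists of a uniformly random point $x_1\in S$ with $2m$ self-loops. At time $t+1$ ($t\ge1$), a new vertex $x_{t+1}$ is drawn uniformly from $S$ (independently of the past). If $B_r(x_{t+1})\cap V_t=\emptyset$, then $2m$ self-loops are added to $x_{t+1}$. Otherwise $m$ contacts $y_1^{t+1},\dots,y_m^{t+1}$ are chosen independently (with replacement) from $B_r(x_{t+1})\cap V_t$, with $$\Pr[y_i^{t+1}=v]=\frac{\deg_t(v)+\delta}{\sum_{w\in B_r(x_{t+1})\cap V_t}(\deg_t(w)+\delta)},$$ where $\deg_t(v)$ is the degree of $v$ in $G_t$, and the edges $(x_{t+1},y_i^{t+1})$ are added. For $u\in S$, $T_t(u)=\sum_{v\in B_r(u)\cap V_t}(\deg_t(v)+\delta)$. *)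

(* Defs.v *)
From HB Require Import structures.
From mathcomp Require Import all_boot all_order all_algebra.
From mathcomp Require Import all_classical all_reals all_analysis.

Set Implicit Arguments.
Unset Strict Implicit.
Unset Printing Implicit Defensive.

Import Order.TTheory GRing.Theory Num.Theory.
Import numFieldNormedType.Exports.

Local Open Scope classical_set_scope.
Local Open Scope ring_scope.

Notation vec3 R := (R * R * R)%type.

Section Sphere.
Variable R : realType.
Implicit Types (u v : vec3 R) (A : set (vec3 R)).

Definition dot u v : R := u.1.1 * v.1.1 + u.1.2 * v.1.2 + u.2 * v.2.

Definition enorm u : R := Num.sqrt (dot u u).

Definition dilate (s : R) u : vec3 R := (s * u.1.1, s * u.1.2, s * u.2).

(* Radius of the sphere of unit area, 4 pi rho ^ 2 = 1. *)
Definition rho : R := (2 * Num.sqrt pi)^-1.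

Definition sphere : set (vec3 R) := [set u | enorm u = rho].

(* The angle at the centre of the sphere, a number in [0, pi] (not the length
   of the great-circle arc, which is rho times smaller). *)
Definition angdist u v : R := acos (dot u v / (enorm u * enorm v)).

Definition cap u (r : R) : set (vec3 R) :=
  [set v | sphere v /\ angdist u v <= r].

Definition cone A : set (vec3 R) :=
  [set dilate s v | s in `]0, 1] & v in A].

Definition volume : set (vec3 R) -> \bar R :=
  ((lebesgue_measure \x lebesgue_measure) \x lebesgue_measure)%E.

(* Surface area on the sphere of radius rho: the cone with apex 0 over a piece
   of area a has volume a * rho / 3.  The total area of the sphere is 1, so
   this is also the uniform distribution on the sphere. *)
Definition area A : \bar R :=
  ((3 / rho)%:E * volume (cone (A `&` sphere)))%E.

(* By rotation invariance, any other centre gives the same value. *)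
Definition cap_area (r : R) : R := fine (area (cap (0, 0, rho) r)).

End Sphere.

(* Vertices are numbered from 0: vertex v, located at x v, is the vertex born at
   time v + 1, and V_t is the set of vertices v < t.  The i-th contact of vertex
   v is the vertex y v i. *)
Section Graph.
Variables (R : realType) (m : nat) (r delta : R).
Variables (x : nat -> vec3 R) (y : nat -> 'I_m -> nat).

Definition neighbours (t : nat) (u : vec3 R) : seq nat :=
  [seq v <- iota 0 t | x v \in cap u r].

(* The list of edges of G_t, a self-loop at v being (v, v).  Vertex t is the one
   added between times t and t + 1; its contacts y t i are only used when
   there is a vertex of V_t within distance r of it.  In particular, edges 1
   consists of 2m self-loops at vertex 0. *)
Fixpoint edges (t : nat) : seq (nat * nat) :=
  if t is s.+1 then
    edges s ++
      (if nilp (neighbours s (x s)) then nseq (2 * m) (s, s)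
       else [seq (s, y s i) | i <- enum 'I_m])
  else [::].

(* A self-loop counts once. *)
Definition degree (t v : nat) : nat :=
  count (fun e => (e.1 == v) || (e.2 == v)) (edges t).

Definition weight (t v : nat) : R := (degree t v)%:R + delta.

(* T_t(u) *)
Definition total_weight (t : nat) (u : vec3 R) : R :=
  \sum_(v <- neighbours t u) weight t v.

Definition contact_prob (t v : nat) : R :=
  if v \in neighbours t (x t) then weight t v / total_weight t (x t) else 0.

End Graph.

Section Process.
Variables (R : realType) (m : nat) (r delta : R).
Variables (d : measure_display) (Omega : measurableType d).
Variable P : probability Omega R.
Variables (x : nat -> {RV P >-> vec3 R}) (y : nat -> 'I_m -> {RV P >-> nat}).

Definition positions (w : Omega) : nat -> vec3 R := fun v => x v w.
Definition contacts (w : Omega) : nat -> 'I_m -> nat := fun v i => y v i w.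

(* The sigma-algebra generated by the positions of the vertices s < a and the
   contacts of the vertices s < b. *)
Definition history (a b : nat) : set (set Omega) :=
  <<s [set E | (exists s B, [/\ (s < a)%N, measurable B & E = x s @^-1` B]) \/
               (exists s i k, (s < b)%N /\ E = y s i @^-1` [set k])] >>.

Definition has_neighbour (t : nat) : set Omega :=
  [set w | ~~ nilp (neighbours r (positions w) t (x t w))].

(* (x, y) is a run of the model up to time n.  The last field gives the joint
   law of the m contacts of vertex t conditionally on everything that precedes
   their choice, including x t: on the event that there is something to choose
   from, they are independent with law contact_prob t. *)
Record base_model (n : nat) : Prop := BaseModel {
  on_sphere : forall t w, (t < n)%N -> sphere (x t w);
  new_vertex_law : forall t E B, (t < n)%N ->
    history t t E -> measurable B ->
    P (E `&` x t @^-1` B) = (P E * area B)%E;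
  contacts_law : forall t E (k : 'I_m -> nat), (t < n)%N ->
    history t.+1 t E ->
    P (E `&` has_neighbour t `&` [set w | forall i, y t i w = k i]) =
      (\int[P]_(w in E `&` has_neighbour t)
        (\prod_(i < m)
          contact_prob r delta (positions w) (contacts w) t (k i))%:E)%E
}.

End Process.

Section Thresholds.
Variable R : realType.

Definition r_min (c0 : R) (n : nat) : R :=
  n%:R `^ (- 2^-1) * ln n%:R `^ c0.

Definition t_min (c0 c1 : R) (n : nat) (r : R) : R :=
  12 * ln n%:R ^+ 2 * n%:R `^ (c1 / c0) / r `^ (2 * (1 - c1 / c0)).

End Thresholds.

(* Main.v *)
Require Import Defs.
From HB Require Import structures.
From mathcomp Require Import all_boot all_order all_algebra.
From mathcomp Require Import all_classical all_reals all_analysis.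
From mathcomp Require Import measurable_realfun ring lra zify.

(* Conditionally on the past, T_t(u) increases on average by
     (1 + xi) m A + m \int_(z) (sum of the weights near both u and z) / T_t(z).
   If T_t(z) is within a factor 1 + e of (2 + xi) m A t for all points z outside
   a set of small area, this is an affine function of T_t(u) up to a relative
   error e / (2 + xi) only, so that the error contracts: starting from a rough
   bound at time t1, it may be required to decrease like eps_t ~ t^(- kappa),
   provided (2 + xi) (1 - kappa) exceeds a constant and
   2 kappa + 2 / (2 + xi) <= 1; kappa = xi / (2 xi + 6) satisfies both, and is at
   least c2 / (2 c1). For each fixed u, exp (lam_t (T_t(u) - B_t)) with a
   deterministic barrier B following the drift is a supermartingale as long as
   the exceptional sets stay small, so that u is exceptional at time t with
   probability O(n^(-5)) on that event. By Fubini and Markov the exceptional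
   sets then have area at most n^(-2) at all times up to n, with probability
   1 - O(n^(-2)).
   The uniform law gives all caps of radius r the same area because the volume
   is invariant under shears, and rotations are products of shears. *)

Set Implicit Arguments.
Unset Strict Implicit.
Unset Printing Implicit Defensive.

Import Order.TTheory GRing.Theory Num.Theory.
Import numFieldNormedType.Exports.
Import HBNNSimple.

Local Open Scope classical_set_scope.
Local Open Scope ring_scope.

(** * Expectations *)

(** The drift at u involves T_t(z) for all z near u, so a bound at one point presupposes bounds at
    others. The start is therefore asymmetric. Until t0, of order ln n / A, no lower bound on T_t is
    at hand and the drift is bounded by the area of a wider cap. A lower bound needs no information:
    the weight of newcomers alone grows by (1 + xi) m A per step, and since the window for c1 forces
    xi > 1, this exceeds 2/3 of (2 + xi) m A. It limits the contact probabilities and so yields the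
    upper bound, whose memory of the rough phase has died out by t1, about 120^6 t0; from then on
    the two bounds feed each other. The model prescribes laws on events of the past only. No
    conditional expectations are formed: identities are stated for integrals against nonnegative
    functions measurable for the past. Of the two factors ln n in t_r, one belongs to the scale of
    t1 and the other beats all constants. For r >= pi caps are the whole sphere, and this case is
    treated apart. *)

Section WeightCongruence.
Context d d' (T : measurableType d) (S : measurableType d') (R : realType).
Variable mu : {measure set T -> \bar R}.
Variable phi : T -> S.
Hypothesis mphi : measurable_fun setT phi.

Local Open Scope ereal_scope.
Let mpre E : measurable E -> measurable (phi @^-1` E).
Proof. by move=> mE; rewrite -[X in measurable X]setTI; exact: mphi. Qed.

(** Stands in for conditional expectation: with [phi] the identity into a coarser sigma-algebra, [f]
    and [g] have the same conditional expectation, hence the same integral against any nonnegative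
    function of [phi]. *)
Lemma integral_weight_congr (f g : T -> R) (H : S -> R) :
  (forall x, 0 <= f x)%R -> (forall x, 0 <= g x)%R ->
  measurable_fun setT f -> measurable_fun setT g ->
  (forall E, measurable E -> \int[mu]_(x in phi @^-1` E) (f x)%:E =
     \int[mu]_(x in phi @^-1` E) (g x)%:E) ->
  measurable_fun setT H -> (forall x, (0 <= H x)%R) ->
  \int[mu]_x (H (phi x) * f x)%:E = \int[mu]_x (H (phi x) * g x)%:E.
Proof.
move=> f0 g0 mf mg fg mH H0.
have mEH : measurable_fun setT (fun x => (H x)%:E) by exact/measurable_EFinP.
pose h := nnsfun_approx measurableT mEH.
have mh n : measurable_fun setT (h n \o phi) by exact: measurableT_comp.
(* Once [H] is approximated by simple functions, the weight enters only through its integrals over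
   preimages under [phi]. *)
have key (k : T -> R) : (forall x, 0 <= k x)%R -> measurable_fun setT k ->
   \int[mu]_x (H (phi x) * k x)%:E = limn (fun n =>
    \sum_(y \in range (h n)) (y%:E * \int[mu]_(x in phi @^-1` ((h n) @^-1` [set y])) (k x)%:E)).
  move=> k0 mk.
  transitivity (\int[mu]_x (limn (fun n => (h n (phi x) * k x)%:E))).
    apply: eq_integral => x _.
    apply/esym/cvg_lim => //.
    have hx := @cvg_nnsfun_approx _ _ R setT measurableT _ mEH
      (fun x _ => H0 x) (phi x) Logic.I.
    apply: cvg_EFin; first by near=> n.
    apply: cvgM; last exact: cvg_cst.
    by move/fine_cvg : hx.
  rewrite monotone_convergence //=; last 3 first.
  - by move=> n; apply/measurable_EFinP; exact: (measurable_funM (mh n) mk).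
  - by move=> n x _; rewrite lee_fin mulr_ge0.
  - move=> x _ a b ab; rewrite lee_fin ler_wpM2r//.
    exact/lefP/nd_nnsfun_approx.
  congr (limn _); apply/funext => n.
  have mhy (y : R) : measurable (phi @^-1` (h n @^-1` [set y])) by exact: mpre.
  transitivity (\int[mu]_x (\sum_(y \in range (h n))
     ((y * (\1_(phi @^-1` (h n @^-1` [set y])) x * k x))%:E))).
    apply: eq_integral => x _.
    rewrite fsumEFin// [in LHS](fimfunE (h n)) /=.
    rewrite mulr_fsuml//; congr EFin; apply: eq_fsbigr => y _ /=.
    by rewrite mulrA.
  rewrite ge0_integral_fsum//; last 2 first.
  - move=> y; apply/measurable_EFinP; apply: measurable_funM => //.
    by apply: measurable_funM => //; exact: measurable_indic.
  - move=> y x _; rewrite lee_fin mulrA mulr_ge0//.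
    rewrite indicE; case: (boolP (x \in _)) => /=; rewrite ?mulr0//.
    by rewrite inE /= => <-; rewrite mulr1.
  apply: eq_fsbigr => y; rewrite inE => -[s _ <-].
  have hs0 : (0 <= h n s)%R by [].
  under eq_integral do rewrite EFinM.
  rewrite ge0_integralZl//; last 2 first.
  - apply/measurable_EFinP; apply: measurable_funM => //; exact: measurable_indic.
  - by move=> x _; rewrite lee_fin mulr_ge0.
  congr (_ * _).
  rewrite [RHS]integral_mkcond; apply: eq_integral => x _.
  rewrite patchE indicE. case: ifP => _; rewrite ?mul1r ?mul0r//.
rewrite !key//; congr (limn _); apply/funext => n.
by apply: eq_fsbigr => y _; rewrite fg.
Unshelve. all: by end_near.
Qed.
End WeightCongruence.

Section Independence.
Context d d' d'' (T : measurableType d) (S : measurableType d')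
  (V : measurableType d'') (R : realType).
Variables (P : probability T R) (nu : probability V R).
Variables (phi : T -> S) (X : T -> V).
Hypotheses (mphi : measurable_fun setT phi) (mX : measurable_fun setT X).
Local Open Scope ereal_scope.
Hypothesis indep : forall E B, measurable E -> measurable B ->
  P (phi @^-1` E `&` X @^-1` B) = P (phi @^-1` E) * nu B.

Let phi_mfun : {mfun T >-> S} := HB.pack phi (isMeasurableFun.Build _ _ _ _ _ mphi).
Let pair_mfun : {mfun T >-> (S * V)%type} := HB.pack (fun w => (phi w, X w))
  (isMeasurableFun.Build _ _ _ _ _ (measurable_fun_pair mphi mX)).

(** The law of the pair agrees on rectangles with the product of the law of [phi] and [nu], hence is
    that product, and Tonelli applies. *)
Lemma integral_independent (F : S * V -> \bar R) :
  measurable_fun setT F -> (forall z, 0 <= F z) ->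
  \int[P]_w F (phi w, X w) = \int[P]_w \int[nu]_v F (phi w, v).
Proof.
move=> mF F0.
transitivity (\int[distribution P pair_mfun]_z F z).
  by rewrite ge0_integral_distribution.
transitivity (\int[distribution P phi_mfun]_s \int[nu]_v F (s, v)); last first.
  rewrite ge0_integral_distribution//.
    exact: measurable_fun_fubini_tonelli_F.
  by move=> s; exact: integral_ge0.
rewrite -[RHS](@fubini_tonelli1 _ _ _ _ _ (distribution P phi_mfun) nu)//.
apply/esym/eq_measure_integral => A mA _.
exact: product_measure_unique.
Qed.
End Independence.

Section Bounded.
Context d (T : measurableType d) (R : realType).

(** Under a probability this gives integrability at once, and it is stable under the algebraic
    operations and [expR]. *)
Definition bounded_measurable (f : T -> R) :=
  measurable_fun setT f /\ exists c : R, forall x, `|f x| <= c.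

Lemma bounded_measurable_cst c : bounded_measurable (cst c).
Proof. by split; [exact: measurable_cst|exists `|c|]. Qed.

Lemma bounded_measurableD f g : bounded_measurable f -> bounded_measurable g ->
  bounded_measurable (fun x => f x + g x).
Proof.
move=> [mf [a fa]] [mg [b gb]]; split; first exact: measurable_funD.
by exists (a + b) => x; rewrite (le_trans (ler_normD _ _))// lerD.
Qed.

Lemma bounded_measurableM f g : bounded_measurable f -> bounded_measurable g ->
  bounded_measurable (fun x => f x * g x).
Proof.
move=> [mf [a fa]] [mg [b gb]]; split; first exact: measurable_funM.
by exists (a * b) => x; rewrite normrM ler_pM.
Qed.

Lemma bounded_measurableZ c f : bounded_measurable f ->
  bounded_measurable (fun x => c * f x).
Proof. exact/bounded_measurableM/bounded_measurable_cst. Qed.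

Lemma bounded_measurable_sum I (s : seq I) (Q : pred I) (f : I -> T -> R) :
  (forall i, Q i -> bounded_measurable (f i)) ->
  bounded_measurable (fun x => \sum_(i <- s | Q i) f i x).
Proof.
move=> bf; elim: s => [|i s ih].
  by under eq_fun do rewrite big_nil; exact: bounded_measurable_cst.
under eq_fun do rewrite big_cons.
by case Qi: (Q i) => //; apply: bounded_measurableD => //; exact: bf.
Qed.

Lemma bounded_measurable_indic A : measurable A -> bounded_measurable \1_A.
Proof.
move=> mA; split; first exact: measurable_indic.
by exists 1 => x; rewrite indicE; case: (_ \in _); rewrite ?normr1 ?normr0.
Qed.

Lemma bounded_measurable_expR f : bounded_measurable f ->
  bounded_measurable (fun x => expR (f x)).
Proof.
move=> [mf [a fa]]; split; first exact: measurableT_comp.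
by exists (expR a) => x; rewrite ger0_norm ?expR_ge0// ler_expR (le_trans (ler_norm _)).
Qed.

Variable P : probability T R.

Lemma bounded_measurable_integrable f :
  bounded_measurable f -> P.-integrable setT (EFin \o f).
Proof.
move=> [mf [a fa]]; apply: measurable_bounded_integrable => //.
  by rewrite ltey_eq fin_num_measure.
exists a; split; [exact: num_real|move=> b ab x _ /=].
exact: le_trans (fa x) (ltW ab).
Qed.

Lemma expectD f g : bounded_measurable f -> bounded_measurable g ->
  \int[P]_x (f x + g x) = \int[P]_x f x + \int[P]_x g x.
Proof. by move=> bf bg; rewrite RintegralD//; exact: bounded_measurable_integrable. Qed.

Lemma expectZ c f : bounded_measurable f ->
  \int[P]_x (c * f x) = c * \int[P]_x f x.
Proof. by move=> bf; rewrite RintegralZl//; exact: bounded_measurable_integrable. Qed.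

Lemma expect_sum I (s : seq I) (Q : pred I) (f : I -> T -> R) :
  (forall i, Q i -> bounded_measurable (f i)) ->
  \int[P]_x (\sum_(i <- s | Q i) f i x) = \sum_(i <- s | Q i) \int[P]_x f i x.
Proof.
move=> bf; elim: s => [|i s ih].
  rewrite big_nil -[RHS](mul0r (\int[P]_x 0 : R)) -expectZ; last exact: bounded_measurable_cst.
  by apply: eq_Rintegral => x _; rewrite big_nil mul0r.
rewrite big_cons -ih; case Qi: (Q i); under eq_Rintegral do rewrite big_cons Qi//.
  by rewrite expectD//; [exact: bf|exact: bounded_measurable_sum].
by [].
Qed.

Lemma expect_le f g : bounded_measurable f -> bounded_measurable g ->
  (forall x, f x <= g x) -> \int[P]_x f x <= \int[P]_x g x.
Proof. by move=> bf bg fg; apply: le_Rintegral => //; exact: bounded_measurable_integrable. Qed.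

Lemma expect_indic A : measurable A -> (\int[P]_x \1_A x)%:E = P A.
Proof.
move=> mA; rewrite /Rintegral integral_indic// setIT fineK//.
exact: fin_num_measure.
Qed.

Lemma expect_cst c : \int[P]_x c = c.
Proof. rewrite Rintegral_cst//.
by rewrite -[X in _ * X]/(fine (P setT)) probability_setT mulr1. Qed.

Lemma expectE f : bounded_measurable f -> (\int[P]_x f x)%:E = (\int[P]_x (f x)%:E)%E.
Proof.
move=> bf; rewrite fineK//; apply: integrable_fin_num => //.
exact: bounded_measurable_integrable.
Qed.
End Bounded.

Section ExpectIndependence.
Context d d' d'' (T : measurableType d) (S : measurableType d')
  (V : measurableType d'') (R : realType).
Variables (P : probability T R) (nu : probability V R).
Variables (phi : T -> S) (X : T -> V).
Hypotheses (mphi : measurable_fun setT phi) (mX : measurable_fun setT X).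
Hypothesis indep : forall E B, measurable E -> measurable B ->
  P (phi @^-1` E `&` X @^-1` B) = (P (phi @^-1` E) * nu B)%E.

Lemma bounded_measurable_section (F : S * V -> R) s :
  bounded_measurable F -> bounded_measurable (fun v => F (s, v)).
Proof.
move=> [mF [c cF]]; split; last by exists c => v.
exact: measurableT_comp.
Qed.

Lemma bounded_measurable_integral (F : S * V -> R) :
  bounded_measurable F -> (forall z, 0 <= F z) ->
  bounded_measurable (fun s => \int[nu]_v F (s, v)).
Proof.
move=> bF F0; split; last first.
  have [mF [c cF]] := bF.
  exists c => s; rewrite ger0_norm ?Rintegral_ge0//.
  rewrite -[leRHS](expect_cst nu); apply: expect_le.
  - exact: bounded_measurable_section.
  - exact: bounded_measurable_cst.
  - by move=> v; exact: le_trans (ler_norm _) (cF _).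
apply/measurable_EFinP.
rewrite (_ : EFin \o _ = fubini_F nu (EFin \o F)); last first.
  by apply/funext => s /=; rewrite expectE//; exact: bounded_measurable_section.
apply: measurable_fun_fubini_tonelli_F; last by move=> z; rewrite lee_fin.
by apply/measurable_EFinP; case: bF.
Qed.

Lemma expect_independent (F : S * V -> R) :
  bounded_measurable F -> (forall z, 0 <= F z) ->
  \int[P]_w F (phi w, X w) = \int[P]_w \int[nu]_v F (phi w, v).
Proof.
move=> bF F0; rewrite {1}/Rintegral.
rewrite (@integral_independent _ _ _ _ _ _ _ _ nu _ _ mphi mX indep (EFin \o F)).
- congr fine; apply: eq_integral => w _; rewrite expectE//.
  exact: bounded_measurable_section.
- by apply/measurable_EFinP; case: bF.
- by move=> z; rewrite lee_fin.
Qed.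
End ExpectIndependence.

(** * Increments of the total weight *)

Section GraphLemmas.
Variables (R : realType) (m : nat) (r delta : R).
Variables (x : nat -> vec3 R) (y : nat -> 'I_m -> nat).
Hypotheses (delta_ge0 : 0 <= delta).

Let nb t := neighbours r x t (x t).
Let T := total_weight r delta x y.

(** The model constrains contacts only in law: on a null event they need not be earlier vertices,
    and without neighbours they are arbitrary. The pathwise recursions rest on this predicate. *)
Definition contacts_earlier (s : nat) : bool :=
  ~~ nilp (nb s) ==> [forall i, y s i < s]%N.

Lemma total_weightE t u :
  T t u = \sum_(0 <= v < t) \1_(cap u r) (x v) * weight r delta x y t v.
Proof.
rewrite /T /total_weight /neighbours big_filter /index_iota subn0 big_mkcond.
by apply: eq_bigr => v _; rewrite indicE; case: (_ \in _); rewrite ?mul1r ?mul0r.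
Qed.

Lemma degreeS t v : degree r x y t.+1 v = (degree r x y t v +
  (if nilp (nb t) then 2 * m * (v == t) else
     \sum_(i < m) ((v == t) || (y t i == v))))%N.
Proof.
rewrite /degree /= count_cat; congr addn.
rewrite -/(nb t); case: ifP => _.
  by rewrite count_nseq /= orbb eq_sym mulnC.
rewrite count_map -sum1_count big_mkcond /= big_enum /=.
by apply: eq_bigr => i _; rewrite eq_sym; case: ifP.
Qed.

Lemma degree_eq0 t v : (forall s, (s < t)%N -> contacts_earlier s) -> (t <= v)%N ->
  degree r x y t v = 0%N.
Proof.
elim: t => [//|t ih] ok tv; rewrite degreeS ih//; last 2 first.
- by move=> s st; apply: ok; exact: ltnW.
- exact: ltnW.
have := ok t (ltnSn t); rewrite /contacts_earlier.
have -> : (v == t) = false by apply/negbTE; rewrite neq_ltn tv orbT.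
case: ifP => [_ _|_ /forallP yt]; first by rewrite muln0.
rewrite big1// => i _; apply/eqP; rewrite eqb0; apply/eqP => yv.
by have := yt i; rewrite yv ltnNge (ltnW tv).
Qed.

Lemma degree_ub t v : (degree r x y t v <= 2 * m * t)%N.
Proof.
elim: t => [//|t ih]; rewrite degreeS mulnS addnC leq_add//.
case: ifP => _; first by case: eqP; rewrite ?muln1 ?muln0.
rewrite (@leq_trans m)//; last by rewrite leq_pmull.
rewrite -[leqRHS]card_ord -sum1_card leq_sum// => i _; exact: leq_b1.
Qed.

Lemma weight_ge0 t v : 0 <= weight r delta x y t v.
Proof. by rewrite addr_ge0. Qed.

Lemma total_weight_ge0 t u : 0 <= T t u.
Proof. by apply: sumr_ge0 => v _; exact: weight_ge0. Qed.

Lemma total_weight_ub t u : T t u <= (t * (2 * m * t))%:R + t%:R * delta.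
Proof.
rewrite total_weightE natrM -mulrDr.
apply: (@le_trans _ _ (\sum_(0 <= v < t) ((2 * m * t)%:R + delta))).
  apply: ler_sum_nat => v _.
  rewrite -[leRHS]mul1r ler_pM ?weight_ge0//.
  by rewrite lerD2r ler_nat degree_ub.
by rewrite sumr_const_nat subn0 mulr_natl.
Qed.

Definition increment (t : nat) (u : vec3 R) : R :=
  \1_(cap u r) (x t) * (delta + m%:R + m%:R * (nilp (nb t))%:R) +
  (~~ nilp (nb t))%:R *
    \sum_(i < m) \sum_(0 <= v < t) (y t i == v)%:R * \1_(cap u r) (x v).

(** The steps before t matter too: no contact made before its birth may point to vertex t, which
    then enters with its own edges only. *)
Lemma total_weightS t u : (forall s, (s <= t)%N -> contacts_earlier s) ->
  T t.+1 u = T t u + increment t u.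
Proof.
move=> ok; rewrite !total_weightE big_nat_recr//= /weight /increment.
rewrite !degreeS eqxx [X in _ + X = _]/=.
rewrite [degree _ _ _ t t]degree_eq0//; last by move=> s st; apply/ok/ltnW.
rewrite addrCA [in LHS]addrC; congr (_ + _).
  congr (_ * _); rewrite addrC -addrA add0n; congr (_ + _).
  case: ifP => _; rewrite ?mulr1 ?mulr0 ?addr0.
    by rewrite muln1 mul2n -addnn natrD.
  by rewrite sum1_card card_ord.
rewrite exchange_big /= mulr_sumr -big_split /=.
apply: eq_big_nat => v /andP[_ vt].
rewrite degreeS (ltn_eqF vt) natrD addrAC mulrDr; congr (_ + _).
rewrite -mulr_suml mulrA mulrC; congr (_ * _).
case: ifP => _; first by rewrite muln0 mul0r.
by rewrite mul1r natr_sum; apply: eq_bigr.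
Qed.

Lemma increment_ge0 t u : 0 <= increment t u.
Proof.
have i0 (A : set (vec3 R)) z : 0 <= \1_A z :> R by rewrite indicE; case: (_ \in _).
rewrite /increment addr_ge0// mulr_ge0//; first by rewrite !addr_ge0// mulr_ge0.
by apply: sumr_ge0 => i _; apply: sumr_ge0 => v _; rewrite mulr_ge0.
Qed.

(** A vertex with contacts has degree m and adds at most m to the degrees of others; an isolated one
    has degree 2m and adds nothing. *)
Lemma increment_ub t u : increment t u <= 2 * m%:R + delta.
Proof.
have i0 (A : set (vec3 R)) z : 0 <= \1_A z :> R by rewrite indicE; case: (_ \in _).
have i1 (A : set (vec3 R)) z : \1_A z <= 1 :> R by rewrite indicE; case: (_ \in _).
have S1 : \sum_(i < m) \sum_(0 <= v < t) (y t i == v)%:R * \1_(cap u r) (x v) <= m%:R :> R.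
  rewrite -[leRHS]mul1r -[in leRHS](card_ord m) mulr_natr -sumr_const; apply: ler_sum => i _.
  apply: (@le_trans _ _ (\sum_(0 <= v < t) (y t i == v)%:R)).
    by apply: ler_sum => v _; rewrite ler_piMr.
  have [yt|yt] := ltnP (y t i) t.
    rewrite (bigD1_seq (y t i))/= ?mem_index_iota ?iota_uniq// eqxx big1 ?addr0// => v.
    by rewrite eq_sym => /negbTE ->.
  rewrite big_nat big1// => v vt; rewrite gtn_eqF//; exact: leq_trans vt yt.
rewrite /increment; case: (nilp _) => /=; rewrite ?mul0r ?mul1r ?mulr1 ?mulr0 ?addr0.
  rewrite -[leRHS]mul1r ler_pM// ?addr_ge0//; by lra.
have : \1_(cap u r) (x t) * (delta + m%:R) <= delta + m%:R.
  by rewrite ler_piMl// addr_ge0.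
lra.
Qed.
End GraphLemmas.

Lemma measurable_sum_in d (T : measurableType d) (R : realType) (I : eqType)
    (s : seq I) (h : I -> T -> R) :
  (forall i, i \in s -> measurable_fun setT (h i)) ->
  measurable_fun setT (fun x => \sum_(i <- s) h i x).
Proof.
elim: s => [|i s ih] mh.
  by under eq_fun do rewrite big_nil; exact: measurable_cst.
under eq_fun do rewrite big_cons.
apply: measurable_funD; first by apply: mh; rewrite mem_head.
by apply: ih => j js; apply: mh; rewrite inE js orbT.
Qed.

(** * Measurability of the graph quantities *)

Section GraphMeasurability.
Variables (R : realType) (m : nat) (r delta : R).
Hypotheses (delta_ge0 : 0 <= delta).
Hypothesis measurable_adjacency : measurable [set z : vec3 R * vec3 R | cap z.1 r z.2].

Lemma measurable_cap u : measurable (cap u r).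
Proof.
have /= := @measurable_fun_pair _ _ _ (vec3 R) (vec3 R) (vec3 R) (cst u) id
  (measurable_cst _) (@measurable_id _ _ _) measurableT _ measurable_adjacency.
by rewrite setTI.
Qed.

Variables (d : measure_display) (S : measurableType d).

(** [S] is arbitrary because it will be the sample space, a [past], or the product of a [past] with
    the space of positions. *)
Lemma measurable_cap_indic (f g : S -> vec3 R) :
  measurable_fun setT f -> measurable_fun setT g ->
  measurable_fun setT (fun s => \1_(cap (f s) r) (g s) : R).
Proof.
move=> mf mg.
rewrite (_ : (fun s => _) = \1_[set z : vec3 R * vec3 R | cap z.1 r z.2] \o
   (fun s => (f s, g s))); last first.
  by apply/funext => s; rewrite /= !indicE; congr (_%:R); apply/idP/idP; rewrite !inE.
apply: measurableT_comp; first exact: measurable_indic.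
exact: measurable_fun_pair.
Qed.

Variables (x : nat -> S -> vec3 R) (y : nat -> 'I_m -> S -> nat).
Let xs s : nat -> vec3 R := fun v => x v s.
Let ys s : nat -> 'I_m -> nat := fun v i => y v i s.

(** As a product of indicators, emptiness is visibly measurable. *)
Lemma nilp_neighboursE (p : nat -> vec3 R) t u :
  (nilp (neighbours r p t u))%:R = \prod_(0 <= v < t) (1 - \1_(cap u r) (p v)) :> R.
Proof.
rewrite /neighbours /index_iota subn0.
elim: (iota 0 t) => [|v s ih]; first by rewrite big_nil.
rewrite /= big_cons -ih indicE; case: (_ \in _) => /=; first by rewrite subrr mul0r.
by rewrite subr0 mul1r.
Qed.

Lemma measurable_nilp_neighbours t (u : S -> vec3 R) :
  (forall v, (v < t)%N -> measurable_fun setT (x v)) -> measurable_fun setT u ->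
  measurable_fun setT (fun s => (nilp (neighbours r (xs s) t (u s)))%:R : R).
Proof.
move=> mx mu; under eq_fun do rewrite nilp_neighboursE.
apply: measurable_prod => v; rewrite mem_index_iota => /andP[_ vt].
apply: measurable_funB; first exact: measurable_cst.
by apply: measurable_cap_indic => //; exact: mx.
Qed.

Lemma measurable_contact_eq (f : S -> nat) v :
  measurable_fun setT f -> measurable_fun setT (fun s => (f s == v)%:R : R).
Proof.
move=> mf.
have mg : measurable_fun setT (fun k : nat => (k == v)%:R : R) by [].
exact: (measurableT_comp mg mf).
Qed.

Lemma measurable_degree t v :
  (forall v, (v < t)%N -> measurable_fun setT (x v)) ->
  (forall v i, (v < t)%N -> measurable_fun setT (y v i)) ->
  measurable_fun setT (fun s => (degree r (xs s) (ys s) t v)%:R : R).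
Proof.
elim: t => [|t ih] mx my; first exact: measurable_cst.
rewrite (_ : (fun s => _) = (fun s => (degree r (xs s) (ys s) t v)%:R +
   ((nilp (neighbours r (xs s) t (x t s)))%:R * (2 * m * (v == t))%N%:R +
   (1 - (nilp (neighbours r (xs s) t (x t s)))%:R) *
   \sum_(i < m) ((v == t)%:R + (v != t)%:R * (y t i s == v)%:R)))); last first.
  apply/funext => s; rewrite degreeS natrD; congr (_ + _).
  rewrite /xs /=; case: (nilp _) => /=; first by rewrite subrr mul0r addr0 mul1r.
  rewrite mul0r subr0 add0r mul1r natr_sum; apply: eq_bigr => i _.
  by case: (v == t) => /=; rewrite ?mul0r ?addr0 ?add0r ?mul1r.
apply: measurable_funD.
  by apply: ih => // *; [apply: mx|apply: my]; exact: ltnW.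
have mnil : measurable_fun setT (fun s => (nilp (neighbours r (xs s) t (x t s)))%:R : R).
  apply: measurable_nilp_neighbours; last exact: mx.
  by move=> w wt; apply: mx; exact: ltnW.
apply: measurable_funD; first by apply: measurable_funM => //; exact: measurable_cst.
apply: measurable_funM; first by apply: measurable_funB => //; exact: measurable_cst.
apply: measurable_sum => i; apply: measurable_funD; first exact: measurable_cst.
apply: measurable_funM; first exact: measurable_cst.
by apply: measurable_contact_eq; exact: my.
Qed.

Lemma measurable_total_weight t (u : S -> vec3 R) :
  (forall v, (v < t)%N -> measurable_fun setT (x v)) ->
  (forall v i, (v < t)%N -> measurable_fun setT (y v i)) ->
  measurable_fun setT u ->
  measurable_fun setT (fun s => total_weight r delta (xs s) (ys s) t (u s)).
Proof.
move=> mx my mu; under eq_fun do rewrite total_weightE.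
apply: measurable_sum_in => v; rewrite mem_index_iota => /andP[_ vt].
apply: measurable_funM; first by apply: measurable_cap_indic => //; exact: mx.
apply: measurable_funD; last exact: measurable_cst.
exact: measurable_degree.
Qed.
End GraphMeasurability.

(** * The conditional drift *)

Section Drift.
Variables (R : realType) (m : nat) (r delta : R).
Hypotheses (m_gt0 : (0 < m)%N) (delta_gt0 : 0 < delta).
Hypothesis measurable_adjacency : measurable [set z : vec3 R * vec3 R | cap z.1 r z.2].
Variable nu : probability (vec3 R) R.
Variables (A A2 : R) (wide : vec3 R -> set (vec3 R)).
Hypothesis nu_cap : forall u, sphere u -> nu (cap u r) = A%:E.
Hypothesis cap_sym : forall u v, sphere u -> sphere v -> cap u r v -> cap v r u.
Hypothesis measurable_wide : forall u, sphere u -> measurable (wide u).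
Hypothesis nu_wide : forall u, sphere u -> (nu (wide u) <= A2%:E)%E.
Hypothesis cap_wide : forall u, sphere u -> cap u r `<=` wide u.
Hypothesis cap_cap_wide : forall u v z, sphere u -> cap u r v -> cap v r z -> wide u z.

(* Conditionally on the past, E(T_{t+1}(u) - T_t(u) | x_t = z). *)
Definition drift_density (x : nat -> vec3 R) (y : nat -> 'I_m -> nat) t u z : R :=
  \1_(cap u r) z * (delta + m%:R + m%:R * (nilp (neighbours r x t z))%:R) +
  m%:R * \sum_(0 <= v < t) \1_(cap u r) (x v) * (\1_(cap (x v) r) z *
    weight r delta x y t v / total_weight r delta x y t z).

Definition drift x y t u : R := \int[nu]_z drift_density x y t u z.

Variables (x : nat -> vec3 R) (y : nat -> 'I_m -> nat) (t : nat).
Hypothesis x_sphere : forall v, (v < t)%N -> sphere (x v).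
Let T := total_weight r delta x y t.
Let w := weight r delta x y t.

Let i0 (B : set (vec3 R)) z : 0 <= \1_B z :> R.
Proof. by rewrite indicE; case: (_ \in _). Qed.
Let i1 (B : set (vec3 R)) z : \1_B z <= 1 :> R.
Proof. by rewrite indicE; case: (_ \in _). Qed.
Let w0 v : 0 <= w v. Proof. by apply: weight_ge0; exact: ltW. Qed.
Let T0 u : 0 <= T u. Proof. by apply: total_weight_ge0; exact: ltW. Qed.
Let iM (B C : set (vec3 R)) z : B `<=` C -> \1_B z <= \1_C z :> R.
Proof.
move=> BC; rewrite !indicE; case: (boolP (z \in B)) => //; rewrite inE => /BC Cz.
by rewrite mem_set.
Qed.

Lemma cap_indic_sym z v : sphere z -> (v < t)%N ->
  \1_(cap (x v) r) z = \1_(cap z r) (x v) :> R.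
Proof.
move=> sz vt; rewrite !indicE.
suff -> : (z \in cap (x v) r) = (x v \in cap z r) by [].
by apply/idP/idP; rewrite !inE; apply: cap_sym => //; exact: x_sphere.
Qed.

Lemma cap_indic_out z v : ~ sphere z -> \1_(cap (x v) r) z = 0 :> R.
Proof. by move=> sz; rewrite indicE memNset// => -[]. Qed.

Lemma nilp_total_weight z : nilp (neighbours r x t z) -> T z = 0.
Proof. by move/nilP => nz; rewrite /T /total_weight nz big_nil. Qed.

Lemma sum_cap_indic z : sphere z ->
  \sum_(0 <= v < t) \1_(cap (x v) r) z * w v = T z.
Proof.
move=> sz; rewrite /T total_weightE; apply: eq_big_nat => v /andP[_ vt].
by rewrite cap_indic_sym.
Qed.

Variable u : vec3 R.
Hypothesis u_sphere : sphere u.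

(** For z on the sphere, [shares z] is the probability that a given contact of a newcomer at z falls
    into the cap around u; its numerator [common z] is the weight lying near both u and z. *)
Let shares z := \sum_(0 <= v < t) \1_(cap u r) (x v) *
  (\1_(cap (x v) r) z * w v / T z).
Let common z := \sum_(0 <= v < t) \1_(cap u r) (x v) * (\1_(cap (x v) r) z * w v).

Lemma shares_ge0 z : 0 <= shares z.
Proof.
by apply: sumr_ge0 => v _; rewrite mulr_ge0// mulr_ge0 ?invr_ge0// mulr_ge0.
Qed.

Lemma sharesE z : shares z = common z / T z.
Proof.
by rewrite /shares /common mulr_suml; apply: eq_bigr => v _; rewrite !mulrA.
Qed.

Lemma common_ge0 z : 0 <= common z.
Proof. by apply: sumr_ge0 => v _; rewrite !mulr_ge0. Qed.

Lemma common_le z : common z <= T u.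
Proof.
rewrite /T total_weightE; apply: ler_sum_nat => v _; rewrite ler_wpM2l//.
by rewrite ler_piMl.
Qed.

Lemma common_out z : ~ sphere z -> common z = 0.
Proof. by move=> sz; apply: big1 => v _; rewrite cap_indic_out// mul0r mulr0. Qed.

Lemma common_le_total z : sphere z -> common z <= T z.
Proof.
move=> sz; rewrite -sum_cap_indic//; apply: ler_sum_nat => v _.
by rewrite ler_piMl// mulr_ge0.
Qed.

(** A vertex within r of both u and z puts z in the wide set, so off this set every term vanishes;
    on it the total weight near z is a bound. *)
Lemma common_wide z : common z <= T z * \1_(wide u) z.
Proof.
have [sz|sz] := pselect (sphere z); last first.
  by rewrite common_out// mulr_ge0.
rewrite indicE; case: (boolP (z \in _)) => [_|]; first by rewrite mulr1 common_le_total.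
rewrite mulr0 => /negP zw.
rewrite /common big1// => v _; rewrite !indicE.
case: (boolP (x v \in _)); last by rewrite mul0r.
case: (boolP (z \in cap _ _)); last by rewrite mul0r mulr0.
rewrite !inE => c1 c2; exfalso; apply: zw; rewrite inE; exact: cap_cap_wide c1.
Qed.

Lemma shares_le z :
  shares z <= (~~ nilp (neighbours r x t z))%:R * \1_(wide u) z.
Proof.
(* Where z has no neighbour the denominator is 0, and the quotient is 0 by convention. *)
rewrite sharesE; case: (boolP (nilp _)) => [/nilp_total_weight ->|_] /=.
  by rewrite invr0 mulr0 mul0r.
rewrite mul1r; have [Tz|Tz] := eqVneq (T z) 0; first by rewrite Tz invr0 mulr0.
by rewrite ler_pdivrMr ?lt_def ?Tz ?T0// mulrC common_wide.
Qed.

Let D z := drift_density x y t u z.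

Lemma DE z : D z = \1_(cap u r) z * (delta + m%:R + m%:R * (nilp (neighbours r x t z))%:R) +
  m%:R * shares z.
Proof. by []. Qed.

Lemma drift_density_ge_cap z : (delta + m%:R) * \1_(cap u r) z <= D z.
Proof.
have := shares_ge0 z; have := i0 (cap u r) z; rewrite DE => h1 h2.
have m0 : 0 <= m%:R :> R by [].
by rewrite mulrDr -addrA [leLHS]mulrC lerDl addr_ge0// mulr_ge0// mulr_ge0.
Qed.

Lemma drift_density_ge0 z : 0 <= D z.
Proof. by apply: le_trans (drift_density_ge_cap z); rewrite mulr_ge0// addr_ge0// ltW. Qed.

Lemma drift_density_le_wide z : D z <= (2 * m%:R + delta) * \1_(wide u) z.
Proof.
have m0 : 0 <= m%:R :> R by [].
have cw := iM z (cap_wide u_sphere).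
have := shares_le z; rewrite DE; have := i0 (cap u r) z.
case: (nilp _) => /= c0; rewrite ?mul0r ?mul1r ?mulr1 ?mulr0 ?addr0 => sh.
  have -> : shares z = 0 by apply/eqP; rewrite eq_le sh shares_ge0.
  rewrite mulr0 addr0 mulrC (_ : delta + m%:R + m%:R = 2 * m%:R + delta); last by ring.
  by rewrite ler_wpM2l// addr_ge0// ltW.
have : m%:R * shares z <= m%:R * \1_(wide u) z by rewrite ler_wpM2l.
have : (delta + m%:R) * \1_(cap u r) z <= (delta + m%:R) * \1_(wide u) z.
  by rewrite ler_wpM2l// addr_ge0// ltW.
lra.
Qed.

(** On [B] nothing is known of T(z), and the contacts, or the additional loops of an isolated
    vertex, cost at most 2m; off [B] the denominator is at least [L]. *)
Lemma drift_density_le (B : set (vec3 R)) (L : R) z : 0 < L ->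
  (sphere z -> ~ B z -> L <= T z) ->
  D z <= (delta + m%:R) * \1_(cap u r) z + 2 * m%:R * \1_B z + m%:R / L * common z.
Proof.
move=> L0 LT.
have m0 : 0 <= m%:R :> R by [].
have cz : 0 <= m%:R / L * common z by rewrite mulr_ge0 ?common_ge0// divr_ge0// ltW.
have [Bz|Bz] := pselect (B z).
  have -> : \1_B z = 1 :> R by rewrite indicE mem_set.
  rewrite DE mulr1; have := shares_le z; have := i0 (cap u r) z; have := i1 (cap u r) z.
  case: (nilp _) => /= c1 c0; rewrite ?mul0r ?mul1r ?mulr1 ?mulr0 ?addr0 => sh.
    have : m%:R * shares z <= 0 by rewrite mulr_ge0_le0.
    have : m%:R * \1_(cap u r) z <= m%:R :> R by rewrite ler_piMr.
    lra.
  have : m%:R * shares z <= m%:R :> R by rewrite ler_piMr// (le_trans sh).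
  lra.
have -> : \1_B z = 0 :> R by rewrite indicE memNset.
have [sz|sz] := pselect (sphere z); last first.
  rewrite DE sharesE common_out//.
  have -> : \1_(cap u r) z = 0 :> R by rewrite indicE memNset// => -[].
  by rewrite !(mul0r, mulr0, addr0).
have LTz := LT sz Bz; have Tz : 0 < T z := lt_le_trans L0 LTz.
(* T(z) >= L > 0 excludes an isolated newcomer. *)
rewrite DE; have -> : nilp (neighbours r x t z) = false.
  by apply/negbTE/negP => /nilp_total_weight Tz0; rewrite Tz0 ltxx in Tz.
rewrite /= !mulr0 !addr0 mulrC lerD2l sharesE mulrAC [leLHS]mulrA.
by rewrite ler_wpM2l ?mulr_ge0 ?common_ge0// lef_pV2.
Qed.

(** On [B] the second term is nonpositive because [common z <= T u], and the newcomer's own weight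
    suffices. *)
Lemma drift_density_ge (B : set (vec3 R)) (U : R) z : 0 < U ->
  (sphere z -> ~ B z -> T z <= U) ->
  (delta + m%:R) * \1_(cap u r) z + m%:R / U * (common z - T u * \1_B z) <= D z.
Proof.
move=> U0 TU.
have m0 : 0 <= m%:R :> R by [].
have mU0 : 0 <= m%:R / U by rewrite divr_ge0// ltW.
have h := drift_density_ge_cap z.
have [Bz|Bz] := pselect (B z).
  apply: le_trans h; have -> : \1_B z = 1 :> R by rewrite indicE mem_set.
  by rewrite gerDl mulr1 mulr_ge0_le0// subr_le0 common_le.
have -> : \1_B z = 0 :> R by rewrite indicE memNset.
have [sz|sz] := pselect (sphere z); last first.
  by apply: le_trans h; rewrite common_out// mulr0 subr0 mulr0 addr0.
rewrite mulr0 subr0 DE mulrDr -addrA mulrC lerD2l.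
apply: (@le_trans _ _ (m%:R * shares z)); last by rewrite lerDr !mulr_ge0.
rewrite sharesE mulrAC [leRHS]mulrA.
have [Tz|Tz] := eqVneq (T z) 0.
  have -> : common z = 0.
    by apply/eqP; rewrite eq_le common_ge0 andbT -Tz common_le_total.
  by rewrite !(mul0r, mulr0).
have Tz0 : 0 < T z by rewrite lt_def Tz T0.
by rewrite ler_wpM2l ?mulr_ge0 ?common_ge0// lef_pV2 ?posrE// TU.
Qed.

Hypothesis bounded_drift_density : bounded_measurable D.
Let mcap v : measurable (cap v r). Proof. exact: measurable_cap. Qed.
Let bcap v : bounded_measurable (\1_(cap v r) : vec3 R -> R).
Proof. exact: bounded_measurable_indic. Qed.

Lemma integral_cap v : sphere v -> \int[nu]_z \1_(cap v r) z = A.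
Proof. by move=> sv; apply: EFin_inj; rewrite expect_indic// nu_cap. Qed.

Lemma bounded_common : bounded_measurable common.
Proof.
apply: bounded_measurable_sum => v _.
by apply: bounded_measurableZ; apply: bounded_measurableM => //; exact: bounded_measurable_cst.
Qed.

(** Each vertex near u contributes its weight times the area of its own cap. That all these areas
    equal [A] makes the drift bounds affine in T(u). *)
Lemma integral_common : \int[nu]_z common z = A * T u.
Proof.
rewrite /common expect_sum; last first.
  by move=> v _; apply: bounded_measurableZ; apply: bounded_measurableM => //; exact: bounded_measurable_cst.
rewrite /T total_weightE mulr_sumr; apply: eq_big_nat => v /andP[_ vt].
under eq_Rintegral do rewrite mulrCA mulrC.
by rewrite expectZ// integral_cap; [rewrite mulrC|exact: x_sphere].
Qed.

(** Presupposes nothing about the weights elsewhere; this is the lower bound in force before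
    [t1]. *)
Lemma drift_ge_cap : (delta + m%:R) * A <= drift x y t u.
Proof.
rewrite -(integral_cap u_sphere) -expectZ//.
by apply: expect_le => //; [exact: bounded_measurableZ|exact: drift_density_ge_cap].
Qed.

(** The upper bound in force before [t0], while T(z) may still be 0 in many places. *)
Lemma drift_le_wide : drift x y t u <= (2 * m%:R + delta) * A2.
Proof.
have bw : bounded_measurable (\1_(wide u) : vec3 R -> R).
  by apply: bounded_measurable_indic; exact: measurable_wide.
apply: (@le_trans _ _ (\int[nu]_z ((2 * m%:R + delta) * \1_(wide u) z))).
  by apply: expect_le => //; [exact: bounded_measurableZ|exact: drift_density_le_wide].
rewrite expectZ// ler_wpM2l//; first by rewrite addr_ge0// ltW.
by rewrite -lee_fin expect_indic ?nu_wide//; exact: measurable_wide.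
Qed.

Lemma drift_le (B : set (vec3 R)) (L : R) : measurable B -> 0 < L ->
  (forall z, sphere z -> ~ B z -> L <= T z) ->
  drift x y t u <= (delta + m%:R) * A + 2 * m%:R * fine (nu B) + m%:R / L * (A * T u).
Proof.
move=> mB L0 LT; have bB := bounded_measurable_indic R mB.
have -> : fine (nu B) = \int[nu]_z \1_B z by rewrite -expect_indic.
rewrite -integral_common -(integral_cap u_sphere) -!expectZ//; last exact: bounded_common.
rewrite -!expectD//; first apply: expect_le => //.
all: try by [exact: bounded_measurableZ|exact: bounded_measurableZ bounded_common|apply: bounded_measurableD; exact: bounded_measurableZ].
  by apply: bounded_measurableD; [apply: bounded_measurableD; exact: bounded_measurableZ|exact: bounded_measurableZ bounded_common].
by move=> z; apply: drift_density_le => // sz Bz; exact: LT.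
Qed.

(** The common weight is discarded on [B], where it is at most T(u); this lowers the factor [A] to
    [A - nu B]. *)
Lemma drift_ge (B : set (vec3 R)) (U : R) : measurable B -> 0 < U ->
  (forall z, sphere z -> ~ B z -> T z <= U) ->
  (delta + m%:R) * A + m%:R / U * ((A - fine (nu B)) * T u) <= drift x y t u.
Proof.
move=> mB U0 TU; have bB := bounded_measurable_indic R mB.
have -> : fine (nu B) = \int[nu]_z \1_B z by rewrite -expect_indic.
rewrite mulrBl -integral_common [X in _ - X]mulrC -(integral_cap u_sphere).
apply: (@le_trans _ _ (\int[nu]_z ((delta + m%:R) * \1_(cap u r) z + m%:R / U * (common z + - T u * \1_B z)))); last first.
  apply: expect_le => //; last first.
    by move=> z; rewrite mulNr; apply: drift_density_ge => // sz Bz; exact: TU.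
  apply: bounded_measurableD; first exact: bounded_measurableZ.
  apply: bounded_measurableZ; apply: bounded_measurableD; first exact: bounded_common.
  exact: bounded_measurableZ.
rewrite expectD; [|exact: bounded_measurableZ|]; last first.
  apply: bounded_measurableZ; apply: bounded_measurableD; first exact: bounded_common.
  exact: bounded_measurableZ.
rewrite expectZ// expectZ; last first.
  by apply: bounded_measurableD; [exact: bounded_common|exact: bounded_measurableZ].
rewrite expectD; [|exact: bounded_common|exact: bounded_measurableZ].
by rewrite expectZ// mulNr.
Qed.
End Drift.

Section DriftMeasurability.
Variables (R : realType) (m : nat) (r delta : R).
Hypotheses (delta_ge0 : 0 <= delta).
Hypothesis measurable_adjacency : measurable [set z : vec3 R * vec3 R | cap z.1 r z.2].
Context d (S : measurableType d).
Variables (x : nat -> S -> vec3 R) (y : nat -> 'I_m -> S -> nat) (t : nat).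
Hypothesis mx : forall v, (v < t)%N -> measurable_fun setT (x v).
Hypothesis my : forall v i, (v < t)%N -> measurable_fun setT (y v i).
Let xs s : nat -> vec3 R := fun v => x v s.
Let ys s : nat -> 'I_m -> nat := fun v i => y v i s.

Lemma measurable_total_weight_pair :
  measurable_fun setT (fun q : S * vec3 R => total_weight r delta (xs q.1) (ys q.1) t q.2).
Proof.
apply: (@measurable_total_weight R m r delta measurable_adjacency _ (S * vec3 R)%type
  (fun v q => x v q.1) (fun v i q => y v i q.1) t (fun q => q.2)) => //.
- by move=> v vt; apply: measurableT_comp; [exact: mx|].
- by move=> v i vt; apply: measurableT_comp; [exact: my|].
- exact: measurable_snd.
Qed.

Lemma measurable_drift_density u :
  measurable_fun setT (fun q : S * vec3 R => drift_density r delta (xs q.1) (ys q.1) t u q.2).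
Proof.
have mx1 v : (v < t)%N -> measurable_fun setT (fun q : S * vec3 R => x v q.1).
  by move=> vt; apply: measurableT_comp; [exact: mx|].
have my1 v i : (v < t)%N -> measurable_fun setT (fun q : S * vec3 R => y v i q.1).
  by move=> vt; apply: measurableT_comp; [exact: my|].
have mci := @measurable_cap_indic R r measurable_adjacency _ (S * vec3 R)%type.
apply: measurable_funD.
  apply: measurable_funM.
    exact: (mci (cst u) snd (measurable_cst _) measurable_snd).
  apply: measurable_funD; first exact: measurable_cst.
  apply: measurable_funM; first exact: measurable_cst.
  apply: (@measurable_nilp_neighbours R r measurable_adjacency _ (S * vec3 R)%type
    (fun v q => x v q.1) t (fun q => q.2)) => //; exact: measurable_snd.
apply: measurable_funM; first exact: measurable_cst.
apply: measurable_sum_in => v; rewrite mem_index_iota => /andP[_ vt].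
apply: measurable_funM.
  exact: (mci (cst u) _ (measurable_cst _) (mx1 _ vt)).
apply: measurable_funM.
  apply: measurable_funM.
    exact: (mci _ snd (mx1 _ vt) measurable_snd).
  apply: measurable_funD; last exact: measurable_cst.
  exact: (@measurable_degree R m r measurable_adjacency _ (S * vec3 R)%type
    (fun v q => x v q.1) (fun v i q => y v i q.1) t).
(* The inverse becomes a power with exponent -1, measurable on the whole line. *)
under eq_fun => q do rewrite -powR_inv1 ?total_weight_ge0//.
exact: (measurableT_comp (measurable_powR _) measurable_total_weight_pair).
Qed.
End DriftMeasurability.

(** * The law of one step *)

Section History.
Variables (R : realType) (m : nat).
Context d (Omega : measurableType d) (P : probability Omega R).
Variables (x : nat -> {RV P >-> vec3 R}) (y : nat -> 'I_m -> {RV P >-> nat}).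

Definition history_gen (a b : nat) : set (set Omega) :=
  [set E | (exists s B, [/\ (s < a)%N, measurable B & E = x s @^-1` B]) \/
           (exists s i k, (s < b)%N /\ E = y s i @^-1` [set k])].

(** The sample space with the sigma-algebra [history a b]; to be determined by the past is to be
    measurable on this space. *)
Definition past (a b : nat) := g_sigma_algebraType (history_gen a b).

Lemma history_gen_measurable a b : history_gen a b `<=` measurable.
Proof.
by move=> E [[s [B [_ mB ->]]]|[s [i [k [_ ->]]]]]; exact: measurable_funPTI.
Qed.

(** The identity as a map into the coarser space plays the role of [phi] in [integral_weight_congr]
    and [expect_independent]. *)
Lemma measurable_past a b :
  @measurable_fun _ _ Omega (past a b) setT (fun w => w).
Proof.
move=> _ B mB; rewrite setTI; apply: smallest_sub mB; last exact: history_gen_measurable.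
split => //.
- by move=> A mA; rewrite setTD; exact: measurableC.
- by move=> F mF; exact: bigcup_measurable.
Qed.

Lemma past_position a b s : (s < a)%N ->
  @measurable_fun _ _ (past a b) _ setT (x s : Omega -> vec3 R).
Proof.
move=> sa _ B mB; rewrite setTI; apply: sub_sigma_algebra; left.
by exists s, B.
Qed.

Lemma past_contact a b s i : (s < b)%N ->
  @measurable_fun _ _ (past a b) _ setT (y s i : Omega -> nat).
Proof.
move=> sb _ B _; rewrite setTI.
rewrite (_ : _ @^-1` B = \bigcup_(k in B) (y s i @^-1` [set k])); last first.
  apply/seteqP; split => [w Bw|w [k Bk] /= yk]; first by exists (y s i w).
  by rewrite /preimage /= yk.
apply: (@bigcup_measurable _ (past a b)) => k _.
by apply: sub_sigma_algebra; right; exists s, i, k.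
Qed.

Lemma past_measurable a b d' (S : measurableType d') (f : Omega -> S) :
  @measurable_fun _ _ (past a b) S setT f -> measurable_fun setT f.
Proof.
move=> mf _ B mB; have := mf measurableT B mB; rewrite setTI => mfB.
by have := measurable_past measurableT mfB; rewrite setTI.
Qed.

Lemma past_monotone a b a' b' d' (S : measurableType d') (f : Omega -> S) :
  (a <= a')%N -> (b <= b')%N ->
  @measurable_fun _ _ (past a b) S setT f -> @measurable_fun _ _ (past a' b') S setT f.
Proof.
move=> aa bb mf _ B mB; have := mf measurableT B mB; rewrite !setTI.
apply: sub_smallest2r => // E [[s [C [sa mC ->]]]|[s [i [k [sb ->]]]]].
- by left; exists s, C; split => //; exact: leq_trans aa.
- by right; exists s, i, k; split => //; exact: leq_trans bb.
Qed.
End History.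

Section Model.
Variables (R : realType) (n m : nat) (r delta : R).
Hypotheses (delta_gt0 : 0 < delta).
Context d (Omega : measurableType d) (P : probability Omega R).
Variables (x : nat -> {RV P >-> vec3 R}) (y : nat -> 'I_m -> {RV P >-> nat}).
Hypothesis model : base_model r delta x y n.
Hypothesis measurable_adjacency : measurable [set z : vec3 R * vec3 R | cap z.1 r z.2].
Hypothesis cap_sym : forall u v, sphere u -> sphere v -> cap u r v -> cap v r u.

Let pos := positions x.
Let con := contacts y.
Let past := past x y.

Section Contacts.
Variables (t : nat).
Hypothesis tn : (t < n)%N.

Let iso w := nilp (neighbours r (pos w) t (x t w)).
Let nb w : R := (~~ iso w)%:R.
Let cp v w : R := contact_prob r delta (pos w) (con w) t v.
Let T w u := total_weight r delta (pos w) (con w) t u.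

Let x_sphere w v : (v < t)%N -> sphere (x v w).
Proof. by move=> vt; apply: (on_sphere model); exact: ltn_trans tn. Qed.

Lemma contact_probE v w : (v < t)%N -> cp v w = \1_(cap (x v w) r) (x t w) *
  weight r delta (pos w) (con w) t v / T w (x t w).
Proof.
move=> vt; rewrite /cp /contact_prob.
rewrite (cap_indic_sym cap_sym (x_sphere w))//; last exact: (on_sphere model).
rewrite mem_filter mem_iota add0n vt /= andbT indicE -/(pos w).
by case: (_ \in cap _ _); rewrite ?mul1r ?mul0r.
Qed.

Lemma contact_prob_ge0 v w : 0 <= cp v w.
Proof.
rewrite /cp /contact_prob; case: ifP => // _.
by rewrite divr_ge0// ?weight_ge0 ?total_weight_ge0// ltW.
Qed.

Lemma sum_contact_prob w : nb w * \sum_(v < t) cp v w = nb w.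
Proof.
rewrite /nb; case: (boolP (iso w)) => [_|niso] /=; first by rewrite mul0r.
rewrite mul1r -(big_mkord xpredT (fun v => cp v w)).
under eq_big_nat => v /andP[_ vt] do rewrite contact_probE//.
rewrite -mulr_suml.
have -> : \sum_(0 <= v < t) \1_(cap (x v w) r) (x t w) * weight r delta (pos w) (con w) t v = T w (x t w).
  exact: (@sum_cap_indic _ _ _ delta cap_sym (pos w) (con w) t (x_sphere w)
    _ (on_sphere model w tn)).
(* One neighbour makes the total weight positive, because [delta] is. *)
rewrite divff// gt_eqF//.
move: niso; rewrite /iso /T /total_weight; case: (neighbours _ _ _ _) => // v s _.
rewrite big_cons ltr_wpDr//; first by apply: sumr_ge0 => ? _; rewrite weight_ge0 ?ltW.
by rewrite /weight ltr_wpDl.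
Qed.

Lemma contact_prob_iso v w : nb w * cp v w = cp v w.
Proof.
rewrite /nb; case: (boolP (iso w)) => [/nilP h|_] /=; last by rewrite mul1r.
by rewrite /cp /contact_prob -/(pos w) in h *; rewrite h mulr0.
Qed.


Let px v : (v <= t)%N -> @measurable_fun _ _ (past t.+1 t) _ setT (x v : Omega -> vec3 R).
Proof. by move=> vt; exact: past_position. Qed.
Let py v i : (v < t)%N -> @measurable_fun _ _ (past t.+1 t) _ setT (y v i : Omega -> nat).
Proof. by move=> vt; exact: past_contact. Qed.

Lemma past_iso : @measurable_fun _ _ (past t.+1 t) _ setT (fun w => (iso w)%:R : R).
Proof.
apply: (@measurable_nilp_neighbours R r measurable_adjacency _ (past t.+1 t)
  (fun v w => x v w) t (fun w => x t w)); last exact: px.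
by move=> v /ltnW; exact: px.
Qed.

Lemma past_nb : @measurable_fun _ _ (past t.+1 t) _ setT nb.
Proof.
rewrite (_ : nb = fun w => 1 - (iso w)%:R); last first.
  by apply/funext => w; rewrite /nb; case: (iso w); rewrite ?subrr ?subr0.
by apply: measurable_funB; [exact: measurable_cst|exact: past_iso].
Qed.

Lemma past_total_weight_new :
  @measurable_fun _ _ (past t.+1 t) _ setT (fun w => T w (x t w)).
Proof.
apply: (@measurable_total_weight R m r delta measurable_adjacency _ (past t.+1 t)
  (fun v w => x v w) (fun v i w => y v i w) t (fun w => x t w)); last exact: px.
- by move=> v /ltnW; exact: px.
- by move=> v i vt; exact: py.
Qed.

Lemma past_contact_prob v : (v < t)%N -> @measurable_fun _ _ (past t.+1 t) _ setT (cp v).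
Proof.
move=> vt; rewrite (_ : cp v = fun w => \1_(cap (x v w) r) (x t w) *
  weight r delta (pos w) (con w) t v / T w (x t w)); last first.
  by apply/funext => w; exact: contact_probE.
apply: measurable_funM.
  apply: measurable_funM.
    apply: (@measurable_cap_indic R r measurable_adjacency _ (past t.+1 t) (x v) (x t)); last exact: px.
    by apply: px; exact: ltnW.
  apply: measurable_funD; last exact: measurable_cst.
  apply: (@measurable_degree R m r measurable_adjacency _ (past t.+1 t)
    (fun v w => x v w) (fun v i w => y v i w) t).
  - by move=> w /ltnW; exact: px.
  - by move=> w i wt; exact: py.
under eq_fun => q do rewrite -powR_inv1 ?total_weight_ge0 1?ltW//.
exact: (measurableT_comp (measurable_powR _) past_total_weight_new).
Qed.

Let of_past (f : Omega -> R) : @measurable_fun _ _ (past t.+1 t) _ setT f -> measurable_fun setT f.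
Proof. exact: past_measurable. Qed.

Let nb01 w : 0 <= nb w <= 1. Proof. by rewrite /nb; case: (iso w); rewrite /= lexx ler01. Qed.

Lemma bounded_has_neighbour : bounded_measurable nb.
Proof.
split; first exact: (of_past past_nb).
by exists 1 => w; rewrite ger0_norm; have /andP[] := nb01 w.
Qed.

Let bnb := bounded_has_neighbour.

Lemma contact_prob_le1 v w : (v < t)%N -> cp v w <= 1.
Proof.
move=> vt; rewrite -contact_prob_iso.
have /andP[n0 n1] := nb01 w; apply: le_trans n1; rewrite -[leRHS]sum_contact_prob ler_wpM2l//.
rewrite (bigD1 (Ordinal vt))//= lerDl; apply: sumr_ge0 => *; exact: contact_prob_ge0.
Qed.

Lemma bounded_contact_prob v : (v < t)%N -> bounded_measurable (cp v).
Proof.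
move=> vt; split; first exact: (of_past (past_contact_prob vt)).
exists 1 => w; rewrite ger0_norm; last exact: contact_prob_ge0.
exact: contact_prob_le1.
Qed.

Let bcp := bounded_contact_prob.

Let yv i v w : R := (y t i w == v)%:R.
Lemma bounded_contact_eq i v : bounded_measurable (yv i v).
Proof.
split; first exact: measurable_contact_eq.
by exists 1 => w; rewrite /yv; case: eqP; rewrite ?normr1 ?normr0.
Qed.

Let byv := bounded_contact_eq.

Let bounded_measurable_prod (f : 'I_m -> Omega -> R) :
  (forall i, bounded_measurable (f i)) -> bounded_measurable (fun w => \prod_(i < m) f i w).
Proof.
move=> bf; elim: (index_enum _) => [|i s ih].
  by under eq_fun do rewrite big_nil; exact: bounded_measurable_cst.
by under eq_fun do rewrite big_cons; exact: bounded_measurableM.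
Qed.

Variable E : set Omega.
Hypothesis hE : history x y t.+1 t E.
Let mE : measurable E.
Proof.
by have := @measurable_past _ _ _ _ P x y t.+1 t measurableT E hE; rewrite setTI.
Qed.
Let bE : bounded_measurable (\1_E : Omega -> R).
Proof. exact: bounded_measurable_indic. Qed.

Lemma contacts_law_expect (k : 'I_m -> 'I_t) :
  \int[P]_w (\1_E w * nb w * \prod_(i < m) yv i (k i) w) =
  \int[P]_w (\1_E w * nb w * \prod_(i < m) cp (k i) w).
Proof.
have mnb : measurable (has_neighbour r x t).
  rewrite (_ : has_neighbour r x t = nb @^-1` [set 1]).
    by rewrite -[X in measurable X]setTI; apply: bnb.1.
  apply/seteqP; split => w; rewrite /has_neighbour /= /nb /iso -/(pos w).
    by move=> ->.
  by case: (nilp _) => //= /esym/eqP; rewrite oner_eq0.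
have nbE w : nb w = \1_(has_neighbour r x t) w.
  rewrite indicE /nb; congr (nat_of_bool _)%:R; apply/idP/idP; by rewrite inE.
have law := contacts_law model (fun i => k i : nat) tn hE.
rewrite integral_mkcond in law.
apply: EFin_inj; rewrite expectE; last first.
  by apply: bounded_measurableM; [exact: bounded_measurableM|exact: bounded_measurable_prod].
rewrite expectE; last first.
  apply: bounded_measurableM; first exact: bounded_measurableM.
  by apply: bounded_measurable_prod => i; exact: bcp.
transitivity (\int[P]_x0 (((fun w => (\prod_(i < m)
      contact_prob r delta (positions x w) (contacts y w) t (k i))%:E) \_
      (E `&` has_neighbour r x t)) x0))%E; last first.
  apply: eq_integral => w _; rewrite patchE in_setI nbE !indicE.
  by case: (w \in E); case: (w \in _); rewrite /= ?mul0r ?mulr0 ?mul1r ?mulr1 ?mul0r.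
rewrite -law.
transitivity (\int[P]_w (\1_(E `&` has_neighbour r x t `&` [set w | forall i, y t i w = k i]) w)%:E)%E.
  apply: eq_integral => w _; congr (_%:E).
  rewrite !indicE !in_setI nbE indicE.
  suff <- : (w \in [set w | forall i, y t i w = k i])%:R = \prod_(i < m) yv i (k i) w.
    by case: (w \in E); case: (w \in _); rewrite /= ?mul0r ?mulr0 ?mul1r ?mulr1 ?mul0r.
  have -> : (w \in [set w | forall i, y t i w = k i]) = [forall i, y t i w == k i].
    apply/idP/forallP; first by rewrite inE => h i; rewrite h.
    by move=> h; rewrite inE => i; apply/eqP.
  case: (boolP [forall i, _]) => [/forallP h|]; first by rewrite big1// => i _; rewrite /yv h.
  rewrite negb_forall => /existsP[i /negbTE ki].
  by rewrite (bigD1 i)//= /yv ki mul0r.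
rewrite integral_indic ?setIT//; apply: measurableI; first exact: measurableI.
rewrite (_ : [set w | _] = \bigcap_(i in [set: 'I_m]) (y t i @^-1` [set (k i : nat)])).
  by apply: fin_bigcap_measurable => // i _; exact: measurable_funPTI.
by apply/seteqP; split => w h; [move=> i _; exact: h|move=> i; exact: h].
Qed.

(** Both sides are multilinear in the contacts: distributing the product gives sums over all maps
    [k], to which the joint law applies term by term. *)
Lemma contacts_law_sum (G : 'I_m -> 'I_t -> R) :
  \int[P]_w (\1_E w * nb w * \prod_(i < m) \sum_(v < t) G i v * yv i v w) =
  \int[P]_w (\1_E w * nb w * \prod_(i < m) \sum_(v < t) G i v * cp v w).
Proof.
have expand (f : 'I_m -> 'I_t -> Omega -> R) : (forall i v, bounded_measurable (f i v)) ->
  \int[P]_w (\1_E w * nb w * \prod_(i < m) \sum_(v < t) G i v * f i v w) =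
  \sum_(k : {ffun 'I_m -> 'I_t}) \prod_(i < m) G i (k i) *
    \int[P]_w (\1_E w * nb w * \prod_(i < m) f i (k i) w).
  move=> bf.
  under eq_Rintegral do rewrite bigA_distr_bigA mulr_sumr.
  rewrite expect_sum; last first.
    move=> k _; apply: bounded_measurableM; first exact: bounded_measurableM.
    by apply: bounded_measurable_prod => i; exact: bounded_measurableZ.
  apply: eq_bigr => k _; rewrite -expectZ; last first.
    apply: bounded_measurableM; first exact: bounded_measurableM.
    exact: bounded_measurable_prod.
  by apply: eq_Rintegral => w _; rewrite big_split /= mulrCA.
rewrite (expand (fun i v => yv i v))// (expand (fun i v => cp v)); last first.
  by move=> i v; exact: bcp.
by apply: eq_bigr => k _; rewrite contacts_law_expect.
Qed.

Let early w : R := \prod_(i < m) \sum_(v < t) yv i v w.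

Let sum_yv i w : \sum_(v < t) yv i v w = (y t i w < t)%N%:R.
Proof.
rewrite /yv; case: ltnP => yt.
  rewrite (bigD1 (Ordinal yt))//= eqxx big1 ?addr0// => v vy.
  by case: eqP => // yv0; case/eqP: vy; apply: val_inj.
by rewrite big1// => v _; rewrite gtn_eqF// (leq_trans _ yt).
Qed.

Lemma earlyE w : early w = [forall i, y t i w < t]%N%:R.
Proof.
rewrite /early; case: (boolP [forall i, _]) => [/forallP h|].
  by rewrite big1// => i _; rewrite sum_yv h.
rewrite negb_forall => /existsP[i /negbTE ki].
by rewrite (bigD1 i)//= sum_yv ki mul0r.
Qed.

Let bearly : bounded_measurable early.
Proof. by apply: bounded_measurable_prod => i; exact: bounded_measurable_sum. Qed.

(** With all coefficients 1, the probabilities of each contact sum to 1: the joint law has its full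
    mass on vectors of earlier vertices. *)
Lemma expect_early : \int[P]_w (\1_E w * nb w * early w) = \int[P]_w (\1_E w * nb w).
Proof.
have := contacts_law_sum (fun _ _ => 1).
under eq_Rintegral do under eq_bigr do under eq_bigr do rewrite mul1r.
move=> ->; apply: eq_Rintegral => w _.
under eq_bigr do under eq_bigr do rewrite mul1r.
rewrite -!mulrA; congr (_ * _).
have := sum_contact_prob w; rewrite /nb; case: (iso w) => /=; rewrite ?mul0r// !mul1r => ->.
by rewrite big1.
Qed.

(** The joint law yields the probability that contact i is v and all other contacts are earlier
    vertices; by [expect_early] the second condition holds almost surely. *)
Lemma expect_contact i v : (v < t)%N ->
  \int[P]_w (\1_E w * (nb w * yv i v w)) = \int[P]_w (\1_E w * (nb w * cp v w)).
Proof.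
move=> vt.
(* Selects v for contact i and leaves the other contacts free among the earlier vertices. *)
pose G j (v' : 'I_t) : R := if j == i then ((v' : nat) == v)%:R else 1.
have pickG (f : 'I_t -> R) : \sum_(v' < t) (v' == v :> nat)%:R * f v' = f (Ordinal vt).
  rewrite (bigD1 (Ordinal vt))//= eqxx mul1r big1 ?addr0// => v' vv.
  by case: eqP => [v'v|]; [case/eqP: vv; apply: val_inj|rewrite mul0r].
have := contacts_law_sum G.
have -> : \int[P]_w (\1_E w * nb w * \prod_(j < m) \sum_(v' < t) G j v' * cp v' w) =
    \int[P]_w (\1_E w * (nb w * cp v w)).
  apply: eq_Rintegral => w _; rewrite -!mulrA; congr (_ * _).
  have := sum_contact_prob w; rewrite /nb; case: (iso w) => /=; rewrite ?mul0r// !mul1r => s1.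
  rewrite (bigD1 i)//= /G eqxx (pickG (fun v' => cp v' w)) big1 ?mulr1// => j /negbTE ->.
  by under eq_bigr do rewrite mul1r.
move=> <-.
pose rest w : R := \prod_(j < m | j != i) \sum_(v' < t) yv j v' w.
have -> : \int[P]_w (\1_E w * nb w * \prod_(j < m) \sum_(v' < t) G j v' * yv j v' w) =
    \int[P]_w (\1_E w * (nb w * (yv i v w * rest w))).
  apply: eq_Rintegral => w _; rewrite -!mulrA; do 2 congr (_ * _).
  rewrite (bigD1 i)//= /G eqxx (pickG (fun v' => yv i v' w)); congr (_ * _).
  by apply: eq_bigr => j /negbTE ->; under eq_bigr do rewrite mul1r.
have brest : bounded_measurable rest.
  rewrite (_ : rest = fun w => \prod_(j < m) if j != i then \sum_(v' < t) yv j v' w else 1).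
    apply: bounded_measurable_prod => j; case: (j != i); last exact: bounded_measurable_cst.
    exact: bounded_measurable_sum.
  by apply/funext => w; rewrite /rest big_mkcond.
have rest01 w : rest w = 0 \/ rest w = 1.
  have [h|] := boolP [forall j, (j != i) ==> (y t j w < t)%N].
    right; rewrite /rest big1// => j ji; rewrite sum_yv.
    by move/forallP : h => /(_ j); rewrite ji /= => ->.
  rewrite negb_forall => /existsP[j]; rewrite negb_imply => /andP[ji /negbTE yj].
  by left; rewrite /rest (bigD1 j)//= sum_yv yj mul0r.
have e01 w : 0 <= \1_E w :> R by rewrite indicE; case: (_ \in _).
have early_rest w : early w = (y t i w < t)%N%:R * rest w.
  by rewrite /early (bigD1 i)//= sum_yv.
apply/eqP; rewrite eq_le; apply/andP; split; last first.
  apply: expect_le.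
  - by do 3 apply: bounded_measurableM => //.
  - by do 2 apply: bounded_measurableM => //.
  - move=> w; rewrite ler_wpM2l// ler_wpM2l//.
    by case: (rest01 w) => ->; rewrite ?mulr0 ?mulr1// /yv.
(* Pointwise [yv + early <= yv * rest + 1], and [early] has the same integral as 1 on this event. *)
rewrite -(lerD2r (\int[P]_w (\1_E w * nb w * early w))) {2}expect_early.
rewrite -!expectD; try by do 3? apply: bounded_measurableM => //.
apply: expect_le.
- by apply: bounded_measurableD; do 3? apply: bounded_measurableM => //.
- by apply: bounded_measurableD; do 3? apply: bounded_measurableM => //.
move=> w; rewrite -[X in _ <= _ + X]mulr1 -!mulrA -!mulrDr ler_wpM2l// ler_wpM2l//.
rewrite early_rest /yv; case: (eqVneq (y t i w) v) => [->|_] /=.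
  by rewrite vt !mul1r addrC.
by rewrite !mul0r !add0r; case: (_ < _)%N; case: (rest01 w) => ->; rewrite ?mul0r ?mulr1 ?mulr0.
Qed.

End Contacts.

Let nu : probability (vec3 R) R := distribution P (x 0).

(** [area] is a mere set function; the law of [x 0] is a probability agreeing with it on measurable
    sets, and replaces it in integrals. *)
Lemma distribution_area B : (0 < n)%N -> measurable B -> nu B = area B.
Proof.
move=> n0 mB; have h : history x y 0 0 setT := @measurableT _ (past 0 0).
have := new_vertex_law model n0 h mB.
by rewrite setTI probability_setT mul1e.
Qed.

Section Step.
Variable t : nat.
Hypothesis tn : (t < n)%N.

Let x_sphere w v : (v < t)%N -> sphere (x v w).
Proof. by move=> vt; apply: (on_sphere model); exact: ltn_trans tn. Qed.

Let inc w := increment r delta (pos w) (con w) t.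
Let D w := drift_density r delta (pos w) (con w) t.
Let T w u := total_weight r delta (pos w) (con w) t u.

Lemma drift_density_le_const w u z : sphere u -> D w u z <= 2 * m%:R + delta.
Proof.
(* The whole space serves as the wide set. *)
move=> su; have := @drift_density_le_wide R m r delta delta_gt0 (fun _ => setT) cap_sym
  (fun _ _ => @subsetT _ _) (fun _ _ _ _ _ _ => I) (pos w) (con w) t (x_sphere w) u su z.
by rewrite indicT mulr1.
Qed.

Lemma bounded_drift_density_pair u : sphere u ->
  @bounded_measurable _ (past t t * vec3 R)%type R (fun q => D q.1 u q.2).
Proof.
move=> su; split.
  apply: (@measurable_drift_density R m r delta (ltW delta_gt0) measurable_adjacency _ (past t t)
    (fun v w => x v w) (fun v i w => y v i w) t).
  - by move=> v vt; exact: past_position.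
  - by move=> v i vt; exact: past_contact.
exists (2 * m%:R + delta) => q; rewrite ger0_norm ?drift_density_le_const//.
exact: drift_density_ge0.
Qed.

Lemma bounded_drift_density u w : sphere u -> bounded_measurable (D w u).
Proof.
move=> su; exact: (@bounded_measurable_section _ _ (past t t) (vec3 R) R
  (fun q => D q.1 u q.2) w (bounded_drift_density_pair su)).
Qed.

Lemma past_total_weight u :
  @measurable_fun _ _ (past t t) _ setT (fun w => T w u).
Proof.
apply: (@measurable_total_weight R m r delta measurable_adjacency _ (past t t)
  (fun v w => x v w) (fun v i w => y v i w) t (fun w => u)).
- by move=> v vt; exact: past_position.
- by move=> v i vt; exact: past_contact.
- exact: measurable_cst.
Qed.

Lemma past_total_weight_pair :
  @measurable_fun _ _ (past t t * vec3 R)%type _ setT (fun q => T q.1 q.2).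
Proof.
apply: (@measurable_total_weight_pair R m r delta measurable_adjacency _ (past t t)
  (fun v w => x v w) (fun v i w => y v i w) t).
- by move=> v vt; exact: past_position.
- by move=> v i vt; exact: past_contact.
Qed.

Lemma past_independent E B : @measurable _ (past t t) E -> measurable B ->
  P ((fun w => w) @^-1` E `&` x t @^-1` B) = (P ((fun w => w) @^-1` E) * nu B)%E.
Proof.
move=> mE mB; rewrite distribution_area//; first exact: (new_vertex_law model).
exact: leq_ltn_trans tn.
Qed.

Lemma bounded_increment u : bounded_measurable (fun w => inc w u).
Proof.
have bcu v : bounded_measurable (fun w => \1_(cap u r) (x v w) : R).
  split; last by exists 1 => w; rewrite indicE; case: (_ \in _); rewrite /= ?normr1 ?normr0.
  exact: (@measurable_cap_indic R r measurable_adjacency _ Omega (cst u) (x v) (measurable_cst _)).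
have bnb : bounded_measurable (fun w => (~~ nilp (neighbours r (pos w) t (x t w)))%:R : R).
  exact: bounded_has_neighbour.
have byv i v : bounded_measurable (fun w => (y t i w == v)%:R : R) by exact: bounded_contact_eq.
rewrite /inc /increment; apply: bounded_measurableD.
  apply: bounded_measurableM; first exact: bcu.
  apply: bounded_measurableD; first exact: bounded_measurable_cst.
  rewrite (_ : (fun w => _) = fun w => m%:R * (1 + -1 * (~~ nilp (neighbours r (pos w) t (x t w)))%:R)).
    apply: bounded_measurableZ; apply: bounded_measurableD; first exact: bounded_measurable_cst.
    exact: bounded_measurableZ.
  by apply/funext => w; rewrite /pos /positions; case: (nilp _); rewrite /=; ring.
apply: bounded_measurableM; first exact: bnb.
apply: bounded_measurable_sum => i _; apply: bounded_measurable_sum => v _.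
by apply: bounded_measurableM; [exact: byv|exact: bcu].
Qed.

(** Two averagings: given the past and [x t], the indicator of a contact is exchanged for its
    probability by [integral_weight_congr]; then [x t], independent of the past, is integrated out
    under [nu]. *)
Lemma expect_increment u (H : Omega -> R) : sphere u ->
  @bounded_measurable _ (past t t) R H -> (forall w, 0 <= H w) ->
  \int[P]_w (H w * inc w u) = \int[P]_w (H w * drift r delta nu (pos w) (con w) t u).
Proof.
move=> su bH H0.
have bHO : bounded_measurable H by split; [exact: past_measurable bH.1|exact: bH.2].
pose h1 w : R := \1_(cap u r) (x t w) * (delta + m%:R + m%:R * (nilp (neighbours r (pos w) t (x t w)))%:R).
pose nb w : R := (~~ nilp (neighbours r (pos w) t (x t w)))%:R.
pose cu v w : R := \1_(cap u r) (x v w).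
pose cp v w : R := contact_prob r delta (pos w) (con w) t v.
pose yv i v w : R := (y t i w == v)%:R.
have cu01 v w : 0 <= cu v w <= 1.
  by rewrite /cu indicE; case: (_ \in _); rewrite /= lexx ler01.
have bcu v : bounded_measurable (cu v).
  split; last by exists 1 => w; rewrite ger0_norm; have /andP[] := cu01 v w.
  exact: (@measurable_cap_indic R r measurable_adjacency _ Omega (cst u) (x v) (measurable_cst _)).
have bnb : bounded_measurable nb by exact: bounded_has_neighbour.
have byv i v : bounded_measurable (yv i v) by exact: bounded_contact_eq.
have bcp v : (v < t)%N -> bounded_measurable (cp v) by exact: bounded_contact_prob.
have bh1 : bounded_measurable h1.
  apply: bounded_measurableM; first exact: bcu.
  apply: bounded_measurableD; first exact: bounded_measurable_cst.
  rewrite (_ : (fun w => _) = fun w => m%:R * (1 + -1 * nb w)).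
    apply: bounded_measurableZ; apply: bounded_measurableD; first exact: bounded_measurable_cst.
    exact: bounded_measurableZ.
  by apply/funext => w; rewrite /nb; case: (nilp _); rewrite /=; ring.
have bHcy i v : bounded_measurable (fun w => (H w * cu v w) * (nb w * yv i v w)).
  by apply: bounded_measurableM; exact: bounded_measurableM.
have bHcp v : (v < t)%N -> bounded_measurable (fun w => (H w * cu v w) * (nb w * cp v w)).
  by move=> vt; apply: bounded_measurableM; apply: bounded_measurableM => //; exact: bcp.
transitivity (\int[P]_w (H w * h1 w + \sum_(i < m) \sum_(v < t)
   ((H w * cu v w) * (nb w * yv i v w)))).
  apply: eq_Rintegral => w _; rewrite /inc /increment mulrDr -/(h1 w); congr (_ + _).
  rewrite -/(nb w) !mulr_sumr; apply: eq_bigr => i _; rewrite big_mkord !mulr_sumr; apply: eq_bigr => v _.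
  by rewrite /cu /yv /con /contacts /pos /positions; ring.
transitivity (\int[P]_w (H w * D w u (x t w))); last first.
  have pid := @measurable_past _ _ _ _ P x y t t.
  have mxt : measurable_fun setT (x t) by [].
  rewrite (@expect_independent _ _ _ _ (past t t) _ _ P nu (fun w => w) (x t) pid mxt past_independent
     (fun q => H q.1 * D q.1 u q.2))//.
  - apply: eq_Rintegral => w _ /=; rewrite expectZ//.
    exact: bounded_drift_density.
  - apply: (@bounded_measurableM _ (past t t * vec3 R)%type); last exact: bounded_drift_density_pair.
    have [mH [c Hc]] := bH; split; last by exists c => q.
    exact: (measurableT_comp mH measurable_fst).
  - by move=> q; rewrite mulr_ge0// drift_density_ge0.
transitivity (\int[P]_w (H w * h1 w + \sum_(i < m) \sum_(v < t)
   ((H w * cu v w) * (nb w * cp v w)))); last first.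
  apply: eq_Rintegral => w _; rewrite /D /drift_density mulrDr; congr (_ + _).
  rewrite [LHS]sumr_const card_ord -[LHS]mulr_natl [RHS]mulrCA; congr (_ * _).
  rewrite big_mkord mulr_sumr; apply: eq_bigr => v _.
  have -> : nb w * cp v w = cp v w by exact: contact_prob_iso.
  by rewrite -mulrA; congr (_ * (_ * _)); exact: contact_probE.
have bSy i : bounded_measurable (fun w => \sum_(v < t) H w * cu v w * (nb w * yv i v w)).
  by apply: bounded_measurable_sum => v _; exact: bHcy.
have bSp : bounded_measurable (fun w => \sum_(v < t) H w * cu v w * (nb w * cp v w)).
  by apply: bounded_measurable_sum => v _; exact: (bHcp _ (ltn_ord v)).
have bHh : bounded_measurable (fun w => H w * h1 w) by exact: bounded_measurableM.
rewrite [LHS]expectD//; last by apply: bounded_measurable_sum.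
rewrite [RHS]expectD//; last by apply: bounded_measurable_sum.
rewrite [in LHS]expect_sum// [in RHS]expect_sum//; congr (_ + _).
apply: eq_bigr => i _.
rewrite [LHS]expect_sum; last by move=> v _; exact: bHcy.
rewrite [RHS]expect_sum; last by move=> v _; exact: (bHcp _ (ltn_ord v)).
apply: eq_bigr => v _.
congr fine.
have pid := @measurable_past _ _ _ _ P x y t.+1 t.
apply: (@integral_weight_congr _ _ _ (past t.+1 t) R P (fun w => w) pid
  (fun w => nb w * yv i v w) (fun w => nb w * cp v w) (fun w => H w * cu v w)).
- by move=> w; rewrite mulr_ge0.
- by move=> w; rewrite mulr_ge0//; exact: contact_prob_ge0.
- by apply: (bounded_measurableM bnb (byv i v)).1.
- by apply: (bounded_measurableM bnb (bcp v (ltn_ord v))).1.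
- move=> E hE.
  have mE : @measurable _ Omega E by have := pid measurableT E hE; rewrite setTI.
  have bE := bounded_measurable_indic R mE.
  have toE (f : Omega -> R) : bounded_measurable f ->
    (\int[P]_(w in E) (f w)%:E = (\int[P]_w (\1_E w * f w))%:E)%E.
    move=> bf; rewrite expectE; last exact: bounded_measurableM.
    rewrite integral_mkcond; apply: eq_integral => w _.
    by rewrite patchE indicE; case: (_ \in _); rewrite ?mul1r ?mul0r.
  rewrite !toE; [|exact: bounded_measurableM (bcp _ _)|exact: bounded_measurableM].
  congr (_%:E); exact: expect_contact.
- apply: measurable_funM.
    by apply: past_monotone bH.1.
  apply: (@measurable_cap_indic R r measurable_adjacency _ (past t.+1 t) (cst u) (x v) (measurable_cst _)).
  by apply: (@past_position _ _ _ _ P x y); exact: (leq_trans (ltn_ord v)).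
- by move=> w; rewrite mulr_ge0//; have /andP[] := cu01 v w.
Qed.
End Step.
End Model.

(** From [expR (- z) >= 1 - z], since (1 - z)(1 + z + 2 z^2) = 1 + z^2 (1 - 2 z). All negative z are
    allowed, as the lower tail requires. *)
Lemma expR_le_quadratic (R : realType) (z : R) : z <= 2^-1 ->
  expR z <= 1 + z * (1 + 2 * z).
Proof.
move=> z2; have h := expR_ge1Dx (- z).
have z1 : 0 < 1 - z by lra.
rewrite -[expR z]invrK -expRN.
apply: (@le_trans _ _ (1 - z)^-1); first by rewrite lef_pV2 ?posrE ?expR_gt0.
rewrite -[leLHS]mul1r ler_pdivrMr//.
have : 0 <= z ^+ 2 * (1 - 2 * z) by rewrite mulr_ge0 ?sqr_ge0//; lra.
rewrite !expr2; nra.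
Qed.

(** * Exponential supermartingales *)

Section Concentration.
Variables (R : realType) (n m : nat) (r delta : R).
Hypotheses (delta_gt0 : 0 < delta).
Context d (Omega : measurableType d) (P : probability Omega R).
Variables (x : nat -> {RV P >-> vec3 R}) (y : nat -> 'I_m -> {RV P >-> nat}).
Hypothesis model : base_model r delta x y n.
Hypothesis measurable_adjacency : measurable [set z : vec3 R * vec3 R | cap z.1 r z.2].
Hypothesis measurable_sphere : measurable (@sphere R).
Hypothesis cap_sym : forall u v, sphere u -> sphere v -> cap u r v -> cap v r u.

Let pos := positions x.
Let con := contacts y.
Let past := past x y.
Let nu : probability (vec3 R) R := distribution P (x 0).
Let T t w u := total_weight r delta (pos w) (con w) t u.
Let M := 2 * m%:R + delta.

Section Supermartingale.
Variable t : nat.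
Hypothesis tn : (t < n)%N.
Variables (good next : set Omega).
Hypothesis past_good : @measurable _ (past t t) good.
Hypothesis measurable_next : measurable next.
Hypothesis next_good : next `<=` good.
Hypothesis next_earlier : forall w, next w -> forall s, (s <= t)%N -> contacts_earlier r (pos w) (con w) s.

Lemma bounded_expR_total_weight (s : nat) (u : vec3 R) (lam B : R) : (s <= n)%N ->
  @bounded_measurable _ (past s s) R (fun w => expR (lam * (T s w u - B))).
Proof.
move=> sn; apply: bounded_measurable_expR; apply: bounded_measurableZ.
apply: bounded_measurableD; last exact: bounded_measurable_cst.
split; first exact: past_total_weight.
exists ((s * (2 * m * s))%:R + s%:R * delta) => w.
by rewrite ger0_norm ?total_weight_ge0 ?total_weight_ub// ltW.
Qed.

Lemma bounded_past (s a : nat) (f : Omega -> R) :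
  @bounded_measurable _ (past s a) R f -> bounded_measurable f.
Proof. by move=> [mf bf]; split => //; exact: past_measurable mf. Qed.

(** [lam] is positive for upper tails and negative for lower ones; [theta] absorbs the second-order
    term of the exponential. An affine drift of slope [g] multiplies the exponent by
    [1 + (1 + theta) * g] going back one step, so exponents are prescribed backwards from the final
    time. *)
Lemma exponential_step (u : vec3 R) (lam theta a g B B' : R) :
  sphere u -> lam * M <= 2^-1 -> - 1 <= theta -> lam * (2 * lam * M - theta) <= 0 ->
  (forall w, good w -> lam * drift r delta nu (pos w) (con w) t u <= lam * (a + g * T t w u)) ->
  lam * (B + (1 + theta) * (a + g * B) - B') <= 0 ->
  \int[P]_w (\1_next w * expR (lam * (T t.+1 w u - B'))) <=
  \int[P]_w (\1_good w * expR (lam * (1 + (1 + theta) * g) * (T t w u - B))).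
Proof.
move=> su lamM theta1 lamth dr BB.
pose H w : R := \1_good w * expR (lam * (T t w u - B')).
pose inc w := increment r delta (pos w) (con w) t u.
pose dri w := drift r delta nu (pos w) (con w) t u.
have mgood : measurable good.
  by have := @measurable_past _ _ _ _ P x y t t measurableT good past_good; rewrite setTI.
have bH : @bounded_measurable _ (past t t) R H.
  apply: bounded_measurableM; first exact: bounded_measurable_indic.
  by apply: bounded_expR_total_weight; exact: ltnW.
have bHO := bounded_past bH.
have i0 (A : set Omega) w : 0 <= \1_A w :> R by rewrite indicE; case: (_ \in _).
have H0 w : 0 <= H w by rewrite mulr_ge0// expR_ge0.
have inc0 w : 0 <= inc w by apply: increment_ge0; exact: ltW.
have incM w : inc w <= M by apply: increment_ub; exact: ltW.
have bDp : @bounded_measurable _ (past t t) R (fun w => dri w).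
  rewrite /dri /drift.
  apply: (@bounded_measurable_integral _ _ (past t t) (vec3 R) R nu
    (fun q => drift_density r delta (pos q.1) (con q.1) t u q.2)).
    exact: (bounded_drift_density_pair delta_gt0 model measurable_adjacency cap_sym tn su).
  by move=> q; exact: drift_density_ge0.
have dri0 w : 0 <= dri w by apply: Rintegral_ge0 => z _; exact: drift_density_ge0.
have binc : bounded_measurable inc by exact: bounded_increment.
set c := lam * (1 + 2 * lam * M).
(* As [0 <= inc <= M], the square of the increment is at most [M * inc], and the quadratic bound
   becomes linear. *)
have exp_inc w : expR (lam * inc w) <= 1 + c * inc w.
  have i0' := inc0 w; have iM := incM w.
  apply: (le_trans (expR_le_quadratic _)).
    have [l0|l0] := leP 0 lam; first by apply: le_trans lamM; rewrite ler_wpM2l.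
    by apply: (@le_trans _ _ 0); rewrite ?invr_ge0// mulr_le0_ge0// ltW.
  have : 0 <= lam ^+ 2 * (inc w * (M - inc w)).
    by rewrite mulr_ge0 ?sqr_ge0// mulr_ge0// subr_ge0.
  rewrite /c !expr2; nra.
apply: (@le_trans _ _ (\int[P]_w (H w + c * (H w * inc w)))).
  apply: expect_le.
  - apply: bounded_measurableM; first exact: bounded_measurable_indic.
    by apply: bounded_past; exact: bounded_expR_total_weight.
  - apply: bounded_measurableD => //; apply: bounded_measurableZ; exact: bounded_measurableM.
  - move=> w; rewrite indicE; case: (boolP (w \in next)) => [|_]; last first.
      rewrite mul0r (_ : _ + _ = H w * (1 + c * inc w)); last by ring.
      by rewrite mulr_ge0// (le_trans (expR_ge0 _) (exp_inc w)).
    rewrite inE mul1r => nw.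
    have -> : T t.+1 w u = T t w u + inc w.
      by apply: total_weightS; exact: next_earlier.
    rewrite /H indicE mem_set ?mul1r; last exact: next_good.
    rewrite (_ : lam * (_ + _ - _) = lam * (T t w u - B') + lam * inc w); last by ring.
    rewrite expRD [leRHS](_ : _ = expR (lam * (T t w u - B')) * (1 + c * inc w)); last by ring.
    by rewrite ler_wpM2l ?expR_ge0.
rewrite expectD//; last by apply: bounded_measurableZ; exact: bounded_measurableM.
rewrite expectZ//; last exact: bounded_measurableM.
rewrite (expect_increment delta_gt0 model measurable_adjacency cap_sym tn su bH H0).
rewrite -expectZ; last by apply: bounded_measurableM => //; exact: bounded_past bDp.
rewrite -expectD//; last by apply: bounded_measurableZ; apply: bounded_measurableM => //; exact: bounded_past bDp.
apply: expect_le.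
- apply: bounded_measurableD => //; apply: bounded_measurableZ; apply: bounded_measurableM => //; exact: bounded_past bDp.
- apply: bounded_measurableM; first exact: bounded_measurable_indic.
  by apply: bounded_past; apply: bounded_expR_total_weight; exact: ltnW.
move=> w; rewrite /H -/(dri w) indicE; case: (boolP (w \in good)); last by rewrite !mul0r mulr0 addr0.
rewrite inE !mul1r => gw.
rewrite [leLHS](_ : _ = expR (lam * (T t w u - B')) * (1 + c * dri w)); last by ring.
apply: (@le_trans _ _ (expR (lam * (T t w u - B')) * expR (c * dri w))).
  by rewrite ler_wpM2l ?expR_ge0// expR_ge1Dx.
rewrite -expRD ler_expR.
have := dr w gw; rewrite -/(dri w) => h.
have d0 := dri0 w.
(* The hypothesis on [theta] says [c <= (1 + theta) * lam], which is multiplied by the nonnegative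
   drift. *)
have h1 : c * dri w <= (1 + theta) * (lam * (a + g * T t w u)).
  apply: (@le_trans _ _ ((1 + theta) * (lam * dri w))); last by rewrite ler_wpM2l//; lra.
  rewrite /c mulrA ler_wpM2r//; lra.
move: h1 BB; lra.
Qed.
End Supermartingale.

Variables (t0 t1 : nat) (Lo Up : nat -> R) (b : R).
Hypothesis b_gt0 : 0 < b.

(* The points z at which T_s(z) has left its band. While the area of this set
   is at most b, the drift of T_s(u) is nearly an affine function of T_s(u). *)
Definition bad (s : nat) (w : Omega) : set (vec3 R) :=
  [set z | sphere z /\ ((t0 <= s)%N /\ T s w z < Lo s \/
                        (t1 <= s)%N /\ Up s < T s w z)].

Definition bad_area (s : nat) (w : Omega) : R := fine (nu (bad s w)).

Definition good_step (s : nat) (w : Omega) : bool :=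
  contacts_earlier r (pos w) (con w) s && (bad_area s w <= b).

(** Only steps before t enter, so that the event belongs to [past t t]. *)
Definition good (t : nat) : set Omega :=
  [set w | forall s, (s < t)%N -> good_step s w].

Lemma measurable_bad_pair s :
  @measurable _ (past s s * vec3 R)%type [set q | bad s q.1 q.2].
Proof.
have mT := @past_total_weight_pair _ _ r delta _ _ P x y measurable_adjacency s.
have mS : @measurable _ (past s s * vec3 R)%type [set q | sphere q.2].
  have := @measurable_snd _ _ (past s s) (vec3 R) measurableT _ measurable_sphere.
  by rewrite setTI.
have mb (P0 : bool) (S : set (past s s * vec3 R)) : measurable S -> measurable [set q | P0 /\ S q].
  move=> mS'; case: P0; first by rewrite (_ : [set q | _] = S)//; apply/seteqP; split => q // [].
  by rewrite (_ : [set q | _] = set0)//; apply/seteqP; split => q // [].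
rewrite (_ : [set q | _] = [set q | sphere q.2] `&`
  ([set q | (t0 <= s)%N /\ T s q.1 q.2 < Lo s] `|` [set q | (t1 <= s)%N /\ Up s < T s q.1 q.2]))//.
apply: measurableI => //; apply: measurableU; apply: mb.
- rewrite -[X in measurable X]setTI.
  by apply: (measurable_fun_ltr mT (measurable_cst (Lo s))) => //; exact: (measurable_set1 true).
- rewrite -[X in measurable X]setTI.
  by apply: (measurable_fun_ltr (measurable_cst (Up s)) mT) => //.
Qed.

Lemma measurable_bad s w : measurable (bad s w).
Proof.
have := @measurable_xsection _ _ (past s s) (vec3 R) _ w (@measurable_bad_pair s).
rewrite (_ : xsection _ w = bad s w)//.
by apply/seteqP; split => z; rewrite /xsection /= inE.
Qed.

Lemma measurable_bad_event s u : measurable [set w | bad s w u].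
Proof.
have := @measurable_ysection _ _ (past s s) (vec3 R) _ u (@measurable_bad_pair s).
rewrite (_ : ysection _ u = [set w | bad s w u]); last first.
  by apply/seteqP; split => z; rewrite /ysection /= inE.
by move=> h; have := @measurable_past _ _ _ _ P x y s s measurableT _ h; rewrite setTI.
Qed.

Lemma bad_areaE s w : bad_area s w = \int[nu]_z \1_(bad s w) z.
Proof. by apply: EFin_inj; rewrite expect_indic ?fineK ?fin_num_measure//; exact: measurable_bad. Qed.

Lemma bounded_bad_area s : @bounded_measurable _ (past s s) R (bad_area s).
Proof.
rewrite (_ : bad_area s = fun w => \int[nu]_z \1_[set q | bad s q.1 q.2] (w, z)); last first.
  apply/funext => w; rewrite bad_areaE; apply: eq_Rintegral => z _.
  by rewrite !indicE; congr (nat_of_bool _)%:R; apply/idP/idP; rewrite !inE.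
apply: (@bounded_measurable_integral _ _ (past s s) (vec3 R) R nu).
  by apply: bounded_measurable_indic; exact: measurable_bad_pair.
by move=> q; rewrite indicE.
Qed.

Lemma past_contacts_earlier s :
  @measurable _ (past s.+1 s.+1) [set w | contacts_earlier r (pos w) (con w) s].
Proof.
have mi := past_monotone (leqnn s.+1) (leqnSn s) (@past_iso _ _ r _ _ P x y measurable_adjacency s).
rewrite (_ : [set w | _] = [set w | (nilp (neighbours r (pos w) s (x s w)))%:R = 1 :> R] `|`
   \bigcap_(i in [set: 'I_m]) [set w | (y s i w < s)%N]); last first.
  apply/seteqP; split => w; rewrite /contacts_earlier /= -/(pos w).
    case: (boolP (nilp _)) => [_ _|ni /forallP h]; first by left.
    by right => i _; exact: h.
  rewrite -/(positions x w) -/(pos w); case: (boolP (nilp _)) => //= ni [/esym/eqP|h].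
    by rewrite oner_eq0.
  by apply/forallP => i; exact: h.
apply: measurableU.
  rewrite -[X in measurable X]setTI.
  exact: (mi measurableT _ (measurable_set1 1)).
apply: fin_bigcap_measurable => // i _.
rewrite -[X in measurable X]setTI.
exact: (@past_contact _ _ _ _ P x y s.+1 s.+1 s i (leqnn _) measurableT [set k | (k < s)%N]).
Qed.

Lemma goodS s : good s.+1 = good s `&` [set w | good_step s w].
Proof.
apply/seteqP; split => w /= h.
  by split; [move=> k ks; apply: h; exact: ltnW|exact: h].
by move=> k; rewrite ltnS leq_eqVlt => /predU1P[->|]; [exact: h.2|exact: h.1].
Qed.

Let small s : set Omega := [set w | bad_area s w <= b].

Lemma past_small s : @measurable _ (past s s) (small s).
Proof.
rewrite -[X in measurable X]setTI.
exact: (measurable_fun_ler (bounded_bad_area s).1 (measurable_cst b)).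
Qed.

Lemma past_goodP s : @measurable _ (past s s) (good s).
Proof.
elim: s => [|s ih].
  rewrite (_ : good 0 = setT); first exact: (@measurableT _ (past 0 0)).
  by apply/seteqP; split.
have up (S : set Omega) : @measurable _ (past s s) S -> @measurable _ (past s.+1 s.+1) S.
  move=> /(@measurable_indicP _ (past s s) R) mS.
  apply/(@measurable_indicP _ (past s.+1 s.+1) R).
  exact: past_monotone mS.
rewrite goodS (_ : [set w | _] = [set w | contacts_earlier r (pos w) (con w) s] `&` small s).
  apply: measurableI; first exact: up.
  by apply: measurableI; [exact: past_contacts_earlier|apply: up; exact: past_small].
by apply/seteqP; split => w; rewrite /good_step => /andP.
Qed.

Lemma measurable_good s : measurable (good s).
Proof.
by have := @measurable_past _ _ _ _ P x y s s measurableT _ (@past_goodP s); rewrite setTI.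
Qed.

Section Chernoff.
Variables (u : vec3 R) (t : nat) (lam B a g : nat -> R) (theta : R).
Hypothesis u_sphere : sphere u.
Hypothesis tn : (t <= n)%N.
Hypothesis theta_ge : -1 <= theta.
Hypothesis lam_small : forall s, (s < t)%N -> lam s.+1 * M <= 2^-1.
Hypothesis lam_theta : forall s, (s < t)%N -> lam s.+1 * (2 * lam s.+1 * M - theta) <= 0.
Hypothesis lam_rec : forall s, (s < t)%N -> lam s = lam s.+1 * (1 + (1 + theta) * g s).
Hypothesis drift_bound : forall s w, (s < t)%N -> bad_area s w <= b ->
  lam s.+1 * drift r delta nu (pos w) (con w) s u <= lam s.+1 * (a s + g s * T s w u).
Hypothesis barrier : forall s, (s < t)%N ->
  lam s.+1 * (B s + (1 + theta) * (a s + g s * B s) - B s.+1) <= 0.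
Hypothesis barrier0 : 0 <= lam 0%N * B 0%N.

(** Induction on time. At time 0 the total weight is 0 and [barrier0] bounds the exponential by
    1. *)
Lemma exponential_moment :
  \int[P]_w (\1_(good t) w * expR (lam t * (T t w u - B t))) <= 1.
Proof.
suff : forall s, (s <= t)%N ->
    \int[P]_w (\1_(good s) w * expR (lam s * (T s w u - B s))) <= 1 by exact.
elim => [_|s ih st].
  rewrite -[leRHS](expect_cst P 1); apply: expect_le.
  - apply: bounded_measurableM; first by apply: bounded_measurable_indic; exact: measurable_good.
    by apply: bounded_past; exact: bounded_expR_total_weight.
  - exact: bounded_measurable_cst.
  - move=> w; rewrite /T /total_weight /= big_nil sub0r mulrN.
    apply: (@le_trans _ _ (1 * 1)); last by rewrite mulr1.
    apply: ler_pM; rewrite ?expR_ge0//.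
    by rewrite -[leRHS]expR0 ler_expR oppr_le0.
apply: le_trans (ih (ltnW st)).
(* The drift bound at time s needs a small exceptional area at time s, which is part of [good s.+1]
   but not of [good s]. *)
apply: (@le_trans _ _ (\int[P]_w (\1_(good s `&` small s) w * expR (lam s * (T s w u - B s))))).
  rewrite (lam_rec st).
  apply: (@exponential_step s _ (good s `&` small s) (good s.+1) _ _ _ _ u _ _ (a s)) => //.
  - exact: leq_trans tn.
  - by apply: measurableI; [exact: past_goodP|exact: past_small].
  - exact: measurable_good.
  - by rewrite goodS => w [gw /andP[_ sw]].
  - by move=> w gw k ks; have /andP[] := gw k ks.
  - exact: lam_small.
  - exact: lam_theta.
  - by move=> w [_ sw]; exact: drift_bound.
  - exact: barrier.
have sn : (s <= n)%N by apply: ltnW; exact: leq_trans tn.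
have mI : measurable (good s `&` small s).
  have := @measurable_past _ _ _ _ P x y s s measurableT _ (@past_small s); rewrite setTI => ms.
  by apply: measurableI ms; exact: measurable_good.
apply: expect_le.
- apply: bounded_measurableM; first exact: bounded_measurable_indic.
  by apply: bounded_past; exact: bounded_expR_total_weight.
- apply: bounded_measurableM; first by apply: bounded_measurable_indic; exact: measurable_good.
  by apply: bounded_past; exact: bounded_expR_total_weight.
move=> w; rewrite ler_wpM2r ?expR_ge0// !indicE in_setI.
by case: (_ \in good s) => //=; rewrite ?lexx//; case: (_ \in _).
Qed.

Lemma chernoff (l : R) (S : set Omega) : measurable S ->
  (forall w, S w -> l <= lam t * (T t w u - B t)) ->
  (P (good t `&` S) <= (expR (- l))%:E)%E.
Proof.
move=> mS Sl; have mI : measurable (good t `&` S).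
  by apply: measurableI => //; exact: measurable_good.
have bE : bounded_measurable (fun w => \1_(good t) w * expR (lam t * (T t w u - B t))).
  apply: bounded_measurableM; first by apply: bounded_measurable_indic; exact: measurable_good.
  by apply: bounded_past; exact: bounded_expR_total_weight.
rewrite -expect_indic// lee_fin -[leRHS]mulr1.
apply: (@le_trans _ _ (expR (- l) * \int[P]_w (\1_(good t) w * expR (lam t * (T t w u - B t))))).
  rewrite -expectZ//; apply: expect_le => //; first exact: bounded_measurable_indic.
    exact: bounded_measurableZ.
  move=> w; rewrite [leLHS]indicE in_setI indicE.
  case: (boolP (w \in good t)) => /= _; last by rewrite mul0r mulr0.
  rewrite mul1r -expRD; case: (boolP (w \in _)) => [|_]; last exact: expR_ge0.
  by rewrite inE => /Sl h; rewrite -[leLHS]expR0 ler_expR addrC subr_ge0.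
by rewrite ler_wpM2l ?expR_ge0// exponential_moment.
Qed.
End Chernoff.

Section Union.
Variable q : R.
Hypothesis q_ge0 : 0 <= q.
Hypothesis bad_prob : forall s u, (s <= n)%N -> sphere u ->
  (P (good s `&` [set w | bad s w u]) <= q%:E)%E.

(* Fubini turns the bound at each point into one for the expected area of the
   exceptional set, so that no net on the sphere is needed. *)
Lemma expect_bad_area s : (s <= n)%N ->
  \int[P]_w (\1_(good s) w * bad_area s w) <= q.
Proof.
move=> sn.
pose f (k : Omega * vec3 R) : \bar R := (\1_(good s) k.1 * \1_(bad s k.1) k.2)%:E.
have mpair : @measurable_fun _ _ (Omega * vec3 R)%type (past s s * vec3 R)%type setT (fun k => (k.1, k.2)).
  apply: (@measurable_fun_pair _ _ _ (Omega * vec3 R)%type (past s s) (vec3 R) (fun k => k.1) (fun k => k.2)).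
    apply: (@measurableT_comp _ _ _ (Omega * vec3 R)%type Omega (past s s) (fun w => w) _ (fun k => k.1)).
      exact: measurable_past.
    exact: measurable_fst.
  exact: measurable_snd.
have mbad : measurable [set k : Omega * vec3 R | bad s k.1 k.2].
  by have := mpair measurableT _ (@measurable_bad_pair s); rewrite setTI.
have mf : measurable_fun setT f.
  apply/measurable_EFinP; apply: measurable_funM.
    apply: (@measurableT_comp _ _ _ (Omega * vec3 R)%type Omega R (\1_(good s)) _ (fun k => k.1)).
      by apply: measurable_indic; exact: measurable_good.
    exact: measurable_fst.
  rewrite (_ : (fun k => _) = \1_[set k : Omega * vec3 R | bad s k.1 k.2]); first exact: measurable_indic.
  apply/funext => k; rewrite !indicE.
  suff -> : (k.2 \in bad s k.1) = (k \in [set k : Omega * vec3 R | bad s k.1 k.2]) by [].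
  by apply/idP/idP; rewrite !inE.
have f0 k : (0 <= f k)%E by rewrite lee_fin mulr_ge0// indicE.
have bga : bounded_measurable (fun w => \1_(good s) w * bad_area s w).
  apply: bounded_measurableM; first by apply: bounded_measurable_indic; exact: measurable_good.
  exact: bounded_past (@bounded_bad_area s).
rewrite -lee_fin expectE//.
have -> : (\int[P]_w (\1_(good s) w * bad_area s w)%:E = \int[P]_w \int[nu]_z f (w, z))%E.
  apply: eq_integral => w _; rewrite bad_areaE -expectZ ?expectE//.
    by apply: bounded_measurableZ; apply: bounded_measurable_indic; exact: measurable_bad.
  by apply: bounded_measurable_indic; exact: measurable_bad.
rewrite (@fubini_tonelli _ _ _ _ _ P nu)//.
apply: (@le_trans _ _ (\int[nu]_z (cst q%:E z))%E); last first.
  by rewrite integral_cst// -[X in (_ * X <= _)%E]/(nu setT) probability_setT mule1.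
apply: ge0_le_integral => //.
- by move=> z _; apply: integral_ge0.
- exact: (measurable_fun_fubini_tonelli_G (m1 := P)).
- move=> z _ /=; have [sz|sz] := pselect (sphere z); last first.
    rewrite integral0_eq ?lee_fin// => w _; rewrite /f /= [\1_(bad _ _) z]indicE memNset ?mulr0// => -[].
    by [].
  apply: le_trans (bad_prob sn sz).
  have mbz : measurable [set w | bad s w z].
    rewrite (_ : [set w | _] = ysection [set k : Omega * vec3 R | bad s k.1 k.2] z).
      exact: measurable_ysection.
    by apply/seteqP; split => w; rewrite /ysection /= inE.
  have mI : measurable (good s `&` [set w | bad s w z]).
    by apply: measurableI => //; exact: measurable_good.
  rewrite -expect_indic// expectE; last exact: bounded_measurable_indic.
  rewrite le_eqVlt; apply/orP; left; apply/eqP; apply: eq_integral => w _; rewrite /f /= !indicE in_setI -natrM mulnb.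
  suff -> : (z \in bad s w) = (w \in [set w0 | bad s w0 z]) by [].
  by apply/idP/idP; rewrite !inE.
Qed.

Lemma contacts_earlier_ae s : (s < n)%N ->
  P [set w | ~~ contacts_earlier r (pos w) (con w) s] = 0%E.
Proof.
move=> sn; pose nb w : R := (~~ nilp (neighbours r (pos w) s (x s w)))%:R.
have e := expect_early delta_gt0 model measurable_adjacency cap_sym sn (@measurableT _ (past s.+1 s)).
have mS : measurable [set w | ~~ contacts_earlier r (pos w) (con w) s].
  have := @measurable_past _ _ _ _ P x y s.+1 s.+1 measurableT _ (@past_contacts_earlier s).
  rewrite setTI => /measurableC; congr measurable.
  by apply/seteqP; split => w /=; [move/negP|move=> /negP].
rewrite -expect_indic//.
have bnb : bounded_measurable nb by exact: (@bounded_has_neighbour _ _ r _ _ P x y measurable_adjacency s).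
have byv i : bounded_measurable (fun w => \sum_(v < s) (y s i w == v)%:R : R).
  by apply: bounded_measurable_sum => v _; exact: bounded_contact_eq.
have bpr : bounded_measurable (fun w => \prod_(i < m) \sum_(v < s) (y s i w == v)%:R : R).
  elim: (index_enum _) => [|i l ih].
    by under eq_fun do rewrite big_nil; exact: bounded_measurable_cst.
  by under eq_fun do rewrite big_cons; exact: bounded_measurableM.
have b1 : bounded_measurable (\1_setT : Omega -> R) by exact: bounded_measurable_indic.
(* Failure means having neighbours without all contacts being earlier, so its indicator is a
   difference of two terms with equal integrals. *)
rewrite (_ : \int[P]_w _ = \int[P]_w (\1_setT w * nb w + -1 * (\1_setT w * nb w *
    \prod_(i < m) \sum_(v < s) (y s i w == v)%:R))); last first.
  apply: eq_Rintegral => w _; rewrite earlyE !indicE in_setT.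
  have -> : (w \in [set w | ~~ contacts_earlier r (pos w) (con w) s]) =
      ~~ contacts_earlier r (pos w) (con w) s by apply/idP/idP; rewrite inE.
  rewrite /contacts_earlier /nb /pos /con /positions /contacts.
  by case: (nilp _); case: [forall i, _]; rewrite /=; ring.
rewrite expectD; [|exact: bounded_measurableM|]; last first.
  by apply: bounded_measurableZ; apply: bounded_measurableM => //; exact: bounded_measurableM.
rewrite expectZ; last by apply: bounded_measurableM => //; exact: bounded_measurableM.
by rewrite e mulN1r subrr.
Qed.

(** At the first failing step either a contact is not earlier, a null event, or the exceptional area
    exceeds [b] within [good s], which by Markov's inequality has probability at most [q / b]. *)
Lemma good_prob s : (s <= n)%N -> (P (~` good s) <= (s%:R * (q / b))%:E)%E.
Proof.
elim: s => [_|s ih sn].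
  rewrite mul0r (_ : ~` good 0 = set0) ?measure0//.
  by apply/seteqP; split => // w; apply.
have ms : measurable (small s).
  by have := @measurable_past _ _ _ _ P x y s s measurableT _ (@past_small s); rewrite setTI.
have mE : measurable [set w | ~~ contacts_earlier r (pos w) (con w) s].
  have := @measurable_past _ _ _ _ P x y s.+1 s.+1 measurableT _ (@past_contacts_earlier s).
  rewrite setTI => /measurableC; congr measurable.
  by apply/seteqP; split => w /=; [move/negP|move=> /negP].
have mg := @measurable_good s.
apply: (@le_trans _ _ (P ((~` good s `|` (good s `&` ~` small s)) `|`
   [set w | ~~ contacts_earlier r (pos w) (con w) s]))).
  apply: le_measure; rewrite ?inE.
  - exact/measurableC/measurable_good.
  - apply: measurableU => //; apply: measurableU; first exact: measurableC.
    by apply: measurableI => //; exact: measurableC.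
  - rewrite goodS => w /=; rewrite /setI /setC /= /good_step => /not_andP [|/negP]; first by left; left.
    rewrite negb_and => /orP[|h]; first by right.
    have [gw|gw] := pselect (good s w); last by left; left.
    by left; right; split => //; apply/negP.
apply: (le_trans (measureU2 _ _ _)) => //.
  by apply: measurableU; [exact: measurableC|apply: measurableI => //; exact: measurableC].
rewrite [X in (_ + X <= _)%E](_ : _ = 0%E) ?adde0; last exact: contacts_earlier_ae.
apply: (le_trans (measureU2 _ _ _)); [exact: measurableC|by apply: measurableI => //; exact: measurableC|].
rewrite -natr1 mulrDl mul1r EFinD; apply: leeD; first by apply: ih; exact: ltnW.
have mI : measurable (good s `&` ~` small s) by apply: measurableI => //; exact: measurableC.
apply: (@le_trans _ _ (\int[P]_w \1_(good s `&` ~` small s) w)%:E); first by rewrite expect_indic.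
rewrite lee_fin ler_pdivlMr// mulrC.
apply: le_trans (expect_bad_area (ltnW sn)).
rewrite -expectZ; last exact: bounded_measurable_indic.
apply: expect_le.
- by apply: bounded_measurableZ; exact: bounded_measurable_indic.
- apply: bounded_measurableM; first exact: bounded_measurable_indic.
  exact: bounded_past (@bounded_bad_area s).
move=> w; rewrite !indicE in_setI; case: (_ \in good s) => /=; last by rewrite mulr0 mul0r.
rewrite mul1r; case: (boolP (_ \in _)) => [|_]; last by rewrite mulr0 fine_ge0.
by rewrite inE mulr1 /small /setC /= => /negP; rewrite -ltNge => /ltW.
Qed.

Lemma bad_total_prob t u : (t <= n)%N -> sphere u ->
  (P [set w | bad t w u] <= (q + t%:R * (q / b))%:E)%E.
Proof.
move=> tn su; have mg := @measurable_good t; have mb := measurable_bad_event t u.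
rewrite EFinD; apply: (@le_trans _ _ (P ((good t `&` [set w | bad t w u]) `|` ~` good t))).
  apply: le_measure; rewrite ?inE//.
    by apply: measurableU; [exact: measurableI|exact: measurableC].
  by move=> w bw; have [gw|gw] := pselect (good t w); [left|right].
apply: (le_trans (measureU2 _ _ _)); [exact: measurableI|exact: measurableC|].
by apply: leeD; [exact: bad_prob|exact: good_prob].
Qed.
End Union.
End Concentration.

(** * Rotation invariance of the area *)

Section Preserving.
Context d (X : measurableType d) (R : realType).

Definition preserves (mu : set X -> \bar R) (f : X -> X) :=
  measurable_fun setT f /\ forall S, measurable S -> mu (f @^-1` S) = mu S.

Lemma preserves_comp mu f g : preserves mu f -> preserves mu g -> preserves mu (f \o g).
Proof.
move=> [mf pf] [mg pg]; split; first exact: measurableT_comp.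
move=> S mS; rewrite comp_preimage pg ?pf//.
by rewrite -[X in measurable X]setTI; exact: mf.
Qed.
End Preserving.

Section Skew.
Context d1 d2 (X : measurableType d1) (Y : measurableType d2) (R : realType).
Variables (m1 : {sigma_finite_measure set X -> \bar R}) (m2 : {sigma_finite_measure set Y -> \bar R}).
Local Open Scope ereal_scope.

Lemma preserves_skewr (h : X -> Y -> Y) :
  measurable_fun setT (fun q : X * Y => (q.1, h q.1 q.2)) ->
  (forall p, preserves m2 (h p)) ->
  preserves (m1 \x m2) (fun q => (q.1, h q.1 q.2)).
Proof.
move=> mf ph; split => // S mS; rewrite /product_measure1 /=.
apply: eq_integral => p _ /=; rewrite -[RHS](ph p).2; last exact: measurable_xsection.
congr (m2 _); apply/seteqP; split => z; by rewrite /xsection /= !inE.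
Qed.

(** The product measure is defined by sections along the second factor; maps acting along the first
    need Tonelli to exchange the order. *)
Lemma preserves_skewl (g : Y -> X -> X) :
  measurable_fun setT (fun q : X * Y => (g q.2 q.1, q.2)) ->
  (forall z, preserves m1 (g z)) ->
  preserves (m1 \x m2) (fun q => (g q.2 q.1, q.2)).
Proof.
move=> mf ph; split => // S mS.
have mS' : measurable ((fun q : X * Y => (g q.2 q.1, q.2)) @^-1` S).
  by rewrite -[X in measurable X]setTI; exact: mf.
have E V : measurable V -> (m1 \x m2) V = \int[m2]_z m1 (ysection V z).
  move=> mV; have := @indic_fubini_tonelli _ _ _ _ _ m1 m2 V mV.
  rewrite indic_fubini_tonelli_FE// indic_fubini_tonelli_GE//.
rewrite !E//; apply: eq_integral => z _.
rewrite -[RHS](ph z).2; last exact: measurable_ysection.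
congr (m1 _); apply/seteqP; split => p; by rewrite /ysection /= !inE.
Qed.
End Skew.

Section Shears.
Variable R : realType.
Notation lam := (@lebesgue_measure R).

(** The push-forward agrees with Lebesgue measure on half-open intervals, which determine it. *)
Lemma preserves_translation (k : R) : preserves lam (fun z => z + k).
Proof.
have mt : measurable_fun (setT : set R) (fun z => z + k) by exact: measurable_funD.
split => // S mS.
have mt' : measurable_fun setT ((fun z => z + k) : measurableTypeR R -> measurableTypeR R) by [].
apply/esym.
pose mx := isMeasurableFun.Build _ _ _ _ _ mt'.
pose f : {mfun measurableTypeR R >-> measurableTypeR R} := HB.pack ((fun z => z + k) : measurableTypeR R -> measurableTypeR R) mx.
rewrite (@lebesgue_measure_unique R (pushforward lam f) _ S mS)// => _ [[a b]] _ <-.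
transitivity (lam `](a - k), (b - k)]%classic); last first.
  by congr (lam _); apply/seteqP; split => z /=; rewrite !in_itv /= ltrBlDr lerBrDr.
rewrite !lebesgue_measure_itv /= !lte_fin ltrD2r.
by case: ifP => // _; rewrite -!EFinB; congr (_%:E); ring.
Qed.

Let RR := (measurableTypeR R * measurableTypeR R)%type.
Let lam_itv (n : nat) : lam `[- n%:R, n%:R]%classic = (n%:R + n%:R)%:E.
Proof.
rewrite lebesgue_measure_itv /= lte_fin; case: ltP => [_|nn]; first by rewrite -EFinB opprK.
have n0 : (n%:R : R) <= 0 by lra.
have -> : (n%:R : R) = 0 by apply/eqP; rewrite eq_le n0 ler0n.
by rewrite addr0.
Qed.

Let sigma_finite_lam2 : sigma_finite setT (lam \x lam)%E.
Proof.
exists (fun n => `[- n%:R, n%:R]%classic `*` `[- n%:R, n%:R]%classic).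
  apply/seteqP; split => // -[a b] _.
  have h0 : 0 <= `|(a : R)| + `|(b : R)| by rewrite addr_ge0.
  exists (Num.bound (`|(a : R)| + `|(b : R)|)) => //; rewrite /= !in_itv /= -!ler_norml.
  have h := archi_boundP h0.
  by split; apply: (le_trans _ (ltW h)); rewrite ?lerDl ?lerDr.
move=> n; split; first by apply: measurableX; exact: measurable_itv.
rewrite product_measure1E; try exact: measurable_itv.
rewrite [X in (X < _)%E](_ : _ = ((n%:R + n%:R)%:E * (n%:R + n%:R)%:E)%E); last first.
  by congr (_ * _)%E; exact: lam_itv.
by rewrite -EFinM ltry.
Qed.

Let lam2 : {sigma_finite_measure set RR -> \bar R} := HB.pack (lam \x lam)%E
  (Measure_isSigmaFinite.Build _ _ _ (lam \x lam)%E sigma_finite_lam2).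
Notation vol := (@volume R).

Let m1 : measurable_fun setT (fun q : vec3 R => q.1.1).
Proof. exact: (measurableT_comp measurable_fst measurable_fst). Qed.
Let m2 : measurable_fun setT (fun q : vec3 R => q.1.2).
Proof. exact: (measurableT_comp measurable_snd measurable_fst). Qed.
Let m3 : measurable_fun setT (fun q : vec3 R => q.2).
Proof. exact: measurable_snd. Qed.

Let mDM (d : measure_display) (T : measurableType d) (f g : T -> R) (k : R) :
  measurable_fun setT f -> measurable_fun setT g -> measurable_fun setT (fun q => f q + k * g q).
Proof. by move=> mf mg; apply: measurable_funD => //; apply: measurable_funM. Qed.

Let mpair3 (d : measure_display) (T : measurableType d) (f g h : T -> R) :
  measurable_fun setT f -> measurable_fun setT g -> measurable_fun setT h ->
  measurable_fun setT (fun q => (f q, g q, h q)).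
Proof. by move=> mf mg mh; do 2 apply: measurable_fun_pair => //. Qed.

Lemma preserves_shear21 k : preserves vol (fun q : vec3 R => (q.1.1, q.1.2 + k * q.1.1, q.2)).
Proof.
apply: (@preserves_skewl _ _ RR (measurableTypeR R) R lam2 lam (fun _ (p : R * R) => (p.1, p.2 + k * p.1))).
  by apply: mpair3 => //; exact: mDM.
move=> _; apply: (@preserves_skewr _ _ (measurableTypeR R) (measurableTypeR R) R lam lam (fun a b => b + k * a)); last first.
  by move=> a; exact: preserves_translation.
apply: measurable_fun_pair; first exact: measurable_fst.
by apply: mDM; [exact: measurable_snd|exact: measurable_fst].
Qed.

Lemma preserves_shear12 k : preserves vol (fun q : vec3 R => (q.1.1 + k * q.1.2, q.1.2, q.2)).
Proof.
apply: (@preserves_skewl _ _ RR (measurableTypeR R) R lam2 lam (fun _ (p : R * R) => (p.1 + k * p.2, p.2))).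
  by apply: mpair3 => //; exact: mDM.
move=> _; apply: (@preserves_skewl _ _ (measurableTypeR R) (measurableTypeR R) R lam lam (fun b a => a + k * b)); last first.
  by move=> b; exact: preserves_translation.
apply: measurable_fun_pair; last exact: measurable_snd.
by apply: mDM; [exact: measurable_fst|exact: measurable_snd].
Qed.

Lemma preserves_shear23 k : preserves vol (fun q : vec3 R => (q.1.1, q.1.2 + k * q.2, q.2)).
Proof.
apply: (@preserves_skewl _ _ RR (measurableTypeR R) R lam2 lam (fun z (p : R * R) => (p.1, p.2 + k * z))).
  by apply: mpair3 => //; exact: mDM.
move=> z; apply: (@preserves_skewr _ _ (measurableTypeR R) (measurableTypeR R) R lam lam (fun a b => b + k * z)); last first.
  by move=> a; exact: preserves_translation.
apply: measurable_fun_pair; first exact: measurable_fst.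
by apply: measurable_funD; [exact: measurable_snd|exact: measurable_cst].
Qed.

Lemma preserves_shear32 k : preserves vol (fun q : vec3 R => (q.1, q.2 + k * q.1.2)).
Proof.
apply: (@preserves_skewr _ _ RR (measurableTypeR R) R lam2 lam (fun (p : R * R) z => z + k * p.2)); last first.
  by move=> p; exact: preserves_translation.
by apply: measurable_fun_pair; [exact: measurable_fst|exact: mDM].
Qed.

Definition rot12 (c s : R) (q : vec3 R) : vec3 R :=
  (c * q.1.1 - s * q.1.2, s * q.1.1 + c * q.1.2, q.2).

Definition rot23 (c s : R) (q : vec3 R) : vec3 R :=
  (q.1.1, c * q.1.2 - s * q.2, s * q.1.2 + c * q.2).

(* A planar rotation of angle t is a product of three shears, of slopes
   - tan (t / 2), sin t and - tan (t / 2). *)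
Lemma half_tangent (c s : R) : c ^+ 2 + s ^+ 2 = 1 -> c != -1 ->
  let k := - (s / (1 + c)) in k * (1 + c) = - s /\ 1 + k * s = c.
Proof.
move=> cs c1 k; have c1' : 1 + c != 0 by rewrite addrC addr_eq0.
have kc : k * (1 + c) = - s by rewrite /k mulNr divfK.
split => //; apply: (mulIf c1').
rewrite mulrDl mul1r mulrAC kc mulNr -expr2 (_ : s ^+ 2 = 1 - c ^+ 2); first by ring.
by rewrite -cs; ring.
Qed.

(** The half-turn [c = -1] is excluded, the tangent of its half-angle being infinite. *)
Lemma preserves_rot12 c s : c ^+ 2 + s ^+ 2 = 1 -> c != -1 -> preserves vol (rot12 c s).
Proof.
move=> cs c1; have [kc ks] := half_tangent cs c1.
set k := - (s / (1 + c)) in kc ks.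
have h := preserves_comp (preserves_shear12 k) (preserves_comp (preserves_shear21 s) (preserves_shear12 k)).
set f := (X in preserves _ X) in h.
suff -> : rot12 c s = f by [].
apply/funext => -[[a b] z]; rewrite /rot12 /f /=; congr (_, _, _).
- rewrite [RHS](_ : _ = (1 + k * s) * a + (k * (1 + (1 + k * s))) * b); last by ring.
  by rewrite ks kc; ring.
- rewrite [RHS](_ : _ = s * a + (1 + k * s) * b); last by ring.
  by rewrite ks.
Qed.

Lemma preserves_rot23 c s : c ^+ 2 + s ^+ 2 = 1 -> c != -1 -> preserves vol (rot23 c s).
Proof.
move=> cs c1; have [kc ks] := half_tangent cs c1.
set k := - (s / (1 + c)) in kc ks.
have h := preserves_comp (preserves_shear23 k) (preserves_comp (preserves_shear32 s) (preserves_shear23 k)).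
set f := (X in preserves _ X) in h.
suff -> : rot23 c s = f by [].
apply/funext => -[[a b] z]; rewrite /rot23 /f /=; congr (_, _, _).
- rewrite [RHS](_ : _ = (1 + k * s) * b + (k * (1 + (1 + k * s))) * z); last by ring.
  by rewrite ks kc; ring.
- rewrite [RHS](_ : _ = s * b + (1 + k * s) * z); last by ring.
  by rewrite ks.
Qed.
End Shears.

(** * Areas of caps *)

Section SphereGeometry.
Variable R : realType.
Notation rho := (@rho R).
Notation vol := (@volume R).
Implicit Types (u v w : vec3 R) (k r : R).

Lemma rho_gt0 : 0 < rho.
Proof. by rewrite invr_gt0 mulr_gt0// sqrtr_gt0 pi_gt0. Qed.
Let rho0 := rho_gt0.

Lemma dotC u v : dot u v = dot v u.
Proof. by rewrite /dot; ring. Qed.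

Lemma dot_ge0 u : 0 <= dot u u.
Proof. by rewrite /dot !addr_ge0// -expr2 sqr_ge0. Qed.

Lemma enorm_ge0 u : 0 <= enorm u. Proof. exact: sqrtr_ge0. Qed.

Lemma enorm_sqr u : enorm u ^+ 2 = dot u u.
Proof. by rewrite sqr_sqrtr// dot_ge0. Qed.

Lemma sphereP u : sphere u <-> dot u u = rho ^+ 2.
Proof.
rewrite /sphere /=; split => [<-|uu]; first by rewrite enorm_sqr.
by rewrite /enorm uu sqrtr_sqr ger0_norm// ltW.
Qed.

Lemma enorm_dilate s u : 0 <= s -> enorm (dilate s u) = s * enorm u.
Proof.
move=> s0; rewrite /enorm (_ : dot (dilate s u) (dilate s u) = s ^+ 2 * dot u u).
  by rewrite sqrtrM ?sqr_ge0// sqrtr_sqr ger0_norm.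
by rewrite /dot /dilate /=; ring.
Qed.

Lemma dot_dilate s u v : dot u (dilate s v) = s * dot u v.
Proof. by rewrite /dot /dilate /=; ring. Qed.

Lemma dot_le u v : `|dot u v| <= enorm u * enorm v.
Proof.
rewrite -(@ler_pXn2r _ 2)// ?nnegrE ?mulr_ge0 ?enorm_ge0//.
rewrite exprMn !enorm_sqr real_normK ?num_real// -subr_ge0.
(* Lagrange's identity: the difference is the squared norm of the cross product. *)
rewrite (_ : _ - _ = (u.1.1 * v.1.2 - u.1.2 * v.1.1) ^+ 2 +
  (u.1.1 * v.2 - u.2 * v.1.1) ^+ 2 + (u.1.2 * v.2 - u.2 * v.1.2) ^+ 2).
  by rewrite !addr_ge0// sqr_ge0.
by rewrite /dot; ring.
Qed.

Definition cosine u v := dot u v / (enorm u * enorm v).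

Lemma cosine_itv u v : -1 <= cosine u v <= 1.
Proof.
rewrite -ler_norml /cosine normrM normfV (ger0_norm (mulr_ge0 _ _)) ?enorm_ge0//.
have [->|h] := eqVneq (enorm u * enorm v) 0; first by rewrite invr0 mulr0.
by rewrite ler_pdivrMr ?mul1r ?dot_le// lt_def h mulr_ge0 ?enorm_ge0.
Qed.

Lemma angdist_le u v r : 0 <= r <= pi -> (angdist u v <= r) = (cos r <= cosine u v).
Proof.
move=> rpi; have c1 := cosine_itv u v; rewrite /angdist -/(cosine u v).
have [/andP[a0 api] ca] := acos_def c1.
rewrite -{2}ca leNgt [RHS]leNgt; congr negb.
by rewrite -(ltr_cos (x:=r)) ?in_itv /= ?a0 ?api ?rpi.
Qed.

Lemma capE u r : 0 <= r <= pi -> cap u r = [set v | sphere v /\ cos r <= cosine u v].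
Proof.
move=> rpi; apply/seteqP; split => v [sv h]; split => //.
  by rewrite -angdist_le.
by rewrite angdist_le.
Qed.

Lemma cap_full u r : pi <= r -> cap u r = @sphere R.
Proof.
move=> rpi; apply/seteqP; split => v; first by case.
move=> sv; split => //; apply: le_trans rpi.
exact: (acos_lepi (cosine_itv u v)).
Qed.

(* For u on the sphere, the cap around u of angular radius acos (k / rho). *)
Definition dot_cap k u : set (vec3 R) := [set v | sphere v /\ k * rho <= dot u v].

Lemma cap_dot_cap u r : sphere u -> 0 <= r <= pi -> cap u r = dot_cap (rho * cos r) u.
Proof.
move=> su rpi; rewrite capE//.
have e v : sphere v -> (cos r <= cosine u v) = (rho * cos r * rho <= dot u v).
  move=> sv; rewrite /cosine su sv ler_pdivlMr ?mulr_gt0//.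
  by rewrite (_ : cos r * (rho * rho) = rho * cos r * rho)//; ring.
by apply/seteqP; split => v [sv h]; split => //; move: h; rewrite e.
Qed.

Lemma cap_sym u v r : sphere u -> sphere v -> cap u r v -> cap v r u.
Proof.
by move=> su sv [_ h]; split => //; move: h; rewrite /angdist dotC [enorm v * _]mulrC.
Qed.

(** The last inequality is homogeneous in w, so this is the cone over [dot_cap k u]; the apex is
    missing because [cone] dilates by s > 0. *)
Definition cone_cap k u : set (vec3 R) :=
  [set w | 0 < dot w w <= rho ^+ 2 /\ k * enorm w <= dot u w].

Lemma cone_dot_cap k u : cone (dot_cap k u `&` @sphere R) = cone_cap k u.
Proof.
apply/seteqP; split.
  move=> w [s /=]; rewrite in_itv /= => /andP[s0 s1] [v [[sv kv] _] <-].
  have e : enorm (dilate s v) = s * rho by rewrite enorm_dilate ?ltW// sv.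
  split; last by rewrite e dot_dilate mulrCA ler_wpM2l// ltW.
  rewrite -enorm_sqr e exprn_gt0 ?mulr_gt0//= lerXn2r ?nnegrE ?mulr_ge0 ?(ltW s0) ?(ltW rho0)//.
  by rewrite ger_pMl.
move=> w [/andP[w0 w1] kw].
have ew0 : 0 < enorm w by rewrite sqrtr_gt0.
have ew1 : enorm w <= rho by rewrite -(@ler_pXn2r _ 2) ?nnegrE ?enorm_ge0 ?enorm_sqr// ltW.
exists (enorm w / rho) => /=.
  by rewrite in_itv /= divr_gt0//= ler_pdivrMr// mul1r.
have sv : sphere (dilate (rho / enorm w) w).
  by rewrite /sphere /= enorm_dilate ?divfK ?gt_eqF// divr_ge0// ltW.
exists (dilate (rho / enorm w) w).
  split => //; split => //; rewrite dot_dilate mulrC -mulrA ler_pM2l// mulrC ler_pdivlMr//.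
have e : enorm w / rho * (rho / enorm w) = 1 by rewrite mulrA divfK ?gt_eqF// divff ?gt_eqF.
move: (enorm w / rho) (rho / enorm w) e => p q e.
by rewrite /dilate /= !mulrA e !mul1r; case: (w) => [[]].
Qed.

Lemma measurable_enorm : measurable_fun setT (@enorm R).
Proof.
have m1 : measurable_fun setT (fun q : vec3 R => q.1.1) by exact: (measurableT_comp measurable_fst measurable_fst).
have m2 : measurable_fun setT (fun q : vec3 R => q.1.2) by exact: (measurableT_comp measurable_snd measurable_fst).
have m3 : measurable_fun setT (fun q : vec3 R => q.2) by exact: measurable_snd.
apply: (measurableT_comp (f := @Num.sqrt R)).
  apply: continuous_measurable_fun; exact: sqrt_continuous.
by apply: measurable_funD; [apply: measurable_funD|]; exact: measurable_funM.
Qed.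

Lemma measurable_sphere : measurable (@sphere R).
Proof.
rewrite (_ : @sphere R = @enorm R @^-1` [set rho]); last by [].
by rewrite -[X in measurable X]setTI; exact: (measurable_enorm measurableT (measurable_set1 _)).
Qed.

Lemma measurable_dot (d : measure_display) (T : measurableType d) (f g : T -> vec3 R) :
  measurable_fun setT f -> measurable_fun setT g -> measurable_fun setT (fun t => dot (f t) (g t)).
Proof.
have m1 : measurable_fun setT (fun q : vec3 R => q.1.1) by exact: (measurableT_comp measurable_fst measurable_fst).
have m2 : measurable_fun setT (fun q : vec3 R => q.1.2) by exact: (measurableT_comp measurable_snd measurable_fst).
have m3 : measurable_fun setT (fun q : vec3 R => q.2) by exact: measurable_snd.
move=> mf mg; apply: measurable_funD; [apply: measurable_funD|]; apply: measurable_funM.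
- exact: (measurableT_comp m1 mf).
- exact: (measurableT_comp m1 mg).
- exact: (measurableT_comp m2 mf).
- exact: (measurableT_comp m2 mg).
- exact: (measurableT_comp m3 mf).
- exact: (measurableT_comp m3 mg).
Qed.

Let measurable_le (d : measure_display) (T : measurableType d) (f g : T -> R) :
  measurable_fun setT f -> measurable_fun setT g -> measurable [set t | f t <= g t].
Proof.
move=> mf mg; rewrite -[X in measurable X]setTI.
exact: (measurable_fun_ler mf mg measurableT (Y := [set true])).
Qed.

Let measurable_lt (d : measure_display) (T : measurableType d) (f g : T -> R) :
  measurable_fun setT f -> measurable_fun setT g -> measurable [set t | f t < g t].
Proof.
move=> mf mg; rewrite -[X in measurable X]setTI.
exact: (measurable_fun_ltr mf mg measurableT (Y := [set true])).
Qed.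

Lemma measurable_dot_cap k u : measurable (dot_cap k u).
Proof.
apply: measurableI; first exact: measurable_sphere.
apply: measurable_le; first exact: measurable_cst.
apply: measurable_dot; [exact: measurable_cst|exact: measurable_id].
Qed.

Lemma measurable_cone_cap k u : measurable (cone_cap k u).
Proof.
rewrite (_ : cone_cap k u = [set w | 0 < dot w w] `&` [set w | dot w w <= rho ^+ 2] `&`
   [set w | k * enorm w <= dot u w]).
  have md : measurable_fun setT (fun w : vec3 R => dot w w) by apply: measurable_dot; exact: measurable_id.
  apply: measurableI; first apply: measurableI.
  - by apply: measurable_lt; [exact: measurable_cst|].
  - by apply: measurable_le; [|exact: measurable_cst].
  - apply: measurable_le; last by apply: measurable_dot; [exact: measurable_cst|exact: measurable_id].
    by apply: measurable_funM; [exact: measurable_cst|exact: measurable_enorm].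
apply/seteqP; split => w; first by move=> [/andP[h1 h2] h3].
by move=> [[h1 h2] h3]; split => //; apply/andP.
Qed.

(** The comparison of cosines describes the cap up to r = pi only; beyond, the cap is the whole
    sphere. *)
Lemma measurable_adjacency r : 0 <= r -> measurable [set z : vec3 R * vec3 R | cap z.1 r z.2].
Proof.
move=> r0.
have mS : measurable [set z : vec3 R * vec3 R | sphere z.2].
  by have := @measurable_snd _ _ (vec3 R) (vec3 R) measurableT _ measurable_sphere; rewrite setTI.
have [rpi|/ltW rpi] := leP r pi; last first.
  rewrite (_ : [set z | _] = [set z : vec3 R * vec3 R | sphere z.2])//.
  by apply/seteqP; split => z /=; rewrite cap_full.
rewrite (_ : [set z | _] = [set z : vec3 R * vec3 R | sphere z.2] `&` [set z | cos r <= cosine z.1 z.2]); last first.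
  by apply/seteqP; split => z /=; rewrite capE ?r0.
apply: measurableI => //; apply: measurable_le; first exact: measurable_cst.
have mf : measurable_fun setT (fun z : vec3 R * vec3 R => z.1) by exact: measurable_fst.
have ms : measurable_fun setT (fun z : vec3 R * vec3 R => z.2) by exact: measurable_snd.
apply: measurable_funM; first exact: measurable_dot.
under eq_fun => q do rewrite -powR_inv1 ?mulr_ge0 ?enorm_ge0//.
apply: (measurableT_comp (measurable_powR _)).
by apply: measurable_funM; [exact: (measurableT_comp measurable_enorm mf)|exact: (measurableT_comp measurable_enorm ms)].
Qed.

Lemma area_dot_cap k u : area (dot_cap k u) = ((3 / rho)%:E * vol (cone_cap k u))%E.
Proof. by rewrite /area cone_dot_cap. Qed.

Lemma dot_rot12 c s u v : c ^+ 2 + s ^+ 2 = 1 -> dot (rot12 c s u) (rot12 c s v) = dot u v.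
Proof.
move=> cs; rewrite /dot /rot12 /=.
rewrite [LHS](_ : _ = (c ^+ 2 + s ^+ 2) * (u.1.1 * v.1.1 + u.1.2 * v.1.2) + u.2 * v.2); last by ring.
by rewrite cs mul1r.
Qed.

Lemma dot_rot23 c s u v : c ^+ 2 + s ^+ 2 = 1 -> dot (rot23 c s u) (rot23 c s v) = dot u v.
Proof.
move=> cs; rewrite /dot /rot23 /=.
rewrite [LHS](_ : _ = u.1.1 * v.1.1 + (c ^+ 2 + s ^+ 2) * (u.1.2 * v.1.2 + u.2 * v.2)); last by ring.
by rewrite cs mul1r addrA.
Qed.

Lemma vol_cone_cap_isometry (f : vec3 R -> vec3 R) k u : preserves vol f ->
  (forall v w, dot (f v) (f w) = dot v w) ->
  vol (cone_cap k (f u)) = vol (cone_cap k u).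
Proof.
move=> [_ pf] df; rewrite -pf; last exact: measurable_cone_cap.
congr (vol _); apply/seteqP; split => w; rewrite /cone_cap /= /enorm !df//.
Qed.

(** A rotation about the third axis brings u into the plane of the last two coordinates, and one
    within that plane takes it to the pole. *)
Lemma vol_cone_cap_pole k u : sphere u -> vol (cone_cap k u) = vol (cone_cap k (0, 0, rho)).
Proof.
(* Hides the volume behind an opaque function. *)
have [V VE] : exists V : vec3 R -> \bar R, forall w, V w = vol (cone_cap k w) by exists (fun w => vol (cone_cap k w)).
rewrite -!VE.
have V12 c s w : c ^+ 2 + s ^+ 2 = 1 -> c != -1 -> V (rot12 c s w) = V w.
  by move=> cs c1; rewrite !VE; apply: vol_cone_cap_isometry; [exact: preserves_rot12|move=> *; exact: dot_rot12].
have V23 c s w : c ^+ 2 + s ^+ 2 = 1 -> c != -1 -> V (rot23 c s w) = V w.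
  by move=> cs c1; rewrite !VE; apply: vol_cone_cap_isometry; [exact: preserves_rot23|move=> *; exact: dot_rot23].
have unit_ratio (a b h : R) : 0 < h -> a ^+ 2 + b ^+ 2 = h ^+ 2 -> a != 0 ->
    (b / h) ^+ 2 + (a / h) ^+ 2 = 1 /\ b / h != -1.
  move=> h0 abh a0.
  have e : (b / h) ^+ 2 + (a / h) ^+ 2 = 1.
    by rewrite !exprMn -mulrDl [b ^+ 2 + _]addrC abh exprVn divff// expf_neq0// gt_eqF.
  split => //; apply/eqP => bh; move: e; rewrite bh sqrrN expr1n => /eqP.
  rewrite eq_sym addrC -subr_eq subrr eq_sym sqrf_eq0 mulf_eq0 (negbTE a0) /=.
  by rewrite invr_eq0 gt_eqF.
have merid b z : b ^+ 2 + z ^+ 2 = rho ^+ 2 -> b != 0 -> V (0, b, z) = V (0, 0, rho).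
  move=> bz b0; have [cs c1] := unit_ratio b z rho rho0 bz b0.
  rewrite -(V23 _ _ (0, b, z) cs c1); suff -> : rot23 (z / rho) (b / rho) (0, b, z) = (0, 0, rho) by [].
  rewrite /rot23 /=; congr (_, _, _); first by ring.
  have -> : b / rho * b + z / rho * z = (b ^+ 2 + z ^+ 2) / rho by ring.
  by rewrite bz expr2 mulfK// gt_eqF.
have merid0 b z : b ^+ 2 + z ^+ 2 = rho ^+ 2 -> V (0, b, z) = V (0, 0, rho).
  move=> bz; have [b0|b0] := eqVneq b 0; last exact: merid.
  have z0 : z != 0.
    apply/eqP => z0; move/eqP: bz; rewrite b0 z0 expr0n addr0 eq_sym.
    by rewrite sqrf_eq0 gt_eqF.
  (* On the axis a quarter-turn comes first, since the south pole would call for the excluded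
     half-turn. *)
  have cs : (0 : R) ^+ 2 + 1 ^+ 2 = 1 by rewrite expr0n expr1n add0r.
  have c1 : (0 : R) != -1 by rewrite eq_sym oppr_eq0 oner_eq0.
  rewrite -(V23 0 1 (0, b, z) cs c1).
  have -> : rot23 0 1 (0, b, z) = (0, - z, b).
    by rewrite /rot23 /=; congr (_, _, _); ring.
  by rewrite merid ?oppr_eq0// sqrrN addrC.
case: u => [[a b] z] /sphereP; rewrite /dot /= -!expr2 => su.
have [a0|a0] := eqVneq a 0; first by rewrite a0 merid0// -su a0 expr0n add0r.
pose h := Num.sqrt (a ^+ 2 + b ^+ 2).
have ab0 : 0 < a ^+ 2 + b ^+ 2 by rewrite ltr_pwDl ?sqr_ge0// exprn_even_gt0.
have h0 : 0 < h by rewrite sqrtr_gt0.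
have abh : a ^+ 2 + b ^+ 2 = h ^+ 2 by rewrite sqr_sqrtr// ltW.
have [cs c1] := unit_ratio a b h h0 abh a0.
rewrite -(V12 _ _ (a, b, z) cs c1).
have -> : rot12 (b / h) (a / h) (a, b, z) = (0, h, z).
  rewrite /rot12 /=; congr (_, _, _); first by ring.
  have -> : a / h * a + b / h * b = (a ^+ 2 + b ^+ 2) / h by ring.
  by rewrite abh expr2 mulfK// gt_eqF.
by rewrite merid0// -su abh.
Qed.

Lemma area_dot_cap_pole k u : sphere u -> area (dot_cap k u) = area (dot_cap k (0, 0, rho)).
Proof. by move=> su; rewrite !area_dot_cap vol_cone_cap_pole. Qed.
End SphereGeometry.

Section AreaBounds.
Variable R : realType.
Notation rho := (@rho R).
Notation vol := (@volume R).
Notation lam := (@lebesgue_measure R).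
Implicit Types (u v w : vec3 R) (k r : R).
Let rho0 : 0 < rho. Proof. exact: rho_gt0. Qed.

Lemma volume_box (h a b : R) : 0 <= h -> a <= b ->
  vol ((`[- h, h]%classic `*` `[- h, h]%classic) `*` `[a, b]%classic) = ((2 * h) ^+ 2 * (b - a))%:E.
Proof.
move=> h0 ab.
have lamI (c d : R) : c <= d -> lam `[c, d]%classic = (d - c)%:E.
  move=> cd; rewrite lebesgue_measure_itv /= lte_fin -EFinB; case: ltP => // dc.
  have -> : c = d by apply/eqP; rewrite eq_le cd dc.
  by rewrite subrr.
have hh : - h <= h by rewrite ge0_cp.
rewrite /volume.
have := lamI _ _ hh; have := lamI _ _ ab.
have : measurable (`[- h, h]%classic : set (measurableTypeR R)) by exact: measurable_itv.
have : measurable (`[a, b]%classic : set (measurableTypeR R)) by exact: measurable_itv.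
move: (`[- h, h]%classic) (`[a, b]%classic) => I J mJ mI lJ lI.
transitivity ((lam I * lam I) * lam J)%E; last first.
  by rewrite lJ lI -!EFinM; congr (_%:E); ring.
rewrite product_measure1E; [|exact: measurableX|by []].
by congr (_ * _)%E; exact: (product_measure1E lam lam mI mI).
Qed.

(** The cone contains a box with third coordinate between [rho / 4] and [rho / 2] and half-width
    [rho * sqrt e / 4], of volume [rho ^+ 3 * e / 16]. *)
Lemma area_dot_cap_ge u (e : R) : sphere u -> 0 < e <= 1 ->
  ((3 / 16 * rho ^+ 2 * e)%:E <= area (dot_cap (rho * (1 - e)) u))%E.
Proof.
move=> su /andP[e0 e1]; rewrite area_dot_cap_pole// area_dot_cap.
pose h := rho * Num.sqrt e / 4.
have s0 : 0 <= Num.sqrt e by exact: sqrtr_ge0.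
have ss : Num.sqrt e ^+ 2 = e by rewrite sqr_sqrtr// ltW.
have h0 : 0 <= h by rewrite /h !mulr_ge0 ?invr_ge0// ltW.
have hE : h ^+ 2 = rho ^+ 2 * e / 16.
  by rewrite /h -[in RHS]ss; field.
have h42 : rho / 4 <= rho / 2 by have := rho0; lra.
have := volume_box h0 h42; set B := (X in vol X) => vE.
apply: (@le_trans _ _ ((3 / rho)%:E * vol B)%E).
  rewrite vE -EFinM lee_fin exprMn hE.
  by rewrite [leRHS](_ : _ = 3 / 16 * rho ^+ 2 * e)//; field; exact: lt0r_neq0.
apply: lee_wpmul2l; first by rewrite lee_fin divr_ge0// ltW.
apply: le_measure; rewrite ?inE.
- by apply: measurableX; [apply: measurableX|]; exact: measurable_itv.
- exact: measurable_cone_cap.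
move=> [[a b] z] [[/=]]; rewrite !in_itv /= -!ler_norml => ah bh /andP[z1 z2].
have a2 : a ^+ 2 <= rho ^+ 2 * e / 16.
  by rewrite -hE -(real_normK (num_real a)) lerXn2r ?nnegrE.
have b2 : b ^+ 2 <= rho ^+ 2 * e / 16.
  by rewrite -hE -(real_normK (num_real b)) lerXn2r ?nnegrE.
have z0 : 0 < z by apply: lt_le_trans z1; rewrite divr_gt0.
have zz1 : rho ^+ 2 / 16 <= z ^+ 2 by rewrite !expr2; nra.
have zz2 : z ^+ 2 <= rho ^+ 2 / 4 by rewrite !expr2; nra.
have re : rho ^+ 2 * e <= rho ^+ 2 by rewrite ler_piMr// sqr_ge0.
split.
  rewrite /dot /= -!expr2; apply/andP; split.
    by rewrite ltr_wpDl ?addr_ge0 ?sqr_ge0// exprn_gt0.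
  have := exprn_gt0 2 rho0; lra.
rewrite /dot /= !mul0r !add0r -mulrA ler_pM2l//.
have [e1'|] := leP (1 - e) 0.
  by apply: (le_trans _ (ltW z0)); rewrite mulr_le0_ge0// enorm_ge0.
move=> e1'.
rewrite -(@ler_pXn2r _ 2) ?nnegrE ?mulr_ge0 ?enorm_ge0 ?(ltW z0) ?(ltW e1')//.
rewrite exprMn enorm_sqr /dot /= -!expr2.
have h3 : a ^+ 2 + b ^+ 2 + z ^+ 2 <= (1 + 2 * e) * z ^+ 2.
  have : rho ^+ 2 / 16 * e <= z ^+ 2 * e by rewrite ler_wpM2r// ltW.
  lra.
apply: (@le_trans _ _ ((1 - e) ^+ 2 * ((1 + 2 * e) * z ^+ 2))).
  by rewrite ler_wpM2l// sqr_ge0.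
rewrite mulrA ler_piMl ?sqr_ge0//.
(* (1 - e)^2 (1 + 2 e) = 1 - e^2 (3 - 2 e). *)
have : 0 <= e ^+ 2 * (3 - 2 * e) by rewrite mulr_ge0 ?sqr_ge0//; lra.
rewrite !expr2; nra.
Qed.

(** The cone lies in a box of height [2 * rho]: if e <= 1, its points of norm l satisfy a^2 + b^2 <=
    (1 - (1 - e)^2) l^2 <= 2 e rho^2; if e > 1, the half-width exceeds [rho]. *)
Lemma area_dot_cap_le u (e : R) : sphere u -> 0 <= e ->
  (area (dot_cap (rho * (1 - e)) u) <= (48 * rho ^+ 2 * e)%:E)%E.
Proof.
move=> su e0; rewrite area_dot_cap_pole// area_dot_cap.
pose h := rho * Num.sqrt (2 * e).
have e20 : 0 <= 2 * e by rewrite mulr_ge0.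
have s0 : 0 <= Num.sqrt (2 * e) by exact: sqrtr_ge0.
have h0 : 0 <= h by rewrite mulr_ge0// ltW.
have hE : h ^+ 2 = rho ^+ 2 * (2 * e) by rewrite /h exprMn sqr_sqrtr.
have hrr : - rho <= rho by have := rho0; lra.
have := volume_box h0 hrr; set B := (X in vol X) => vE.
apply: (@le_trans _ _ ((3 / rho)%:E * vol B)%E); last first.
  rewrite vE -EFinM lee_fin exprMn hE.
  by rewrite [leLHS](_ : _ = 48 * rho ^+ 2 * e)//; field; exact: lt0r_neq0.
apply: lee_wpmul2l; first by rewrite lee_fin divr_ge0// ltW.
apply: le_measure; rewrite ?inE.
- exact: measurable_cone_cap.
- by apply: measurableX; [apply: measurableX|]; exact: measurable_itv.
move=> [[a b] z] [/andP[w0 w1]].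
rewrite {1}/dot /= !mul0r !add0r -mulrA ler_pM2l// => kz.
have en := enorm_sqr (a, b, z); have en0 := enorm_ge0 (a, b, z).
move: (enorm (a, b, z)) en en0 kz => l en l0 kz.
rewrite -en in w1; rewrite /dot /= -!expr2 in en.
have a0 := sqr_ge0 a; have b0 := sqr_ge0 b; have z0 := sqr_ge0 z.
have ab : a ^+ 2 + b ^+ 2 <= h ^+ 2.
  rewrite hE; have [e1|e1] := leP e 1; last first.
    have : rho ^+ 2 * 1 <= rho ^+ 2 * (2 * e) by rewrite ler_wpM2l ?sqr_ge0//; lra.
    lra.
  have kz2 : ((1 - e) * l) ^+ 2 <= z ^+ 2.
    rewrite -(real_normK (num_real z)) lerXn2r ?nnegrE ?mulr_ge0//; first lra.
    exact: le_trans kz (ler_norm _).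
  have : l ^+ 2 * (2 * e) <= rho ^+ 2 * (2 * e) by rewrite ler_wpM2r.
  have : 0 <= e ^+ 2 * l ^+ 2 by rewrite mulr_ge0 ?sqr_ge0.
  move: kz2 en; rewrite !expr2; nra.
have norm_le (t d : R) : 0 <= d -> t ^+ 2 <= d ^+ 2 -> `|t| <= d.
  by move=> d0 td; rewrite -(@ler_pXn2r _ 2) ?nnegrE// real_normK ?num_real.
split; first split; rewrite /= in_itv /= -ler_norml; apply: norm_le => //.
- lra.
- lra.
- exact: ltW.
- lra.
Qed.

(** Up to 1/2 by the mean value theorem; from there to pi / 2 < 2, sine stays above sin(1/2), which
    is at least cos(1/2) / 2. *)
Lemma sin_ge_linear (z : R) : 0 <= z <= pi / 2 -> cos 2^-1 / 4 * z <= sin z.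
Proof.
move=> /andP[z0 zpi]; have := pi_ge2 R; have := pihalf_lt2 R => p1 p2.
have c0 : 0 < cos (2^-1 : R) by apply: cos_gt0_pihalf; lra.
have small (v : R) : 0 <= v <= 2^-1 -> cos 2^-1 * v <= sin v.
  move=> /andP[v0 v2].
  have [c] := @MVT_segment R sin cos 0 v v0 (fun t _ => is_derive_sin t) ltac:(by apply: continuous_subspaceT => t; exact: continuous_sin).
  rewrite in_itv /= => /andP[c0' cv]; rewrite sin0 !subr0 => ->.
  rewrite ler_wpM2r// leNgt ltr_cos ?in_itv /=; [rewrite -leNgt; lra|..];
    by apply/andP; split; lra.
have [z2|z2] := leP z 2^-1.
  have := small z; rewrite z0 z2 => /(_ isT).
  have : 0 <= cos (2^-1) * z by rewrite mulr_ge0// ltW.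
  lra.
have s2 : cos 2^-1 * 2^-1 <= sin (2^-1 : R) by apply: small; lra.
have : sin 2^-1 < sin z by rewrite ltr_sin ?in_itv //=; apply/andP; split; lra.
have : cos 2^-1 * z <= cos 2^-1 * 2 by rewrite ler_wpM2l ?ltW//; lra.
lra.
Qed.

Definition cap_const : R := 3 / 512 * rho ^+ 2 * (cos 2^-1 / 4) ^+ 2.

Lemma cap_const_gt0 : 0 < cap_const.
Proof.
have := pi_ge2 R; have := pihalf_lt2 R => p1 p2.
have c0 : 0 < cos (2^-1 : R) by apply: cos_gt0_pihalf; lra.
have n0 : 0 < 3 / 512 :> R by rewrite divr_gt0 ?ltr0n.
by rewrite /cap_const mulr_gt0 ?(mulr_gt0 n0)// exprn_gt0 ?rho_gt0 ?divr_gt0.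
Qed.

(** On the sphere, 1 - cos is the squared chord over [2 * rho ^+ 2], so the factor 4 doubles the
    chord. Once [4 * (1 - cos r)] reaches 2 this is the whole sphere. *)
Definition wide_cap r u : set (vec3 R) := dot_cap (rho * (1 - 4 * (1 - cos r))) u.

Let pole_sphere : sphere ((0, 0, rho) : vec3 R).
Proof. by apply/sphereP; rewrite /dot /= !mul0r !add0r expr2. Qed.

Section Cap.
Variable r : R.
Hypothesis rpi : 0 < r <= pi.
Let rpi' : 0 <= r <= pi. Proof. by have /andP[/ltW -> ->] := rpi. Qed.
Let e := 1 - cos r.
Let e_gt0 : 0 < e.
Proof.
rewrite subr_gt0 -cos0 ltr_cos ?in_itv /= ?lexx ?pi_ge0//; by have /andP[] := rpi.
Qed.
Let e_le2 : e <= 2. Proof. by have := cos_geN1 r; rewrite /e; lra. Qed.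

Lemma area_capE u : sphere u -> area (cap u r) = (cap_area r)%:E.
Proof.
move=> su; rewrite cap_dot_cap// area_dot_cap_pole// /cap_area [in RHS]cap_dot_cap//.
rewrite fineK// ge0_fin_numE; last first.
  by rewrite area_dot_cap mule_ge0// lee_fin divr_ge0// ltW.
have -> : cos r = 1 - e by rewrite /e; ring.
by apply: le_lt_trans (area_dot_cap_le pole_sphere (ltW e_gt0)) _; rewrite ltry.
Qed.

(** [area_dot_cap_ge] takes a parameter at most 1, while [e] reaches 2 at r = pi; hence it is
    applied to [e / 2]. *)
Lemma cap_area_ge : 3 / 32 * rho ^+ 2 * e <= cap_area r.
Proof.
rewrite -lee_fin -(area_capE pole_sphere) cap_dot_cap//.
have e2 : 0 < e / 2 <= 1 by move: e_gt0 e_le2; lra.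
apply: (@le_trans _ _ (3 / 16 * rho ^+ 2 * (e / 2))%:E); first by rewrite lee_fin; lra.
apply: (le_trans (area_dot_cap_ge pole_sphere e2)).
rewrite !area_dot_cap; apply: lee_wpmul2l; first by rewrite lee_fin divr_ge0// ltW.
apply: le_measure; rewrite ?inE; [exact: measurable_cone_cap..|].
move=> w [w0 kw]; split => //; apply: le_trans kw.
rewrite ler_wpM2r ?enorm_ge0// ler_wpM2l ?(ltW rho0)//.
by move: e_gt0; rewrite /e; lra.
Qed.

(** 1 - cos r = 2 sin^2 (r / 2), and sine has a linear lower bound on [0, pi / 2]. *)
Lemma cap_area_ge_square : cap_const * r ^+ 2 <= cap_area r.
Proof.
apply: le_trans cap_area_ge.
have er : e = 2 * sin (r / 2) ^+ 2.
  rewrite /e -[r in cos r](_ : (r / 2) *+ 2 = r); last by rewrite -mulr_natr divfK.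
  rewrite cos_mulr2n sin2cos2; ring.
have /andP[r0 rp] := rpi.
have := @sin_ge_linear (r / 2); set c := cos _ / 4 => h.
have c0 : 0 < c.
  have := pi_ge2 R; have := pihalf_lt2 R => p1 p2.
  by rewrite /c divr_gt0//; apply: cos_gt0_pihalf; lra.
have s2 : (c * (r / 2)) ^+ 2 <= sin (r / 2) ^+ 2.
  have cr : 0 <= c * (r / 2) by rewrite mulr_ge0 ?ltW// divr_gt0.
  have cs : c * (r / 2) <= sin (r / 2) by apply: h; lra.
  by rewrite lerXn2r ?nnegrE// (le_trans cr cs).
rewrite er /cap_const -/c.
have : 3 / 32 * rho ^+ 2 * (2 * (c * (r / 2)) ^+ 2) <= 3 / 32 * rho ^+ 2 * (2 * sin (r / 2) ^+ 2).
  by apply: ler_wpM2l; [rewrite mulr_ge0 ?sqr_ge0//; lra|apply: ler_wpM2l; [lra|]].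
apply: le_trans.
rewrite (_ : 3 / 32 * rho ^+ 2 * (2 * (c * (r / 2)) ^+ 2) = 3 / 64 * (rho ^+ 2 * (c * r) ^+ 2)); last by field.
rewrite [leLHS](_ : _ = 3 / 512 * (rho ^+ 2 * (c * r) ^+ 2)); last by field.
by have : 0 <= rho ^+ 2 * (c * r) ^+ 2; [rewrite mulr_ge0 ?sqr_ge0|move: (_ * _ : R) => q q0; lra].
Qed.

(** 48 * 4 = 2048 * 3 / 32. *)
Lemma area_wide_cap u : sphere u -> (area (wide_cap r u) <= (2048 * cap_area r)%:E)%E.
Proof.
move=> su; apply: (le_trans (area_dot_cap_le su _)); first by rewrite mulr_ge0// ltW.
rewrite lee_fin; have := cap_area_ge; rewrite -/e; lra.
Qed.

Lemma cap_wide u : sphere u -> cap u r `<=` wide_cap r u.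
Proof.
move=> su; rewrite cap_dot_cap// => v [sv kv]; split => //; apply: le_trans kv.
rewrite ler_wpM2r ?(ltW rho0)// ler_wpM2l ?(ltW rho0)//; move: e_gt0; rewrite /e; lra.
Qed.

(* The chord satisfies |z - u|^2 <= 2 |z - v|^2 + 2 |v - u|^2. *)
Lemma cap_cap_wide u v z : sphere u -> cap u r v -> cap v r z -> wide_cap r u z.
Proof.
move=> su uv vz; have sv : sphere v by case: uv.
move: uv vz; rewrite !cap_dot_cap// => -[_ uv] [sz vz]; split => //.
have := dot_ge0 (z.1.1 - 2 * v.1.1 + u.1.1, z.1.2 - 2 * v.1.2 + u.1.2, z.2 - 2 * v.2 + u.2).
rewrite (_ : dot _ _ = dot z z + 4 * dot v v + dot u u - 4 * dot v z - 4 * dot u v + 2 * dot u z); last first.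
  by rewrite /dot /=; ring.
move/sphereP : su sz sv => -> /sphereP -> /sphereP ->; move: uv vz; rewrite expr2; nra.
Qed.

Lemma measurable_wide u : measurable (wide_cap r u).
Proof. exact: measurable_dot_cap. Qed.
End Cap.
End AreaBounds.

(** * Error schedule and barriers *)

Section PowerBounds.
Variable R : realType.
Implicit Types (k x z a b c : R).

Lemma powR_ratio a b c k : 0 < a -> 0 < b -> 0 < c -> (a / b) `^ k * (b / c) `^ k = (a / c) `^ k.
Proof.
move=> a0 b0 c0; rewrite -powRM ?divr_ge0 ?ltW//; congr (_ `^ _).
by field; rewrite !lt0r_neq0.
Qed.

(** Young's inequality for the product of [z ^ k] and 1, with exponents 1 / k and 1 / (1 - k). *)
Lemma powR_le_affine k z : 0 < k < 1 -> 0 <= z -> z `^ k <= k * z + (1 - k).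
Proof.
move=> /andP[k0 k1] z0; have k1' : 0 < 1 - k by rewrite subr_gt0.
have := @conjugate_powR R (z `^ k) 1 k^-1 (1 - k)^-1 (powR_ge0 _ _) ler01.
rewrite !invr_gt0 !invrK k0 k1' => /(_ isT isT).
rewrite addrCA subrr addr0 => /(_ erefl).
by rewrite mulr1 -powRrM mulfV ?lt0r_neq0// powRr1// powR1 mul1r mulrC.
Qed.

(** Together with [shrink_le], encloses the factor by which [eps] decreases between ratios of
    consecutive powers. *)
Lemma shrink_ge k s : 0 < k < 1 ->
  (s%:R / s.+1%:R) `^ k <= 1 - k / s.+1%:R :> R.
Proof.
move=> k01; have s0 : 0 < s.+1%:R :> R by rewrite ltr0n.
apply: (le_trans (powR_le_affine k01 _)); first by rewrite divr_ge0.
rewrite le_eqVlt; apply/orP; left; apply/eqP.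
by rewrite -[in s%:R](addrK 1 s%:R) natr1; field; rewrite lt0r_neq0.
Qed.

Lemma shrink_le k s : 0 < k ->
  1 - k / s.+1%:R <= (s.+1%:R / s.+2%:R) `^ k :> R.
Proof.
move=> k0; have s0 : 0 < s.+1%:R :> R by rewrite ltr0n.
have s2 : 0 < s.+2%:R :> R by rewrite ltr0n.
rewrite /powR gt_eqF ?divr_gt0//.
apply: (@le_trans _ _ (expR (- (k / s.+1%:R)))); first exact: expR_ge1Dx.
rewrite ler_expR -mulrN ler_pM2l// -[_ / _ in leRHS]invf_div lnV ?posrE ?divr_gt0// lerN2.
rewrite (_ : s.+2%:R / s.+1%:R = 1 + s.+1%:R^-1); last by rewrite -natr1; field; rewrite lt0r_neq0.
by apply: le_ln1Dx; rewrite (lt_trans (ltrN10 R))// invr_gt0.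
Qed.

(** 1551/2000 * (1 + 1/4) < 1, hence the condition [4 <= s]. For p = 2 / M the constant is 1551/1000
    / M, and 1551/1000 exceeds (1 + 1/5000)(1 + 11/20), the largest coefficient in the slopes of the
    drift. *)
Lemma growth_le p s : 0 < p -> (4 <= s)%N ->
  1 + (1551 / 2000 * p) / s%:R <= (s.+1%:R / s%:R) `^ p :> R.
Proof.
move=> p0 s4; have s0 : 0 < s%:R :> R by rewrite ltr0n (leq_trans _ s4).
have s1 : 0 < s.+1%:R :> R by rewrite ltr0n.
rewrite /powR gt_eqF ?divr_gt0//.
apply: (le_trans (expR_ge1Dx _)); rewrite ler_expR mulrAC [leRHS]mulrC ler_pM2r//.
rewrite -[_ / _ in leRHS]invf_div lnV ?posrE ?divr_gt0//.
rewrite (_ : s%:R / s.+1%:R = 1 + (- s.+1%:R^-1)); last by rewrite -natr1; field; rewrite natr1 lt0r_neq0.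
rewrite lerNr; apply: le_trans (le_ln1Dx _) _.
  by rewrite ltrN2 invf_lt1// ltr1n; case: (s) s4.
have si : s%:R^-1 <= 4^-1 :> R by rewrite lef_pV2 ?posrE// ler_nat.
rewrite lerN2; suff : 1551 / 2000 / s%:R * s.+1%:R <= 1 :> R.
  by rewrite -(ler_pdivlMr _ _ s1) div1r.
rewrite (_ : _ * s.+1%:R = 1551 / 2000 * (1 + s%:R^-1)); last by rewrite -natr1; field; rewrite lt0r_neq0.
lra.
Qed.

End PowerBounds.

Section Barriers.
Variables (R : realType) (M kappa : R) (t0 t1 : nat).
Hypotheses (M_gt3 : 3 < M) (kappa01 : 0 < kappa < 1).
Hypotheses (M_kappa : 21 / 8 <= M * (1 - kappa)) (kappa_M : 2 * kappa + 2 / M <= 1).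
Hypotheses (t0_ge4 : (4 <= t0)%N) (t0_t1 : 120 ^+ 6 * t0%:R <= t1%:R :> R).
Let p := 2 / M.

(* The relative error tolerated at time s: a constant up to t1, and then a
   sequence of order s ^ (- kappa). *)
Fixpoint eps (s : nat) : R :=
  if s is s'.+1 then
    if (s' < t1)%N then 11 / 20 else eps s' * (1 - kappa / s'.+1%:R)
  else 11 / 20.

Let M0 : 0 < M. Proof. by have := M_gt3; lra. Qed.
Let p0 : 0 < p. Proof. by rewrite divr_gt0. Qed.
Let t0R : 4 <= t0%:R :> R. Proof. by rewrite ler_nat. Qed.
Let t01 : (t0 < t1)%N.
Proof.
rewrite -(ltr_nat R); apply: lt_le_trans t0_t1.
have : (120 : R) ^+ 6 = 120 * 120 * 120 * 120 * 120 * 120 by rewrite !exprS expr0; ring.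
move: t0R; lra.
Qed.

Lemma eps_early s : (s <= t1)%N -> eps s = 11 / 20.
Proof. by case: s => [|s] //= ->. Qed.

Lemma epsS s : (t1 <= s)%N -> eps s.+1 = eps s * (1 - kappa / s.+1%:R).
Proof. by move=> h /=; rewrite ltnNge h. Qed.

Let shrink01 s : 0 < 1 - kappa / s.+1%:R <= 1.
Proof.
have /andP[k0 k1] := kappa01; have s0 : 0 < s.+1%:R :> R by rewrite ltr0n.
rewrite subr_gt0 ltr_pdivrMr// mul1r (lt_le_trans k1) ?ler1n//=.
by rewrite gerDl oppr_le0 divr_ge0// ltW.
Qed.

Lemma eps_gt0 s : 0 < eps s.
Proof.
elim: s => [|s ih] /=; first by lra.
by case: ifP => _; [lra|rewrite mulr_gt0//; have /andP[] := shrink01 s].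
Qed.

Lemma eps_antitone s t : (s <= t)%N -> eps t <= eps s.
Proof.
elim: t => [|t ih]; first by case: s.
rewrite leq_eqVlt => /predU1P[->//|]; rewrite ltnS => st.
have [tt1|t1t] := ltnP t t1.
  by rewrite !eps_early// ltnW// (leq_ltn_trans st).
rewrite epsS//; apply: le_trans (ih st).
by have /andP[_ h] := shrink01 t; rewrite ler_piMr// ltW// eps_gt0.
Qed.

Lemma eps_le s : eps s <= 11 / 20.
Proof. exact: (eps_antitone (leq0n s)). Qed.

Lemma eps_ge_power t : (0 < t1)%N -> (t1 <= t)%N -> 11 / 20 * (t1%:R / t%:R) `^ kappa <= eps t.
Proof.
move=> t1p; have t1R : 0 < t1%:R :> R by rewrite ltr0n.
elim: t => [|t ih]; first by rewrite leqNgt t1p.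
rewrite leq_eqVlt => /predU1P[<-|].
  by rewrite eps_early// divff ?lt0r_neq0// powR1 mulr1.
rewrite ltnS => t1t; have t0' : 0 < t%:R :> R by rewrite (lt_le_trans t1R)// ler_nat.
rewrite epsS// -(powR_ratio kappa t1R t0') ?ltr0n// mulrA.
by apply: ler_pM; rewrite ?mulr_ge0 ?powR_ge0// ?ih ?shrink_ge//; lra.
Qed.

Lemma eps_le_power t : (0 < t1)%N -> (t1 <= t)%N -> eps t <= 11 / 20 * (t1.+1%:R / t.+1%:R) `^ kappa.
Proof.
move=> t1p; have /andP[k0 k1] := kappa01.
elim: t => [|t ih]; first by rewrite leqNgt t1p.
rewrite leq_eqVlt => /predU1P[<-|].
  by rewrite eps_early// divff ?lt0r_neq0// powR1 mulr1.
rewrite ltnS => t1t.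
have a0 : 0 < t1.+1%:R :> R by []; have b0 : 0 < t.+1%:R :> R by [].
rewrite epsS// -(powR_ratio kappa a0 b0) ?ltr0n// mulrA.
apply: ler_pM; rewrite ?ih ?shrink_le// ?(ltW (eps_gt0 t))//.
by have /andP[/ltW] := shrink01 t.
Qed.

(* In units of m A, barriers that follow the extremal drift recursions with a
   margin th. Up to t1 the upper one consists of a particular solution, linear
   in s, and a transient of order s ^ p, which is negligible at t1. *)
Definition upper (s : nat) : R :=
  if (s < t0)%N then 2049 * M * s%:R
  else if (s < t1)%N then 7 / 5 * M * s%:R + 2049 * M * t0%:R * (s%:R / t0%:R) `^ p
  else M * s%:R * (1 + 99 / 100 * eps s).

(** In units of m A the drift is at most constant plus slope times T: from the wide cap before [t0],
    from the lower band afterwards. [be] is the cost of the exceptional set. *)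
Definition upper_const (be : R) s : R := if (s < t0)%N then 2048 * M else M - 1 + be.
Definition upper_slope s : R := if (s < t0)%N then 0 else (1 + eps s) / (M * s%:R).

(** M > 3 gives p <= 2/3, so the transient divided by [M * t1] is at most 2049 (t0 / t1)^(1/3) <=
    2049 / 120^2 < 143/1000, and 7/5 + 143/1000 < 1 + 99/100 * 11/20. This is the origin of
    120^6. *)
Lemma upper_join : 7 / 5 * M * t1%:R + 2049 * M * t0%:R * (t1%:R / t0%:R) `^ p <=
  M * t1%:R * (1 + 99 / 100 * (11 / 20)).
Proof.
have t00 : 0 < t0%:R :> R by have := t0R; lra.
have t10 : 0 < t1%:R :> R by rewrite ltr0n (leq_ltn_trans _ t01).
set rt := t1%:R / t0%:R; have rt120 : 120 ^+ 6 <= rt by rewrite ler_pdivlMr.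
have rt1 : 1 <= rt by apply: le_trans rt120; rewrite exprn_ege1//; lra.
have rt0 : 0 < rt by apply: lt_le_trans rt1.
have p23 : p <= 2 / 3 by rewrite /p ler_pM2l// lef_pV2 ?posrE// ltW.
pose w := rt `^ 3^-1.
have w3 : w ^+ 3 = rt by rewrite -powR_mulrn ?powR_ge0// -powRrM mulVf// powRr1// ltW.
have w2 : rt `^ (2 / 3) = w ^+ 2 by rewrite -powR_mulrn ?powR_ge0// -powRrM mulrC.
have w0 : 0 < w by exact: powR_gt0.
pose c : R := 120 ^+ 2; have c0 : 0 < c by rewrite exprn_gt0.
have w120 : c <= w.
  by rewrite -(@ler_pXn2r _ 3) ?nnegrE ?(ltW w0) ?(ltW c0)// w3 /c -exprM.
have h : (t1%:R / t0%:R) `^ p <= w ^+ 2 by rewrite -w2; exact: ler_powR.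
have h2 : t0%:R * (t1%:R / t0%:R) `^ p <= t1%:R / c.
  apply: (@le_trans _ _ (t0%:R * w ^+ 2)); first by rewrite ler_pM2l.
  rewrite (ler_pdivlMr _ _ c0); apply: (@le_trans _ _ (t0%:R * w ^+ 2 * w)).
    by rewrite ler_wpM2l// mulr_ge0 ?sqr_ge0// ltW.
  by rewrite -mulrA -exprSr w3 /rt mulrC divfK// lt0r_neq0.
have h3 : M * (t0%:R * (t1%:R / t0%:R) `^ p) <= M * (t1%:R / c) by rewrite ler_pM2l.
have h4 : 0 < M * t1%:R by exact: mulr_gt0.
have h5 : 2049 * (M * t1%:R / c) <= 143 / 1000 * (M * t1%:R).
  by rewrite mulrA ler_pdivrMr// /c expr2; lra.
move: h3 h4 h5; rewrite -/rt !mulrA; move: (rt `^ p) (c^-1) => Y Z; lra.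
Qed.

(** In turn: 2049 leaves room over 2048 for the factor [1 + th]; M - 1 + (1 + 11/20) * 7/5 < 7/5 * M
    as M > 3; and 99/100 * 21/8 exceeds 199/100 + 99/100 * 11/20, which bounds the coefficient of
    [eps s] in the drift. *)
Lemma upper_step s th be : 0 <= th -> 1000 * (M * th) <= eps s -> 0 <= be <= th ->
  upper s + (1 + th) * (upper_const be s + upper_slope s * upper s) <= upper s.+1.
Proof.
move=> th0 Mth /andP[be0 beth]; have e0 := eps_gt0 s; have e1 := eps_le s.
have M3 := M_gt3.
have th1 : th <= 1 / 5000 by nra.
have beth2 : th * be <= th * th by rewrite ler_wpM2l.
have thth : th * th <= th * (1 / 5000) by rewrite ler_wpM2l.
have t00 : 0 < t0%:R :> R by have := t0R; lra.
rewrite /upper_const /upper_slope; have [st0|t0s] := ltnP s t0.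
  rewrite mul0r addr0 [upper s]/upper st0.
  apply: (@le_trans _ _ (2049 * M * s.+1%:R)); first by rewrite -natr1; lra.
  rewrite /upper; have [//|] := ltnP s.+1 t0.
  move=> /(conj st0)/andP; rewrite -eqn_leq => /eqP ->.
  rewrite t01 divff ?powR1 ?mulr1 ?gt_eqF//.
  by rewrite lerDr !mulr_ge0 ?ltW//; lra.
have s0 : 0 < s%:R :> R by rewrite (lt_le_trans t00)// ler_nat.
have s1 : 0 < s.+1%:R :> R by rewrite ltr0n.
have [st1|t1s] := ltnP s t1.
  apply: (@le_trans _ _ (7 / 5 * M * s.+1%:R + 2049 * M * t0%:R * (s.+1%:R / t0%:R) `^ p)); last first.
    rewrite /upper [(s.+1 < t0)%N]ltnNge (leqW t0s) /=.
    have [//|] := ltnP s.+1 t1.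
    move=> /(conj st1)/andP; rewrite -eqn_leq => /eqP ->; rewrite leqnn; exact: upper_join.
  rewrite eps_early ?(ltnW st1)// -(powR_ratio p s1 s0 t00) /upper ltnNge t0s st1 /=.
  set K := 2049 * M * t0%:R * (s%:R / t0%:R) `^ p.
  have c0 : 0 <= 2049 :> R by exact: ler0n.
  have K0 : 0 <= K := mulr_ge0 (mulr_ge0 (mulr_ge0 c0 (ltW M0)) (ltW t00)) (powR_ge0 _ _).
  have /(ler_wpM2l K0) := growth_le p0 (leq_trans t0_ge4 t0s).
  rewrite (_ : 1551 / 2000 * p = 1551 / 1000 / M); last by rewrite /p; field; rewrite gt_eqF.
  have K1 : 0 <= K / (M * s%:R) by rewrite divr_ge0// mulr_ge0// ltW.
  have thK : th * (K / (M * s%:R)) <= 1 / 5000 * (K / (M * s%:R)) by rewrite ler_wpM2r.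
  rewrite [X in X <= _ -> _](_ : _ = K + 1551 / 1000 * (K / (M * s%:R))); last by field; rewrite !gt_eqF.
  rewrite [X in (1 + th) * (_ + X)](_ : _ = (1 + 11 / 20) * (7 / 5 + K / (M * s%:R))); last by field; rewrite !gt_eqF.
  rewrite [X in _ <= _ + X](_ : _ = K * (s.+1%:R / s%:R) `^ p); last by rewrite /K; ring.
  rewrite -[in 7 / 5 * M * s.+1%:R]natr1; move: (K * _ `^ p) (K / _) thK K1 => K2 k thK K1; lra.
rewrite /upper ltnNge t0s ltnNge t1s /= ltnNge leqW//= ltnNge leqW//= ltnNge t1s /=.
rewrite [leRHS](_ : _ = M * s%:R + M + 99 / 100 * (eps s * (M * s%:R) + eps s * (M * (1 - kappa)))); last first.
  by rewrite -natr1; field; rewrite natr1 gt_eqF.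
rewrite [X in (1 + th) * (_ + X)](_ : _ = (1 + eps s) * (1 + 99 / 100 * eps s)); last by field; rewrite !gt_eqF.
have Mk : eps s * (21 / 8) <= eps s * (M * (1 - kappa)) by rewrite ler_pM2l.
have ee : eps s * eps s <= eps s * (11 / 20) by rewrite ler_pM2l.
have te : th * eps s <= th * (11 / 20) by rewrite ler_wpM2l.
have tee : th * (eps s * eps s) <= th * (eps s * (11 / 20)) by rewrite ler_wpM2l.
have tM : th * 3 <= th * M by rewrite ler_wpM2l// ltW.
move: Mk ee te tee tM Mth beth2 thth; move: (eps s) (M * (1 - kappa)) e0 e1 => e Mk e0 e1; lra.
Qed.

(** 1 - 63/100 * 11/20 < 2/3 < (M - 1) / M, so up to [t1] newcomers alone keep pace with it. Since 1
    / (1 + e) <= 1 - 635/1000 * e for e <= 11/20, it stays above the edge of the band. *)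
Definition lower (s : nat) : R := M * s%:R * (1 - 63 / 100 * eps s).
(** The slope is 0 before [t1], where the band has no upper edge. *)
Definition lower_slope (be : R) s : R := if (s < t1)%N then 0 else (1 - be) / (M * (1 + eps s) * s%:R).

(** After [t1], (1 - 63/100 e) / (1 + e) >= 1 - 163/100 e, and 63/100 * 21/8 exceeds 163/100. *)
Lemma lower_step s th be : 0 <= th -> 1000 * (M * th) <= eps s -> 0 <= be <= th ->
  lower s.+1 <= lower s + (1 - th) * (M - 1 + lower_slope be s * lower s).
Proof.
move=> th0 Mth /andP[be0 beth]; have e0 := eps_gt0 s; have e1 := eps_le s.
have M3 := M_gt3.
have th1 : th <= 1 / 5000 by nra.
rewrite /lower_slope; have [st1|t1s] := ltnP s t1.
  rewrite mul0r addr0 /lower !eps_early// 1?ltnW// -natr1; lra.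
have s1 : 0 < s.+1%:R :> R by rewrite ltr0n.
have s0 : 0 < s%:R :> R by rewrite ltr0n (leq_ltn_trans _ (leq_trans t01 t1s)).
have e10 : 0 < 1 + eps s by rewrite addr_gt0.
rewrite /lower epsS//.
rewrite [leLHS](_ : _ = M * s%:R + M - 63 / 100 * (eps s * (M * s%:R) + eps s * (M * (1 - kappa)))); last first.
  by rewrite -natr1; field; rewrite natr1 gt_eqF.
rewrite [X in (1 - th) * (_ + X)](_ : _ = (1 - be) * ((1 - 63 / 100 * eps s) / (1 + eps s))); last first.
  by field; rewrite !gt_eqF.
have q1 : 1 - 163 / 100 * eps s <= (1 - 63 / 100 * eps s) / (1 + eps s).
  rewrite ler_pdivlMr//; have := mulr_ge0 (ltW e0) (ltW e0); lra.
have q2 : (1 - 63 / 100 * eps s) / (1 + eps s) <= 1 by rewrite ler_pdivrMr//; lra.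
move: (_ / (1 + eps s)) q1 q2 => q q1 q2.
have q0 : 0 <= q by lra.
have bq : be * q <= be * 1 by rewrite ler_wpM2l.
have tq : th * q <= th * 1 by rewrite ler_wpM2l.
have tbq : 0 <= th * (be * q) by rewrite !mulr_ge0.
have Mk : eps s * (21 / 8) <= eps s * (M * (1 - kappa)) by rewrite ler_pM2l.
have tM : th * 3 <= th * M by rewrite ler_wpM2l// ltW.
move: Mk bq tq tbq tM Mth; move: (eps s) (M * (1 - kappa)) e0 e1 q1 => e Mk e0 e1 q1; lra.
Qed.

(** The distance from the barrier to the edge of the band is the deviation to which the Chernoff
    bound is applied. *)
Lemma upper_gap t : (t1 <= t)%N ->
  1 / 200 * (M * (eps t * t%:R)) <= M * (1 + eps t) * t%:R - upper t.
Proof.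
move=> t1t; have e0 := eps_gt0 t; rewrite /upper ltnNge (leq_trans (ltnW t01) t1t) ltnNge t1t /=.
have : 0 <= M * (eps t * t%:R) by rewrite mulr_ge0 ?(ltW M0)// mulr_ge0 ?(ltW e0).
lra.
Qed.

Lemma lower_gap t :
  1 / 200 * (M * (eps t * t%:R)) <= lower t - M / (1 + eps t) * t%:R.
Proof.
have e0 := eps_gt0 t; have e1 := eps_le t; rewrite /lower.
have q : M / (1 + eps t) <= M * (1 - 635 / 1000 * eps t).
  rewrite ler_pM2l// -[leLHS]mul1r ler_pdivrMr ?addr_gt0//.
  have := ler_wpM2l (ltW e0) e1; lra.
have := ler_wpM2r (ler0n R t) q; lra.
Qed.

(** Limits the growth of the exponents [lam] when they are traced back from time t. *)
Lemma growth_prod (c : nat -> R) s t :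
  (forall j, (j < t0)%N -> c j = 0) ->
  (forall j, (t0 <= j)%N -> 0 <= c j <= 1551 / 1000 / (M * j%:R)) ->
  1 <= \prod_(s <= j < t) (1 + c j) <= ((maxn t0 t)%:R / t0%:R) `^ p.
Proof.
move=> c0 c1; have t00 : 0 < t0%:R :> R by have := t0R; lra.
have cge j : 0 <= c j.
  by have [jt|tj] := ltnP j t0; [rewrite c0|have /andP[] := c1 _ tj].
apply/andP; split.
  elim: t => [|t ih]; first by rewrite big_geq.
  have [st|ts] := leqP s t; last by rewrite big_geq.
  by rewrite big_nat_recr//= -[leLHS]mulr1 ler_pM// lerDl.
have mono a b : (a <= b)%N -> ((maxn t0 a)%:R / t0%:R) `^ p <= ((maxn t0 b)%:R / t0%:R) `^ p.
  move=> ab; apply: ge0_ler_powR; rewrite ?(ltW p0) ?nnegrE ?divr_ge0//.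
  by rewrite ler_pM2r ?invr_gt0// ler_nat geq_max !leq_max leqnn ab orbT.
elim: t => [|t ih]; first by rewrite big_geq// maxn0 divff ?powR1// gt_eqF.
have [st|ts] := leqP s t; last first.
  rewrite big_geq//; apply: le_trans (mono 0%N _ _) => //.
  by rewrite maxn0 divff ?powR1// gt_eqF.
rewrite big_nat_recr//=; have [tt0|t0t] := ltnP t t0.
  by rewrite c0// addr0 mulr1; apply: le_trans ih (mono _ _ _).
have t00' : 0 < t%:R :> R by rewrite (lt_le_trans t00)// ler_nat.
rewrite (maxn_idPr _) 1?ltnW// -(powR_ratio p _ t00' t00)// mulrC.
apply: ler_pM.
- by rewrite addr_ge0.
- by apply: prodr_ge0 => j _; rewrite addr_ge0.
- apply: le_trans (growth_le p0 (leq_trans t0_ge4 t0t)); rewrite lerD2l.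
  have /andP[_] := c1 _ t0t; congr (_ <= _); rewrite /p; field; by rewrite !gt_eqF.
- by move: ih; rewrite (maxn_idPr _).
Qed.

(* The Chernoff exponent at time t is a multiple of this quantity: it does not
   drop below its value at t0 because 2 kappa + p <= 1. *)
Lemma exponent_ge t : (t0 <= t)%N ->
  121 / 400 * t0%:R <= eps t ^+ 2 * (t%:R * (t0%:R / t%:R) `^ p).
Proof.
move=> t0t; have t00 : 0 < t0%:R :> R by have := t0R; lra.
have t00' : 0 < t%:R :> R by rewrite (lt_le_trans t00)// ler_nat.
have /andP[k0 k1] := kappa01.
have p1 : 0 <= 1 - p by have := kappa_M; rewrite -/p; lra.
have tp : t%:R * (t0%:R / t%:R) `^ p = t0%:R * (t%:R / t0%:R) `^ (1 - p).
  rewrite powRD; last by apply/implyP => _; rewrite gt_eqF ?divr_gt0.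
  rewrite powRr1 ?divr_ge0// mulrA mulrCA mulfV ?gt_eqF// mulr1.
  by rewrite -[t0%:R / t%:R]invf_div -[(_ / _)^-1 in LHS]powR_inv1 ?divr_ge0// -powRrM mulN1r.
rewrite tp mulrCA mulrC ler_pM2l//.
have [tt1|t1t] := leqP t t1.
  rewrite eps_early//; apply: (@le_trans _ _ ((11 / 20) ^+ 2 * 1)); first by rewrite expr2; lra.
  rewrite ler_pM2l ?exprn_gt0// -[leLHS](powRr0 (t%:R / t0%:R)); apply: ler_powR => //.
  by rewrite ler_pdivlMr// mul1r ler_nat.
have t10 : 0 < t1%:R :> R by rewrite ltr0n (leq_ltn_trans _ t01).
have r1 : t1%:R / t%:R <= 1 :> R by rewrite ler_pdivrMr// mul1r ler_nat ltnW.
have e2 : (11 / 20) ^+ 2 * (t1%:R / t%:R) `^ (1 - p) <= eps t ^+ 2.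
  apply: (@le_trans _ _ ((11 / 20 * (t1%:R / t%:R) `^ kappa) ^+ 2)).
    rewrite [leRHS]exprMn ler_pM2l ?exprn_gt0// -[leRHS]powR_mulrn ?powR_ge0// -powRrM.
    apply: ger_powR; rewrite ?r1 ?divr_gt0//.
    by have := kappa_M; rewrite -/p; lra.
  have h := eps_ge_power (leq_ltn_trans (leq0n t0) t01) (ltnW t1t).
  have h0 : 0 <= 11 / 20 * (t1%:R / t%:R) `^ kappa by rewrite mulr_ge0 ?powR_ge0.
  by rewrite lerXn2r ?nnegrE// (le_trans h0 h).
apply: (@le_trans _ _ ((11 / 20) ^+ 2 * (t1%:R / t%:R) `^ (1 - p) * (t%:R / t0%:R) `^ (1 - p))).
  rewrite -mulrA powR_ratio//; apply: (@le_trans _ _ ((11 / 20) ^+ 2 * 1)); first by rewrite expr2; lra.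
  rewrite ler_pM2l ?exprn_gt0// -[leLHS](powRr0 (t1%:R / t0%:R)); apply: ler_powR => //.
  by rewrite ler_pdivlMr// mul1r ler_nat ltnW.
by rewrite ler_wpM2r ?powR_ge0.
Qed.
End Barriers.

(** * Concentration for a fixed number of vertices *)

Section FixedSize.
Variables (R : realType) (n m : nat) (r xi kappa b l : R) (t0 t1 : nat).
Let M := 2 + xi.
Let delta := xi * m%:R.
Let A := cap_area r.
Hypotheses (m_gt0 : (0 < m)%N) (xi_gt1 : 1 < xi) (r_pi : 0 < r <= pi).
Hypotheses (kappa01 : 0 < kappa < 1).
Hypotheses (M_kappa : 21 / 8 <= M * (1 - kappa)) (kappa_M : 2 * kappa + 2 / M <= 1).
Hypotheses (t0_ge4 : (4 <= t0)%N) (t0_t1 : 120 ^+ 6 * t0%:R <= t1%:R :> R).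
Hypotheses (b_gt0 : 0 < b) (A_gt0 : 0 < A) (b_le : 2000 * (M * b) <= A * eps kappa t1 n).
Hypothesis l_le : 2 * 10 ^+ 6 * (M * l) <= A * t0%:R.
Context d (Omega : measurableType d) (P : probability Omega R).
Variables (x : nat -> {RV P >-> vec3 R}) (y : nat -> 'I_m -> {RV P >-> nat}).
Hypothesis model : base_model r delta x y n.

Let e := eps kappa t1.
Let Lo s := m%:R * A * (M / (1 + e s) * s%:R).
Let Up s := m%:R * A * (M * (1 + e s) * s%:R).
Let T t w u := total_weight r delta (positions x w) (contacts y w) t u.
Notation bad := (bad r delta x y t0 t1 Lo Up).
Notation good := (good r delta x y t0 t1 Lo Up b).
Let nu : probability (vec3 R) R := distribution P (x 0).

Let xi0 : 0 < xi. Proof. by have := xi_gt1; lra. Qed.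
Let mR : 0 < m%:R :> R. Proof. by rewrite ltr0n. Qed.
Let delta0 : 0 < delta. Proof. exact: mulr_gt0. Qed.
Let M3 : 3 < M. Proof. by have := xi_gt1; rewrite /M; lra. Qed.
Let M0 : 0 < M. Proof. by have := M3; lra. Qed.
Let r0 : 0 <= r. Proof. by have /andP[/ltW] := r_pi. Qed.
Let madj := @measurable_adjacency R r r0.
Let msph := @measurable_sphere R.
Let csym u v : sphere u -> sphere v -> cap u r v -> cap v r u := @cap_sym R u v r.
Let e0 s : 0 < e s. Proof. exact: eps_gt0. Qed.
Let t00 : 0 < t0%:R :> R. Proof. by rewrite ltr0n (leq_trans _ t0_ge4). Qed.
Let mA : 0 < m%:R * A. Proof. exact: mulr_gt0. Qed.

Let nu_cap u : (0 < n)%N -> sphere u -> nu (cap u r) = A%:E.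
Proof.
move=> n0 su; rewrite /nu (distribution_area model n0); first exact: area_capE.
by rewrite cap_dot_cap//; [exact: measurable_dot_cap|rewrite r0; have /andP[] := r_pi].
Qed.

Let nu_wide u : (0 < n)%N -> sphere u -> (nu (wide_cap r u) <= (2048 * A)%:E)%E.
Proof.
move=> n0 su; rewrite /nu (distribution_area model n0); first exact: area_wide_cap.
exact: measurable_wide.
Qed.

Let bounded_drift s w u : (s < n)%N -> sphere u ->
  bounded_measurable (drift_density r delta (positions x w) (contacts y w) s u).
Proof. by move=> sn su; exact: (bounded_drift_density delta0 model madj csym sn w su). Qed.

Let x_sphere s w : (s < n)%N -> forall v, (v < s)%N -> sphere (positions x w v).
Proof. by move=> sn v vs; exact: (on_sphere model w (ltn_trans vs sn)). Qed.

Let M1000 : 0 < 1000 * M. Proof. by apply: mulr_gt0; rewrite ?ltr0n. Qed.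
Let thp t : 0 < e t / (1000 * M). Proof. exact: divr_gt0. Qed.

Let eth s t : (s <= t)%N -> 1000 * (M * (e t / (1000 * M))) <= e s.
Proof.
move=> st; rewrite (_ : 1000 * _ = e t); last by field; rewrite gt_eqF.
exact: eps_antitone.
Qed.

Let beth t : (t <= n)%N -> 2 * b / A <= e t / (1000 * M).
Proof.
move=> tn; rewrite ler_pdivrMr// mulrAC (ler_pdivlMr _ _ M1000).
have := b_le; have : A * e n <= A * e t by rewrite ler_pM2l//; exact: eps_antitone.
rewrite -/e; lra.
Qed.

Let p := 2 / M.
(** Traced back in time the exponent grows by a factor at most [(t / t0) ^ p]; this final value
    keeps [2 * lam * (m * M)] within the margin [e t / (1000 * M)] throughout. *)
Let lam0 t : R := e t / (1000 * M) / (2 * M * m%:R) * (t0%:R / t%:R) `^ p.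

Let lam_bounds (c : nat -> R) s t : (t0 <= t)%N ->
  (forall j, (j < t0)%N -> c j = 0) ->
  (forall j, (t0 <= j)%N -> 0 <= c j <= 1551 / 1000 / (M * j%:R)) ->
  0 < lam0 t * \prod_(s <= j < t) (1 + c j) /\
  lam0 t * \prod_(s <= j < t) (1 + c j) * (m%:R * M) <= e t / (1000 * M) / 2.
Proof.
move=> t0t c0 c1; have /andP[p1 p2] := @growth_prod R M t0 M3 t0_ge4 c s t c0 c1.
have t00' : 0 < t%:R :> R by rewrite (lt_le_trans t00)// ler_nat.
have f0 : 0 < e t / (1000 * M) / (2 * M * m%:R) by rewrite divr_gt0 ?thp// !mulr_gt0.
have lam00 : 0 < lam0 t by rewrite mulr_gt0// powR_gt0// divr_gt0.
split; first by rewrite mulr_gt0// (lt_le_trans _ p1).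
rewrite (maxn_idPr t0t) in p2.
apply: (@le_trans _ _ (lam0 t * (t%:R / t0%:R) `^ p * (m%:R * M))).
  by rewrite ler_pM2r ?mulr_gt0// ler_pM2l.
have := powR_ratio p t00 t00' t00; rewrite divff ?gt_eqF// powR1 => pr.
rewrite [leLHS](_ : _ = e t / (1000 * M) / 2 * ((t0%:R / t%:R) `^ p * (t%:R / t0%:R) `^ p)); last first.
  by rewrite /lam0; field; rewrite !gt_eqF.
by rewrite pr mulr1.
Qed.

(** The constants combine to 1000 * 2 * 200 = 4 * 10^5, less than 2 * 10^6 * 121/400. *)
Let level t : (t0 <= t)%N -> l <= lam0 t * (m%:R * A * (1 / 200 * (M * (e t * t%:R)))).
Proof.
move=> t0t; have h := exponent_ge kappa01 kappa_M t0_ge4 t0_t1 t0t.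
have t00' : 0 < t%:R :> R by rewrite (lt_le_trans t00)// ler_nat.
rewrite [leRHS](_ : _ = A * (e t ^+ 2 * (t%:R * (t0%:R / t%:R) `^ p)) / (4 * 10 ^+ 5 * M)); last first.
  by rewrite /lam0; field; rewrite !gt_eqF.
have c0 : 0 < 4 * 10 ^+ 5 * M by rewrite mulr_gt0// mulr_gt0// exprn_gt0.
rewrite (ler_pdivlMr _ _ c0).
have := ler_wpM2l (ltW A_gt0) h; rewrite -/e -/p; have := mulr_gt0 A_gt0 t00; have := l_le.
rewrite [A * (121 / 400 * _)]mulrCA [l * _]mulrC -[_ * M * l]mulrA.
move: (A * (e t ^+ 2 * _)) (A * t0%:R) (M * l) => X Y Z.
rewrite !exprS expr0; lra.
Qed.

Let e1 s : e s <= 11 / 20. Proof. exact: (eps_le t1 kappa01 s). Qed.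

Let th_le t : e t / (1000 * M) <= 1 / 5000.
Proof.
have := eth (leqnn t); have := e1 t; have := thp t; move: (e t) (e t / (1000 * M)) => et th th0.
have : 3 * th <= M * th by rewrite ler_wpM2r ?(ltW th0) ?(ltW M3).
lra.
Qed.

Let t01 : (t0 < t1)%N.
Proof.
rewrite -(ltr_nat R); apply: lt_le_trans t0_t1.
by rewrite ltr_pMl// exprn_egt1// ltr1n.
Qed.

Let mxi : delta + m%:R = m%:R * (M - 1). Proof. by rewrite /delta /M; ring. Qed.
Let mM : 2 * m%:R + delta = m%:R * M. Proof. by rewrite /delta /M; ring. Qed.

Lemma upper_prob t u (S : set Omega) : (t <= n)%N -> sphere u -> (t1 <= t)%N -> measurable S ->
  (forall w, S w -> Up t < T t w u) -> (P (good t `&` S) <= (expR (- l))%:E)%E.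
Proof.
move=> tn su t1t mS SU.
have t0t := leq_trans (ltnW t01) t1t.
set th := e t / (1000 * M).
have th0 : 0 < th by exact: thp.
(* The exceptional set adds at most [2 * m * b] to the drift, measured here in units of [m * A]. *)
pose be := 2 * b / A.
have be0 : 0 <= be by rewrite divr_ge0 ?mulr_ge0// ltW.
have beth' : be <= th by exact: beth.
pose g s := upper_slope M kappa t0 t1 s.
pose c s := (1 + th) * g s.
have M3' := M3.
have th1 : th <= 1 / 5000.
  exact: th_le.
have c0 j : (j < t0)%N -> c j = 0 by move=> jt; rewrite /c /g /upper_slope jt mulr0.
have c1 j : (t0 <= j)%N -> 0 <= c j <= 1551 / 1000 / (M * j%:R).
  move=> tj; rewrite /c /g /upper_slope ltnNge tj /=.
  have j0 : 0 < M * j%:R by rewrite mulr_gt0// (lt_le_trans t00)// ler_nat.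
  have ej := e1 j; have ej0 := e0 j; rewrite -/e in ej *.
  rewrite mulrA; apply/andP; split; first by apply: divr_ge0; [apply: mulr_ge0; lra|exact: ltW].
  rewrite ler_pM2r ?invr_gt0//.
  have : th * e j <= th * (11 / 20) by rewrite ler_pM2l.
  lra.
(* Solves the backward recursion [lam_rec] with final value [lam0 t]. *)
pose lam s := lam0 t * \prod_(s <= j < t) (1 + c j).
have lamB s := lam_bounds s t0t c0 c1.
have lamt : lam t = lam0 t by rewrite /lam big_geq// mulr1.
have n0 s : (s < t)%N -> (0 < n)%N by move=> st; apply: leq_trans tn; apply: leq_ltn_trans st.
apply: (@chernoff _ n m r delta delta0 _ _ _ x y model madj msph csym t0 t1 Lo Up b u t lam
  (fun s => m%:R * A * upper M kappa t0 t1 s) (fun s => m%:R * A * upper_const M t0 be s) g th su tn) => //.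
- by lra.
- by move=> s _; have [_ h] := lamB s.+1; rewrite mM; move: h; rewrite -/(lam s.+1) -/th; lra.
- move=> s _; have [h1 h2] := lamB s.+1; rewrite mM mulr_ge0_le0 ?(ltW h1)//.
  by move: h2; rewrite -/(lam s.+1) -/th; lra.
- move=> s st; rewrite /lam big_ltn// -/(c s); ring.
- move=> s w st bs; have [h1 _] := lamB s.+1; rewrite ler_pM2l//.
  have sn := leq_trans st tn; have nn := n0 s st.
  rewrite /g /upper_const /upper_slope; have [st0|t0s] := ltnP s t0.
    rewrite mul0r addr0.
    have := @drift_le_wide R m r delta delta0 nu (2048 * A) (wide_cap r) csym
      (fun u _ => @measurable_wide R r u) (fun u su => nu_wide nn su) (cap_wide r_pi) (@cap_cap_wide R r r_pi)
      _ _ _ (x_sphere w sn) u su (bounded_drift w sn su).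
    by rewrite mM => /le_trans; apply; rewrite le_eqVlt; apply/orP; left; apply/eqP; ring.
  have s0 : 0 < s%:R :> R by rewrite (lt_le_trans t00)// ler_nat.
  have Lo0 : 0 < Lo s by rewrite /Lo !mulr_gt0// ?invr_gt0 addr_gt0.
  have := @drift_le R m r delta delta0 madj nu A (wide_cap r) (fun u => nu_cap nn (u:=u)) csym
    (@cap_cap_wide R r r_pi) _ _ _ (x_sphere w sn) u su (bounded_drift w sn su)
    (bad s w) (Lo s) (measurable_bad delta x y madj msph t0 t1 Lo Up s w) Lo0.
  move=> /(_ _)/le_trans; apply.
    by move=> z sz nb; rewrite leNgt; apply/negP => lz; apply: nb; split => //; left.
  rewrite mxi; move: bs; rewrite /bad_area -/nu; move: (fine _) => f fb.
  have -> : m%:R / Lo s * (A * T s w u) = (1 + e s) / (M * s%:R) * T s w u.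
    by rewrite /Lo; field; rewrite !gt_eqF ?addr_gt0.
  rewrite lerD2r (_ : m%:R * A * (M - 1 + be) = m%:R * (M - 1) * A + 2 * m%:R * b); last first.
    by rewrite /be; field; rewrite gt_eqF.
  by rewrite lerD2l ler_pM2l// mulr_gt0.
- move=> s st; have [h1 _] := lamB s.+1; rewrite mulr_ge0_le0 ?(ltW h1)//.
  have es : 1000 * (M * th) <= eps kappa t1 s by exact: eth (ltnW st).
  have := @upper_step R M kappa t0 t1 M3 kappa01 M_kappa t0_ge4 t0_t1 s th be (ltW th0) es.
  rewrite be0 beth' => /(_ isT)/(ler_wpM2l (ltW mA)); rewrite -/(g s).
  rewrite subr_le0; apply: le_trans; rewrite le_eqVlt; apply/orP; left; apply/eqP; ring.
- have u0 : upper M kappa t0 t1 0 = 0 by rewrite /upper (leq_trans _ t0_ge4) ?mulr0.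
  by rewrite u0 !mulr0.
move=> w /SU h; rewrite lamt; apply: (le_trans (level t0t)).
rewrite ler_pM2l; last by have [] := lamB t; rewrite -/(lam t) lamt.
apply: (@le_trans _ _ (m%:R * A * (M * (1 + e t) * t%:R - upper M kappa t0 t1 t))).
  by rewrite ler_pM2l//; apply: upper_gap.
by rewrite mulrBr lerD2r ltW.
Qed.

Lemma lower_prob t u (S : set Omega) : (t <= n)%N -> sphere u -> (t0 <= t)%N -> measurable S ->
  (forall w, S w -> T t w u < Lo t) -> (P (good t `&` S) <= (expR (- l))%:E)%E.
Proof.
move=> tn su t0t mS SL.
set th := e t / (1000 * M).
have th0 : 0 < th by exact: thp.
(* Here the exceptional set lowers the factor [A] to at least [A - b], a relative loss of
   [b / A]. *)
pose be := b / A.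
have be0 : 0 <= be by rewrite divr_ge0// ltW.
have beth' : be <= th.
  by have := beth tn; rewrite -mulrA -/be -/th; lra.
have M3' := M3.
have th1 : th <= 1 / 5000.
  exact: th_le.
pose g s := lower_slope M kappa t1 be s.
pose c s := (1 - th) * g s.
have c0 j : (j < t0)%N -> c j = 0.
  by move=> jt; rewrite /c /g /lower_slope (ltn_trans jt t01) mulr0.
have c1 j : (t0 <= j)%N -> 0 <= c j <= 1551 / 1000 / (M * j%:R).
  move=> tj; have j0 : 0 < j%:R :> R by rewrite (lt_le_trans t00)// ler_nat.
  have Mj0 : 0 < M * j%:R by rewrite mulr_gt0.
  rewrite /c /g /lower_slope; case: ifP => _.
    rewrite mulr0 lexx /=; apply: divr_ge0 (ltW Mj0).
    by apply: divr_ge0; exact: ler0n.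
  have ej0 := e0 j; rewrite -/e in ej0 *.
  have ee : 0 < M * (1 + e j) * j%:R by rewrite !mulr_gt0// addr_gt0.
  rewrite mulrA; apply/andP; split; first by apply: divr_ge0; [apply: mulr_ge0; lra|exact: ltW].
  rewrite ler_pdivrMr//.
  have -> : 1551 / 1000 / (M * j%:R) * (M * (1 + e j) * j%:R) = 1551 / 1000 * (1 + e j).
    by field; rewrite !gt_eqF.
  have be1 : be <= 1 by lra.
  have : th * be <= th * 1 by rewrite ler_pM2l.
  lra.
(* Negative exponents, with margin [- th], give the lower tail. *)
pose lam s := - (lam0 t * \prod_(s <= j < t) (1 + c j)).
have lamB s := lam_bounds s t0t c0 c1.
have lamt : lam t = - lam0 t by rewrite /lam big_geq// mulr1.
have n0 s : (s < t)%N -> (0 < n)%N by move=> st; apply: leq_trans tn; apply: leq_ltn_trans st.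
apply: (@chernoff _ n m r delta delta0 _ _ _ x y model madj msph csym t0 t1 Lo Up b u t lam
  (fun s => m%:R * A * lower M kappa t1 s) (fun s => m%:R * A * (M - 1)) g (- th) su tn) => //.
- by lra.
- move=> s _; have [h1 _] := lamB s.+1; rewrite mM mulNr.
  have : 0 <= lam0 t * \prod_(s.+1 <= j < t) (1 + c j) * (m%:R * M) by rewrite mulr_ge0 ?(ltW h1)// mulr_ge0// ltW.
  move: (_ * \prod_(_ <= _ < _) _ * _) => z; lra.
- move=> s _; have [h1 h2] := lamB s.+1; rewrite mM mulr_le0_ge0 ?oppr_le0 ?(ltW h1)//.
  by move: h2; rewrite -/th /lam; move: (_ * \prod_(_ <= _ < _) _) => z; lra.
- by move=> s st; rewrite /lam big_ltn// -/(c s); ring.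
- move=> s w st bs; have [h1 _] := lamB s.+1; rewrite ler_nM2l ?oppr_lt0//.
  have sn := leq_trans st tn; have nn := n0 s st.
  rewrite /g /lower_slope; have [st1|t1s] := ltnP s t1.
    rewrite mul0r addr0.
    have := @drift_ge_cap R m r delta delta0 madj nu A (fun u => nu_cap nn (u:=u))
      _ _ _ u su (bounded_drift w sn su).
    by rewrite mxi; apply: le_trans; rewrite le_eqVlt; apply/orP; left; apply/eqP; ring.
  have s0 : 0 < s%:R :> R by rewrite (lt_le_trans t00)// ler_nat ltnW// (leq_trans t01).
  have Up0 : 0 < Up s by rewrite /Up !mulr_gt0// addr_gt0.
  have := @drift_ge R m r delta delta0 madj nu A (fun u => nu_cap nn (u:=u)) csym
    _ _ _ (x_sphere w sn) u su (bounded_drift w sn su)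
    (bad s w) (Up s) (measurable_bad delta x y madj msph t0 t1 Lo Up s w) Up0.
  have Tle z : sphere z -> ~ bad s w z -> T s w z <= Up s.
    by move=> sz nb; rewrite leNgt; apply/negP => lz; apply: nb; split => //; right.
  move=> /(_ Tle); apply: le_trans.
  rewrite mxi; move: bs; rewrite /bad_area -/nu; move: (fine _) => f fb.
  have -> : m%:R * A * (M - 1) = m%:R * (M - 1) * A by ring.
  rewrite lerD2l.
  have -> : (1 - be) / (M * (1 + e s) * s%:R) * T s w u = m%:R / Up s * ((A - b) * T s w u).
    by rewrite /Up /be; field; rewrite !gt_eqF ?addr_gt0.
  rewrite ler_pM2l ?divr_gt0// ler_wpM2r ?lerD2l ?lerN2//.
  by apply: total_weight_ge0; exact: ltW.
- move=> s st; have [h1 _] := lamB s.+1; rewrite mulr_le0_ge0 ?oppr_le0 ?(ltW h1)//.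
  have es : 1000 * (M * th) <= eps kappa t1 s by exact: eth (ltnW st).
  have := @lower_step R M kappa t0 t1 M3 kappa01 M_kappa t0_ge4 t0_t1 s th be (ltW th0) es.
  rewrite be0 beth' => /(_ isT)/(ler_wpM2l (ltW mA)); rewrite -/(g s).
  rewrite subr_ge0 => /le_trans; apply; rewrite le_eqVlt; apply/orP; left; apply/eqP; ring.
- by rewrite /lower mulr0 mul0r mulr0 mulr0.
move=> w /SL h; rewrite lamt; apply: (le_trans (level t0t)).
rewrite mulNr -mulrN ler_pM2l; last by have [] := lamB t; rewrite big_geq// mulr1.
apply: (@le_trans _ _ (m%:R * A * (lower M kappa t1 t - M / (1 + e t) * t%:R))).
  by rewrite ler_pM2l//; apply: lower_gap.
by rewrite mulrBr opprB lerD2l lerN2 ltW.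
Qed.

(** The two tails give 2 exp(- l) at one time within [good]; leaving [good] during t steps costs
    [t / b] times as much. *)
Lemma total_weight_concentration t u : (t <= n)%N -> sphere u ->
  (P [set w | bad t w u] <= (2 * expR (- l) + t%:R * (2 * expR (- l) / b))%:E)%E.
Proof.
apply: (@bad_total_prob _ n m r delta delta0 _ _ _ x y model madj msph csym t0 t1 Lo Up b b_gt0).
  by rewrite mulr_ge0// expR_ge0.
move=> s z sn sz.
have mT : measurable_fun setT (fun w => T s w z).
  by have := @past_total_weight R m r delta _ _ P x y madj s z => /past_measurable.
pose SL := [set w | (t0 <= s)%N /\ T s w z < Lo s].
pose SU := [set w | (t1 <= s)%N /\ Up s < T s w z].
have mb (P0 : bool) (S : set Omega) : measurable S -> measurable [set q | P0 /\ S q].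
  move=> mS'; case: P0; first by rewrite (_ : [set q | _] = S)//; apply/seteqP; split => q // [].
  by rewrite (_ : [set q | _] = set0)//; apply/seteqP; split => q // [].
have mSL : measurable SL.
  apply: mb; rewrite -[X in measurable X]setTI.
  by apply: (measurable_fun_ltr mT (measurable_cst (Lo s))) => //; exact: (measurable_set1 true).
have mSU : measurable SU.
  apply: mb; rewrite -[X in measurable X]setTI.
  by apply: (measurable_fun_ltr (measurable_cst (Up s)) mT) => //.
have mg : measurable (good s).
  exact: (measurable_good delta x y madj msph t0 t1 Lo Up b s).
apply: (@le_trans _ _ (P ((good s `&` SL) `|` (good s `&` SU)))).
  apply: le_measure; rewrite ?inE.
  - rewrite (_ : _ `&` _ = (good s `&` SL) `|` (good s `&` SU)).
      by apply: measurableU; exact: measurableI.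
    rewrite -setIUr; congr (_ `&` _); apply/seteqP; split => w /=; first by case.
    by split.
  - by apply: measurableU; exact: measurableI.
  - by move=> w [gw [_ [h|h]]]; [left|right].
apply: (le_trans (measureU2 _ _ _)); [exact: measurableI|exact: measurableI|].
rewrite mulr_natl mulr2n EFinD; apply: leeD.
  have [t0s|st0] := leqP t0 s; first exact: (@lower_prob s z SL sn sz t0s mSL (fun w h => h.2)).
  rewrite (_ : _ `&` _ = set0) ?measure0 ?lee_fin ?expR_ge0//.
  by apply/seteqP; split => // w [_ [h _]]; rewrite leqNgt st0 in h.
have [t1s|st1] := leqP t1 s; first exact: (@upper_prob s z SU sn sz t1s mSU (fun w h => h.2)).
rewrite (_ : _ `&` _ = set0) ?measure0 ?lee_fin ?expR_ge0//.
by apply/seteqP; split => // w [_ [h _]]; rewrite leqNgt st1 in h.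
Qed.
End FixedSize.

(** * Exponents and scales *)

Section Exponents.
Variable R : realType.
Implicit Types xi c : R.

(** Let D = c0 - c1 - 1 and q = 1 / (xi + 2). If D <= 0, then c1 >= c0 - 1 >= 0 contradicts the
    upper bound. So D > 0, and 1 - q < 2 (1 - 2 q) means q < 1/3. *)
Lemma xi_gt1_of_window xi c0 c1 : 0 < xi -> 1 <= c0 ->
  (c0 - c1 - 1) * (1 - 1 / (xi + 2)) < c1 ->
  c1 < 2 * (c0 - c1 - 1) * (1 - 2 / (2 + xi)) -> 1 < xi /\ 0 < c1.
Proof.
move=> xi0 c01; rewrite [2 + xi]addrC; set D := c0 - c1 - 1 => h1 h2.
have x2 : 0 < xi + 2 by rewrite addr_gt0.
have q0 : 0 < 1 / (xi + 2) by rewrite divr_gt0.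
have q2 : 1 / (xi + 2) < 1 / 2 by rewrite ltr_pM2l// ltf_pV2 ?posrE// ltrDr.
have q2E : 2 / (xi + 2) = 2 * (1 / (xi + 2)) by rewrite mul1r.
have qx : 1 / (xi + 2) * (xi + 2) = 1 by rewrite mul1r mulVf// gt_eqF.
rewrite q2E in h2; move: (1 / (xi + 2)) q0 q2 h1 h2 qx => q q0 q2 h1 h2 qx.
have D0 : 0 < D.
  rewrite ltNge; apply/negP => D0.
  have : 2 * D * (1 - 2 * q) <= 0 by rewrite mulr_le0_ge0//; lra.
  by move: h2 c01 D0; rewrite /D; lra.
have q3 : 3 * q < 1.
  have : 0 < D * (1 - 3 * q) by lra.
  by rewrite pmulr_rgt0//; lra.
have Dq : 0 < D * (1 - q) by rewrite mulr_gt0//; lra.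
split; last by lra.
rewrite ltNge; apply/negP => x1.
have : q * (xi + 2) <= q * 3 by rewrite ler_pM2l//; lra.
lra.
Qed.

(** 49 is the infimum of (7 + 400 / xi)^2. The bound comes from the twelfth power of exp(1/4) <=
    4/3. *)
Lemma expR3_le49 : expR 3 <= 49 :> R.
Proof.
have e0 := expR_gt0 (4^-1 : R).
have e4 : expR (4^-1 : R) <= 4 / 3.
  have := expR_ge1Dx (- (4^-1) : R); rewrite expRN => h.
  have h2 : 3 / 4 <= (expR (4^-1))^-1 :> R by lra.
  by rewrite -[leLHS]invrK -[leRHS]invf_div lef_pV2 ?posrE ?invr_gt0.
have -> : (3 : R) = 12%:R * 4^-1 by field.
rewrite expRM_natl; apply: (@le_trans _ _ ((4 / 3) ^+ 12)).
  by rewrite lerXn2r ?nnegrE ?(ltW e0)// divr_ge0.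
have -> : (4 / 3 : R) ^+ 12 = ((4 / 3) ^+ 3) ^+ 4 by rewrite -exprM.
have h3 : (4 / 3 : R) ^+ 3 <= 12 / 5 by rewrite !exprS expr0; lra.
apply: (@le_trans _ _ ((12 / 5) ^+ 4)).
  by rewrite lerXn2r ?nnegrE ?exprn_ge0 ?divr_ge0.
by rewrite !exprS expr0; lra.
Qed.

(** e^xi >= (1 + xi / 6)^6, whose expansion contains 15/36 xi^2 + 20/216 xi^3, at least xi^2 / 2 for
    xi >= 1. *)
Lemma quadratic_le_expR xi : 1 <= xi -> xi * (1 + xi / 2) + 1 <= expR xi.
Proof.
move=> x1; have x0 : 0 <= xi by lra.
rewrite [in expR xi](_ : xi = 6%:R * (xi / 6)); last by field.
rewrite expRM_natl; apply: (@le_trans _ _ ((1 + xi / 6) ^+ 6)); last first.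
  rewrite lerXn2r ?nnegrE ?expR_ge0 ?expR_ge1Dx// addr_ge0// divr_ge0//.
have x2 : 0 <= xi * xi by rewrite mulr_ge0.
have x3 : xi * xi <= xi * (xi * xi) by rewrite ler_peMl.
have x4 : 0 <= xi * (xi * (xi * xi)) by rewrite !mulr_ge0.
have x5 : 0 <= xi * (xi * (xi * (xi * xi))) by rewrite !mulr_ge0.
have x6 : 0 <= xi * (xi * (xi * (xi * (xi * xi)))) by rewrite !mulr_ge0.
rewrite !exprS expr0; lra.
Qed.

(* The exponent c2 / (2 c1) of the statement is at most decay xi, since
   ln (1 + xi + xi^2 / 2) <= xi and ln (7 + 400 / xi)^2 >= 3. *)
Definition decay xi : R := xi / (2 * xi + 6).

Lemma decay_le xi c1 : 1 < xi -> 0 < c1 ->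
  c1 * (ln (xi * (1 + xi / 2) + 1) / ln ((7 + 400 / xi) ^+ 2 * (xi * (1 + xi / 2) + 1))) <=
  2 * c1 * decay xi.
Proof.
move=> x1 c10; have x0 : 0 < xi by lra.
set Q := xi * (1 + xi / 2) + 1; set D := (7 + 400 / xi) ^+ 2.
have Q1 : 1 < Q by rewrite ltrDr mulr_gt0// addr_gt0// divr_gt0.
have Q0 : 0 < Q by lra.
have D49 : 49 <= D.
  have y0 : 0 <= 400 / xi by rewrite divr_ge0 ?ler0n// ltW.
  have : 0 <= 400 / xi * (400 / xi) by rewrite mulr_ge0.
  by rewrite /D expr2; lra.
have D0 : 0 < D by lra.
have lnQ : ln Q <= xi by rewrite -[leRHS]expRK ler_ln ?posrE ?expR_gt0//; apply: quadratic_le_expR; exact: ltW.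
have lnQ0 : 0 < ln Q by exact: ln_gt0.
have lnD : 3 <= ln D.
  by rewrite -[leLHS]expRK ler_ln ?posrE ?expR_gt0// (le_trans expR3_le49).
rewrite lnM ?posrE// [2 * c1]mulrC -mulrA ler_pM2l// /decay.
have DQ : 0 < ln D + ln Q by lra.
have xx : 0 < 2 * xi + 6 by lra.
rewrite mulrA ler_pdivlMr// mulrAC ler_pdivrMr//.
have : xi * 3 <= xi * ln D by rewrite ler_pM2l.
lra.
Qed.

Lemma decay01 xi : 1 < xi -> 0 < decay xi < 1.
Proof.
move=> x1; have xx : 0 < 2 * xi + 6 by lra.
by rewrite /decay divr_gt0 ?ltr_pdivrMr// ?mul1r; lra.
Qed.

(** 21/8 is the value at xi = 1. *)
Lemma decay_ge xi : 1 < xi -> 21 / 8 <= (2 + xi) * (1 - decay xi).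
Proof.
move=> x1; have xx : 0 < 2 * xi + 6 by lra.
have -> : (2 + xi) * (1 - decay xi) = (2 + xi) * (xi + 6) / (2 * xi + 6).
  by rewrite /decay; field; rewrite gt_eqF.
rewrite ler_pdivlMr//; have : 0 <= (xi - 1) * (xi + 15 / 4) by rewrite mulr_ge0//; lra.
lra.
Qed.

Lemma decay_power xi : 1 < xi -> 2 * decay xi + 2 / (2 + xi) <= 1.
Proof.
move=> x1; have xx : 0 < 2 * xi + 6 by lra.
have x2 : 0 < 2 + xi by lra.
rewrite -subr_ge0 (_ : _ - _ = xi * 2 / ((2 * xi + 6) * (2 + xi))).
  by rewrite divr_ge0// ?mulr_ge0//; lra.
by rewrite /decay; field; rewrite !gt_eqF.
Qed.

End Exponents.

Section Scales.
Variable R : realType.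
Implicit Types (r a h M kappa c : R) (n : nat).

(** Displays t_r as (ln n)^2 / r^2, which is ln n times the scale of [t1], multiplied by 12 and a
    power of n r^2. *)
Lemma t_minE c0 c1 n r : 0 < r ->
  t_min c0 c1 n r = 12 * ln n%:R ^+ 2 * (n%:R * r ^+ 2) `^ (c1 / c0) / r ^+ 2.
Proof.
move=> r0; rewrite /t_min; set a := c1 / c0.
have -> : r `^ (2 * (1 - a)) = r ^+ 2 * ((r ^+ 2) `^ a)^-1.
  rewrite -powR_mulrn ?(ltW r0)// -powRrM -powRN -powRD; last by rewrite (gt_eqF r0) implybT.
  by congr (_ `^ _); ring.
rewrite powRM ?exprn_ge0 ?(ltW r0)// invfM invrK; ring.
Qed.

Lemma r_min_square c0 n r : 1 <= c0 -> 1 <= ln n%:R :> R -> r_min c0 n <= r ->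
  0 < r /\ ln n%:R ^+ 2 <= n%:R * r ^+ 2.
Proof.
move=> c01 L1.
have n0 : 0 < n%:R :> R.
  by rewrite ltNge; apply/negP => n0; move: L1; rewrite ln0// ler10.
have Lc : ln n%:R <= ln n%:R `^ c0 :> R by exact: le1r_powR.
have p0 : 0 < n%:R `^ (- 2^-1) :> R by exact: powR_gt0.
rewrite /r_min => rr.
have L0 : 0 < ln n%:R :> R by lra.
have h : n%:R `^ (- 2^-1) * ln n%:R <= r by apply: le_trans rr; rewrite ler_pM2l.
have r0 : 0 < r by apply: lt_le_trans h; rewrite mulr_gt0.
split=> //; have -> : ln n%:R ^+ 2 = n%:R * (n%:R `^ (- 2^-1) * ln n%:R) ^+ 2 :> R.
  rewrite exprMn -[(_ `^ _) ^+ 2]powR_mulrn ?powR_ge0// -powRrM mulNr mulVf// powR_inv1 ?ler0n//.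
  by rewrite mulrA mulfV ?mul1r// gt_eqF.
by rewrite ler_pM2l// lerXn2r// nnegrE ltW// mulr_gt0.
Qed.

Lemma ler_wpM2l_inv (x c d : R) : 0 < c -> c <= d -> 0 <= x -> x / d <= x / c.
Proof. by move=> c0 cd x0; rewrite ler_wpM2l// lef_pV2 ?posrE// (lt_le_trans c0). Qed.

(** [t0] is about C ln n / A, which makes the Chernoff exponent a multiple of ln n, and [t1] about
    [G * t0]; both are O(ln n / r^2). The second factor ln n of t_r exceeds [K2 * W] for large n, so
    t is at least [t1 * W * (n r^2)^a], and the power [kappa] of this ratio gives the precision. *)
Lemma scales (C F G M kappa a h c0 : R) : 0 < C -> 0 < F -> 1 <= G -> 1 <= M ->
  0 < kappa < 1 -> 0 <= a -> h <= a * kappa -> 1 <= c0 ->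
  exists L0 : R, forall n r, L0 <= ln n%:R -> r_min c0 n <= r -> r <= pi ->
  exists t0 t1 : nat,
  [/\ (4 <= t0)%N, G * t0%:R <= t1%:R, C * ln n%:R <= cap_area r * t0%:R,
      (t1 <= n)%N -> F * n%:R ^- 2 <= cap_area r * eps kappa t1 n &
      forall t, 12 * ln n%:R ^+ 2 * (n%:R * r ^+ 2) `^ a / r ^+ 2 <= t%:R ->
        (t1 <= t)%N /\ M * eps kappa t1 t < 1 / (n%:R * r ^+ 2) `^ h].
Proof.
move=> C0 F0 G1 M1 kappa01 a0 hak c01.
have /andP[k0 k1] := kappa01; have M0 : 0 < M by lra.
have cc0 := cap_const_gt0 R; set cc := cap_const R in cc0.
(* The 64 pays for rounding [t0] up by at most 4, as r <= pi < 4. *)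
pose K1 := C / cc + 64.
have K10 : 0 < K1 by rewrite addr_gt0 ?divr_gt0.
(* Since [t1 + 1 <= G * t0 + 2 <= (G + 2) * t0]. *)
pose K2 := (G + 2) * K1.
have K20 : 0 < K2 by rewrite mulr_gt0//; lra.
(* Chosen so that its power [kappa] cancels the factor [M] of the relative error. *)
pose W := M `^ kappa^-1.
have W1 : 1 <= W.
  by rewrite -(powRr0 M); apply: ler_powR; [lra|rewrite invr_ge0 ltW].
exists (1 + 2 * F / cc + K2 * W) => n r L0 rmin rpi; set L := ln n%:R in L0 *.
have e1 : 0 < 2 * F / cc by rewrite divr_gt0// mulr_gt0.
have e2 : 0 < K2 * W by rewrite mulr_gt0//; lra.
have L1 : 1 <= L by lra.
have n0 : 0 < n%:R :> R.
  by rewrite ltNge; apply/negP => n0; move: L1; rewrite /L ln0// ler10.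
have [r0 nr] := r_min_square c01 L1 rmin; rewrite -/L in nr.
have r20 : 0 < r ^+ 2 by rewrite exprn_gt0.
have rpi' : 0 < r <= pi by rewrite r0.
have AB := cap_area_ge_square rpi'; rewrite -/cc in AB; set A := cap_area r in AB *.
have ccr : 0 < cc * r ^+ 2 by rewrite mulr_gt0.
have A0 : 0 < A by exact: lt_le_trans AB.
have CLA : 0 <= C * L / A by rewrite divr_ge0 ?mulr_ge0 ?ltW//; lra.
have [t0 t0_ge4 [t0a t0b]] : exists2 t0, (4 <= t0)%N & C * L / A <= t0%:R /\ t0%:R <= C * L / A + 4.
  have /andP[h1 h2] := truncn_itv CLA; exists (Num.truncn (C * L / A)).+4 => //.
  by move: h1 h2; rewrite -!natr1; move: (_ / A) (_%:R) => u v; lra.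
have t0le : t0%:R <= K1 * (L / r ^+ 2).
  apply: (le_trans t0b).
  have h1 : C * L / A <= C * L / (cc * r ^+ 2).
    by apply: ler_wpM2l_inv => //; rewrite mulr_ge0 ?ltW//; lra.
  have h2 : C * L / (cc * r ^+ 2) = C / cc * (L / r ^+ 2) by field; rewrite !gt_eqF.
  have r16 : r ^+ 2 <= 16.
    have := pihalf_lt2 R => p2; have : r <= 4 by lra.
    by rewrite expr2 => r4; nra.
  have h3 : 4 <= 64 * (L / r ^+ 2) by rewrite mulrA ler_pdivlMr//; lra.
  by rewrite /K1 mulrDl; lra.
have Gt0 : 0 <= G * t0%:R by rewrite mulr_ge0//; lra.
have [t1 t1a t1b] : exists2 t1, G * t0%:R <= t1%:R & t1%:R <= G * t0%:R + 1.
  have /andP[h1 h2] := truncn_itv Gt0; exists (Num.truncn (G * t0%:R)).+1; first exact: ltW.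
  by rewrite -natr1 lerD2r.
have t1le : t1.+1%:R <= K2 * (L / r ^+ 2).
  rewrite /K2 -mulrA; apply: (@le_trans _ _ ((G + 2) * t0%:R)); last by rewrite ler_pM2l//; lra.
  have : 1 <= t0%:R :> R by rewrite ler1n (leq_trans _ t0_ge4).
  rewrite -natr1 mulrDl; move: (G * t0%:R) t1b => g; lra.
have t1_gt0 : (0 < t1)%N.
  have t00 : 0 < t0%:R :> R by rewrite ltr0n (leq_trans _ t0_ge4).
  by rewrite -(ltr_nat R); apply: lt_le_trans t1a; rewrite mulr_gt0//; lra.
have Lr0 : 0 < L / r ^+ 2 by rewrite divr_gt0//; lra.
exists t0, t1; split => //.
- by rewrite [leRHS]mulrC -ler_pdivrMr.
(* [t1 >= 1] and [kappa < 1] give eps >= 11/20 / n at time n, while A >= cc ln n / n; their product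
   beats n^(-2) by a factor ln n. *)
- move=> t1n.
  have n1 : 1 <= n%:R :> R by rewrite ler1n (leq_trans t1_gt0 t1n).
  have := eps_ge_power kappa01 t1_gt0 t1n => ep.
  have t1n' : n%:R^-1 <= t1%:R / n%:R :> R by rewrite -[leLHS]mul1r ler_pM2r ?invr_gt0// ler1n.
  have t1n0 : 0 < t1%:R / n%:R :> R by rewrite divr_gt0// ltr0n.
  have t1n1 : t1%:R / n%:R <= 1 :> R by rewrite ler_pdivrMr// mul1r ler_nat.
  have /ger1_powR/(_ (ltW k1)) h1 : 0 < t1%:R / n%:R <= 1 := introT andP (conj t1n0 t1n1).
  have en : 11 / 20 * n%:R^-1 <= eps kappa t1 n.
    by apply: le_trans ep; rewrite ler_pM2l//; lra.
  have An : cc * (L / n%:R) <= A.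
    apply: le_trans AB; rewrite ler_pM2l// ler_pdivrMr// mulrC.
    by apply: le_trans nr; rewrite expr2 ler_peMl//; lra.
  apply: (@le_trans _ _ (cc * (L / n%:R) * (11 / 20 * n%:R^-1))); last first.
    by apply: ler_pM => //; rewrite mulr_ge0 ?divr_ge0 ?invr_ge0//; lra.
  rewrite [leRHS](_ : _ = 11 / 20 * (cc * L) * n%:R ^- 2); last by field; rewrite gt_eqF.
  rewrite ler_wpM2r ?invr_ge0 ?sqr_ge0//.
  have : 2 * F <= L * cc by rewrite -ler_pdivrMr//; lra.
  lra.
move=> t; set Y := (n%:R * r ^+ 2) `^ a => tge.
have nr1 : 1 <= n%:R * r ^+ 2.
  by apply: le_trans nr; rewrite exprn_ege1.
have Y1 : 1 <= Y by rewrite -(powRr0 (n%:R * r ^+ 2)); apply: ler_powR.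
have tge' : K2 * (L / r ^+ 2) * (W * Y) <= t%:R.
  apply: le_trans tge.
  rewrite [leLHS](_ : _ = (K2 * W) * (L / r ^+ 2 * Y)); last by ring.
  rewrite [leRHS](_ : _ = 12 * L * (L / r ^+ 2 * Y)); last by ring.
  have LY : 0 < L / r ^+ 2 * Y by apply: mulr_gt0 => //; lra.
  by rewrite (ler_pM2r LY); lra.
have WY1 : 1 <= W * Y by rewrite mulr_ege1.
have t1t : t1.+1%:R * (W * Y) <= t%:R.
  by apply: le_trans tge'; rewrite ler_pM2r//; lra.
have t1tn : (t1 < t)%N.
  rewrite -(ler_nat R); apply: le_trans t1t.
  by rewrite ler_peMr.
split; first exact: ltnW.
have := eps_le_power kappa01 t1_gt0 (ltnW t1tn) => ep.
have tk : (t1.+1%:R / t.+1%:R) `^ kappa <= (W * Y)^-1 `^ kappa.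
  apply: ge0_ler_powR; rewrite ?(ltW k0) ?nnegrE ?divr_ge0 ?invr_ge0//; first lra.
  rewrite -[leRHS]mul1r ler_pdivlMr; last lra.
  rewrite mulrAC ler_pdivrMr// mul1r; apply: (le_trans t1t); rewrite ler_nat; exact: leqnSn.
have W0 : 0 < W by lra. have Y0 : 0 < Y by lra.
have WYk : (W * Y)^-1 `^ kappa = M^-1 * (Y `^ kappa)^-1.
  rewrite -powR_inv1 ?mulr_ge0 ?ltW// -powRrM mulN1r powRN powRM ?ltW// invfM.
  by rewrite /W -powRrM mulVf ?gt_eqF// powRr1// ltW.
have Yk : (n%:R * r ^+ 2) `^ h <= Y `^ kappa.
  by rewrite /Y -powRrM; apply: ler_powR.
have nrh : 0 < (n%:R * r ^+ 2) `^ h by rewrite powR_gt0//; lra.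
have Yk0 : 0 < Y `^ kappa by exact: powR_gt0.
apply: (@le_lt_trans _ _ (11 / 20 * (Y `^ kappa)^-1)).
  apply: (@le_trans _ _ (M * (11 / 20 * (M^-1 * (Y `^ kappa)^-1)))).
    by rewrite ler_pM2l//; apply: (le_trans ep); rewrite ler_pM2l// -WYk.
  by rewrite le_eqVlt; apply/orP; left; apply/eqP; field; rewrite !gt_eqF.
have : (Y `^ kappa)^-1 <= ((n%:R * r ^+ 2) `^ h)^-1 by rewrite lef_pV2.
have : 0 < (Y `^ kappa)^-1 by rewrite invr_gt0.
rewrite div1r; lra.
Qed.

End Scales.

(** * Conclusion *)

Section WholeSphere.
Variables (R : realType) (n m : nat) (r delta : R).
Hypotheses (delta_gt0 : 0 < delta) (pi_le : pi <= r).

(** All vertices and contacts lie in the cap, so each step adds exactly [2 * m + delta]. *)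
Lemma total_weight_full (x : nat -> vec3 R) (y : nat -> 'I_m -> nat) t u :
  (forall v, (v < t)%N -> cap u r (x v)) ->
  (forall s, (s < t)%N -> contacts_earlier r x y s) ->
  total_weight r delta x y t u = t%:R * (2 * m%:R + delta).
Proof.
elim: t => [_ _|t ih near early]; first by rewrite /total_weight big_nil mul0r.
rewrite total_weightS//.
rewrite ih; last 2 first.
- by move=> v vt; apply: near; exact: ltnW.
- by move=> s st; apply: early; exact: ltnW.
rewrite -[t.+1%:R]natr1 mulrDl mul1r.
rewrite /increment indicE mem_set; last exact: near.
have := early t (ltnSn t); rewrite /contacts_earlier; case: (nilp _) => /=.
  by move=> _; ring.
move=> /forallP yt; rewrite (_ : \sum_(i < m) _ = \sum_(i < m) 1); last first.
  apply: eq_bigr => i _; rewrite big_mkord (bigD1 (Ordinal (yt i)))//= eqxx mul1r indicE mem_set.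
    rewrite big1 ?addr0// => v; rewrite -val_eqE /= eq_sym => /negbTE ->.
    by rewrite mul0r.
  by apply: near; rewrite (ltn_trans (yt i)).
by rewrite sumr_const card_ord; ring.
Qed.

Context d (Omega : measurableType d) (P : probability Omega R).
Variables (x : nat -> {RV P >-> vec3 R}) (y : nat -> 'I_m -> {RV P >-> nat}).
Hypothesis model : base_model r delta x y n.

Let T t w u := total_weight r delta (positions x w) (contacts y w) t u.
Let madj : measurable [set z : vec3 R * vec3 R | cap z.1 r z.2].
Proof. by apply: measurable_adjacency; apply: le_trans pi_le; exact: pi_ge0. Qed.
Let csym u v : sphere u -> sphere v -> cap u r v -> cap v r u := @cap_sym R u v r.

Lemma cap_area_full : (0 < n)%N -> cap_area r = 1.
Proof.
move=> n0; rewrite /cap_area cap_full// -(distribution_area model n0); last exact: measurable_sphere.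
suff e : P (x 0 @^-1` @sphere R) = 1%E by rewrite [X in fine X](_ : _ = 1%E)//; exact: e.
rewrite (_ : _ @^-1` _ = setT) ?probability_setT//.
by apply/seteqP; split => w // _; exact: (on_sphere model).
Qed.

(** [good_prob] is applied to a band that is never left, with q = 0: failing [good] then means that
    some contact is not earlier, a null event. *)
Lemma total_weight_full_ae t u (E : set Omega) : (t <= n)%N -> measurable E ->
  (forall w, E w -> T t w u <> t%:R * (2 * m%:R + delta)) -> P E = 0%E.
Proof.
move=> tn mE Ene.
pose Up s : R := (s * (2 * m * s))%:R + s%:R * delta.
have bad0 s w : bad r delta x y 0 0 (fun=> 0) Up s w = set0.
  apply/seteqP; split => // z [_ [[_ h]|[_ h]]].
    by move: h; rewrite ltNge total_weight_ge0// ltW.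
  by move: h; rewrite ltNge total_weight_ub// ltW.
have := @good_prob _ n m r delta delta_gt0 _ _ _ x y model madj (@measurable_sphere R) csym 0 0
  (fun=> 0) Up 1 ltr01 0 (lexx 0).
have bp s z : (s <= n)%N -> sphere z ->
    (P (good r delta x y 0 0 (fun=> 0%R) Up 1 s `&` [set w | bad r delta x y 0 0 (fun=> 0%R) Up s w z]) <= 0%:E)%E.
  move=> _ _; rewrite (_ : _ `&` _ = set0) ?measure0//.
  by apply/seteqP; split => // w [_]; rewrite /= bad0.
move=> /(_ bp t tn); rewrite mul0r mulr0 => h.
apply/eqP; rewrite eq_le measure_ge0 andbT; apply: le_trans h.
apply: le_measure; rewrite ?inE//.
  by apply/measurableC/measurable_good => //; exact: measurable_sphere.
move=> w Ew gw; apply: (Ene w Ew); apply: total_weight_full.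
  by move=> v vt; rewrite cap_full//; exact: (on_sphere model w (leq_trans vt tn)).
by move=> s st; have /andP[] := gw s st.
Qed.
End WholeSphere.

(** The band is geometric and the deviation additive; below the centre, 1 - e <= 1 / (1 + e). *)
Lemma outside_band (R : realType) (M e Z T : R) : 0 < M -> 0 < e -> 0 < Z ->
  M * e * Z < `|T - M * Z| -> T < M / (1 + e) * Z \/ M * (1 + e) * Z < T.
Proof.
move=> M0 e0 Z0; have [TM|MT] := leP T (M * Z).
  rewrite ler0_norm ?subr_le0// => dev; left.
  apply: (@lt_le_trans _ _ (M * (1 - e) * Z)); first by lra.
  rewrite ler_pM2r// ler_pM2l// -[leRHS]mul1r ler_pdivlMr ?addr_gt0//.
  have := mulr_gt0 e0 e0; lra.
by rewrite ger0_norm ?subr_ge0 ?(ltW MT)// => dev; right; lra.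
Qed.

(** With q = 2 n^(-5) and b = n^(-2), at most n steps contribute 2 n^(-3) each. *)
Lemma total_failure_le (R : realType) (N s : R) : 1 <= N -> s <= N ->
  2 * N ^- 5 + s * (2 * N ^- 5 / N ^- 2) <= 4 / N ^+ 2.
Proof.
move=> N1 sN; have N0 : 0 < N by lra.
rewrite [leLHS](_ : _ = (2 / N ^+ 3 + 2 * (s / N)) / N ^+ 2); last by field; rewrite gt_eqF.
rewrite ler_pM2r ?invr_gt0 ?exprn_gt0//.
have : s / N <= 1 by rewrite ler_pdivrMr// mul1r.
have : (N ^+ 3)^-1 <= 1 by rewrite invf_le1 ?exprn_gt0// exprn_ege1.
lra.
Qed.

Theorem lemma10 (R : realType) (xi : R) (xi_gt0 : 0 < xi) :
  exists K : R, forall c0 c1 c2 : R, K <= c0 ->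
  (c0 - c1 - 1) * (1 - 1 / (xi + 2)) < c1 ->
  c1 < 2 * (c0 - c1 - 1) * (1 - 2 / (2 + xi)) ->
  c2 = c1 * (ln (xi * (1 + xi / 2) + 1)
             / ln ((7 + 400 / xi) ^+ 2 * (xi * (1 + xi / 2) + 1))) ->
  forall (m : nat -> nat) (r : nat -> R),
  (forall n, (0 < m n)%N) ->
  (forall n, r_min c0 n <= r n) ->
  exists (C : R) (N : nat), forall n : nat, (N <= n)%N ->
  forall (d : measure_display) (Omega : measurableType d)
    (P : probability Omega R)
    (x : nat -> {RV P >-> vec3 R})
    (y : nat -> 'I_(m n) -> {RV P >-> nat}),
  base_model (r n) (xi * (m n)%:R) x y n ->
  forall (u : vec3 R) (t : nat), sphere u ->
  t_min c0 c1 n (r n) <= t%:R -> (t <= n)%N ->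
  (P [set w |
       (`| total_weight (r n) (xi * (m n)%:R) (positions x w) (contacts y w) t u
          - (2 + xi) * (m n)%:R * cap_area (r n) * t%:R |
       >= 1 / (n%:R * r n ^+ 2) `^ (c2 / (2 * c0))
          * ((m n)%:R * cap_area (r n) * t%:R))%R]
     <= (C / n%:R ^+ 2)%R%:E)%E.
Proof.
(* c0 >= 1 serves twice: it lets the window force xi > 1, and it gives (ln n)^c0 >= ln n once ln n
   >= 1. *)
exists 1 => c0 c1 c2 c01 h1 h2 c2E m r m_gt0 rmin.
have [xi_gt1 c10] := xi_gt1_of_window xi_gt0 c01 h1 h2.
have c00 : 0 < c0 by rewrite (lt_le_trans ltr01).
have kappa01 := decay01 xi_gt1; have Mk := decay_ge xi_gt1; have kM := decay_power xi_gt1.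
have a0 : 0 <= c1 / c0 by rewrite divr_ge0// ltW.
have hak : c2 / (2 * c0) <= c1 / c0 * decay xi.
  rewrite ler_pdivrMr ?mulr_gt0//; apply: (@le_trans _ _ (2 * c1 * decay xi)).
    by rewrite c2E; exact: decay_le.
  by rewrite le_eqVlt; apply/orP; left; apply/eqP; field; rewrite gt_eqF.
pose M := 2 + xi; have M0 : 0 < M by rewrite addr_gt0.
have M1 : 1 <= M by rewrite /M; lra.
(* 10^7 = 2 * 10^6 * 5 belongs to the exponent 5 ln n, and 2000 M to the threshold b = n^(-2). *)
have C0 : 0 < 10 ^+ 7 * M by rewrite mulr_gt0// exprn_gt0// ltr0n.
have F0 : 0 < 2000 * M by apply: mulr_gt0 M0; rewrite ltr0n.
have G1 : 1 <= 120 ^+ 6 :> R by rewrite exprn_ege1// ler1n.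
have [L0 HL0] := scales C0 F0 G1 M1 kappa01 a0 hak c01.
exists 4, (Num.truncn (expR (Num.max L0 1))).+1 => n Nn d Omega P x y model u t su tmin tn.
have nexp : expR (Num.max L0 1) <= n%:R.
  by apply: (le_trans (ltW (truncnS_gt _))); rewrite ler_nat.
have n0 : 0 < n%:R :> R by apply: lt_le_trans nexp; exact: expR_gt0.
have n0' : (0 < n)%N by rewrite -(ltr0n R).
have n1 : 1 <= n%:R :> R by rewrite ler1n.
have Lmax : Num.max L0 1 <= ln n%:R by rewrite -[leLHS]expRK ler_ln ?posrE// expR_gt0.
have [L0le L1] : L0 <= ln n%:R /\ 1 <= ln n%:R :> R.
  by move: Lmax; rewrite ge_max => /andP[].
have [r0 nr] := r_min_square c01 L1 (rmin n).
have nr0 : 0 < n%:R * r n ^+ 2 by rewrite mulr_gt0// exprn_gt0.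
have m0 : 0 < (m n)%:R :> R by rewrite ltr0n.
have delta0 : 0 < xi * (m n)%:R by rewrite mulr_gt0.
have thr0 : 0 < 1 / (n%:R * r n ^+ 2) `^ (c2 / (2 * c0)) by rewrite divr_gt0// powR_gt0.
rewrite t_minE// in tmin.
have ln0 : 0 < ln n%:R :> R by apply: lt_le_trans L1.
have t0 : 0 < t%:R :> R.
  by apply: lt_le_trans tmin; rewrite divr_gt0 ?mulr_gt0 ?exprn_gt0 ?powR_gt0.
have madj : measurable [set z : vec3 R * vec3 R | cap z.1 (r n) z.2].
  by apply: measurable_adjacency; exact: ltW.
have mT : measurable_fun setT (fun w => total_weight (r n) (xi * (m n)%:R) (positions x w) (contacts y w) t u).
  by have := @past_total_weight R (m n) (r n) (xi * (m n)%:R) _ _ P x y madj t u => /past_measurable.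
set E := (X in P X).
have mE : measurable E.
  rewrite -[X in measurable X]setTI; apply: measurable_fun_ler => //.
  apply: measurableT_comp => //; apply: measurable_funB => //.
have C4 : 0 <= 4 / n%:R ^+ 2 :> R by rewrite divr_ge0 ?sqr_ge0.
(* For r >= pi the weight is almost surely equal to the centre of the band, while the allowed
   deviation is positive. *)
have [rpi|pir] := ltP (r n) pi; last first.
  rewrite (@total_weight_full_ae _ n (m n) (r n) _ delta0 pir _ _ _ x y model t u)//.
  move=> w; rewrite /E /= (cap_area_full pir model n0') !mulr1 => /[swap] ->.
  rewrite (_ : _ - _ = 0); last by ring.
  by rewrite normr0 leNgt mulr_gt0// mulr_gt0.
have [t0' [t1 [t0_ge4 t01 ll bl Hlate]]] := HL0 n (r n) L0le (rmin n) (ltW rpi).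
have [t1t Meps] := Hlate t tmin.
have r_pi : 0 < r n <= pi by rewrite r0 ltW.
have A0 : 0 < cap_area (r n).
  by apply: lt_le_trans (cap_area_ge_square r_pi); rewrite mulr_gt0 ?cap_const_gt0// exprn_gt0.
have b0 : 0 < n%:R ^- 2 :> R by rewrite invr_gt0 exprn_gt0.
have ble : 2000 * (M * n%:R ^- 2) <= cap_area (r n) * eps (decay xi) t1 n.
  by rewrite mulrA; exact: bl (leq_trans t1t tn).
have lle : 2 * 10 ^+ 6 * (M * (5 * ln n%:R)) <= cap_area (r n) * t0'%:R.
  apply: le_trans ll; rewrite le_eqVlt; apply/orP; left; apply/eqP; rewrite !exprS; ring.
have := @total_weight_concentration R n (m n) (r n) xi (decay xi) (n%:R ^- 2) (5 * ln n%:R) t0' t1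
  (m_gt0 n) xi_gt1 r_pi kappa01 Mk kM t0_ge4 t01 b0 A0 ble lle _ _ _ x y model t u tn su.
set B := (X in P X); move=> Bp.
apply: (@le_trans _ _ (P B)).
  apply: le_measure; rewrite ?inE//.
    by apply: measurable_bad_event => //; exact: measurable_sphere.
  move=> w; rewrite /E /B /bad /= => dev; split => //.
  set T := total_weight _ _ _ _ _ _ in dev *.
  set e := eps _ _ _ in Meps *.
  have e0 : 0 < e by exact: eps_gt0.
  have mAt : 0 < (m n)%:R * cap_area (r n) * t%:R by rewrite !mulr_gt0.
  have lowE : (m n)%:R * cap_area (r n) * ((2 + xi) / (1 + e) * t%:R) =
      M / (1 + e) * ((m n)%:R * cap_area (r n) * t%:R) by rewrite /M; ring.
  have upE : (m n)%:R * cap_area (r n) * ((2 + xi) * (1 + e) * t%:R) =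
      M * (1 + e) * ((m n)%:R * cap_area (r n) * t%:R) by rewrite /M; ring.
  have devE : (2 + xi) * (m n)%:R * cap_area (r n) * t%:R =
      M * ((m n)%:R * cap_area (r n) * t%:R) by rewrite /M; ring.
  rewrite lowE upE; rewrite devE in dev.
  have [] := @outside_band R M e _ T M0 e0 mAt; first by apply: lt_le_trans dev; rewrite ltr_pM2r.
    left; split => //; apply: leq_trans t1t; rewrite -(ler_nat R); apply: le_trans t01.
    by rewrite ler_peMl.
  by right.
apply: (le_trans Bp); rewrite lee_fin.
have -> : expR (- (5 * ln n%:R)) = n%:R ^- 5 :> R by rewrite expRN expRM_natl lnK.
by apply: total_failure_le; rewrite ?ler_nat.
Qed.
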